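(* Let $d\ge 1$ and consider the system of evolution equations $$\partial_t u = A(u,\nabla_x u)$$ for a vector-valued function $u=u(t,x)$, $x\in\mathbb{T}^d$, $t\ge 0$. Assume that the function $A(\cdot,\cdot)$ satisfies $$Gen[A(u,\nabla_x u)] \le C_0\, F(Gen[u])\,\bigl(1+\partial_z Gen[u]\bigr)$$ for some constant $C_0$ and some analytic function $F$ (the inequality being understood for all functions $u$ on $\mathbb{T}^d$ and all $z\ge 0$ for which the quantities involved are defined). Let $\rho>0$ and let $u_0\in X_\rho$. Then there exists a (large) positive constant $C_1$, depending on $u_0$, such that, setting $\rho(t)=\rho-C_1t$, the Cauchy problem for $\partial_t u=A(u,\nabla_x u)$ with initial data $u(0,\cdot)=u_0$ has a unique solution $u(t)\in X_{\rho(t)}$ for positive times $t$ as long as $\rho(t)$ remains positive.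
   Context: For a (scalar- or vector-valued) function $f$ on the torus $\mathbb{T}^d$ (possibly depending also on $t$), with Fourier coefficients $f_\alpha$, $\alpha\in\mathbb{Z}^d$ (so that $f(x)=\sum_{\alpha\in\mathbb{Z}^d} f_\alpha e^{i\alpha\cdot x}$), the generator function of $f$ is $$Gen[f](z)=\sum_{\alpha\in\mathbb{Z}^d} e^{z|\alpha|}\,|f_\alpha|,$$ where $|\alpha|$ is the Euclidean norm of $\alpha$ and $|f_\alpha|$ is the modulus (Euclidean norm for vectors) of $f_\alpha$. If $f$ is analytic in $x$, $Gen[f](z)$ is only defined (finite) for small enough $z$. For $\rho>0$ the function space $X_\rho$ is $$X_\rho=\{u : Gen[u](\rho)<\infty\}.$$ *)

(* Defs.v *)
From HB Require Import structures.
From mathcomp Require Import all_boot all_order all_algebra.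
From mathcomp Require Import finmap.
From mathcomp Require Import all_classical all_reals all_analysis.
From mathcomp Require Import complex.

Set Implicit Arguments.
Unset Strict Implicit.
Unset Printing Implicit Defensive.

Import Order.TTheory GRing.Theory Num.Theory.
Import numFieldNormedType.Exports.

Local Open Scope classical_set_scope.
Local Open Scope ring_scope.

(* A function on the torus T^d = (R / 2 pi Z)^d is given by its lift
   'rV[R]_d -> 'rV[R]_n; the 2 pi-periodicity of the lift is a consequence of
   fourier_series below. *)

Section FourierSeries.
Context {R : realType}.

Definition expi (theta : R) : R[i] := (cos theta +i* sin theta)%C.

Definition freq_dot (d : nat) (a : 'rV[int]_d) (x : 'rV[R]_d) : R :=
  \sum_(j < d) (a 0 j)%:~R * x 0 j.

Definition freq_norm (d : nat) (a : 'rV[int]_d) : R :=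
  Num.sqrt (\sum_(j < d) (a 0 j)%:~R ^+ 2).

(* The library norm on matrices is the sup norm, hence this definition. *)
Definition euclid_norm (n : nat) (v : 'rV[R[i]]_n) : R :=
  Num.sqrt (\sum_(i < n) (complex.Re (v 0 i) ^+ 2 + complex.Im (v 0 i) ^+ 2)).

(* Unordered convergence: R[i] carries no topology in the library, so the limit
   along finite index sets is spelled out. *)
Definition has_sum (I : choiceType) (a : I -> R[i]) (l : R[i]) : Prop :=
  forall e : R, 0 < e -> exists J0 : {fset I}, forall J : {fset I},
    (J0 `<=` J)%fset -> `| \sum_(i <- J) a i - l | < e%:C%C.

(* f(x) = \sum_a c_a e^{i a.x} at every x, the series converging absolutely. *)
Definition fourier_series (d n : nat) (f : 'rV[R]_d -> 'rV[R]_n)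
    (c : 'rV[int]_d -> 'rV[R[i]]_n) : Prop :=
  (\esum_(a in [set: 'rV[int]_d]) (euclid_norm (c a))%:E < +oo)%E /\
  forall x i, has_sum (fun a => c a 0 i * expi (freq_dot a x)) (f x 0 i)%:C%C.

(* The coefficients of an absolutely convergent Fourier series are determined by
   its sum, so that there is at most one candidate for xget to choose. *)
Definition fourier_coef (d n : nat) (f : 'rV[R]_d -> 'rV[R]_n) :
    'rV[int]_d -> 'rV[R[i]]_n :=
  xget (fun=> 0) [set c | fourier_series f c].

(* For z >= 0 a finite value of Gen[f](z) forces the Fourier series of f to
   converge absolutely; +oo is the value for the functions f that are not
   everywhere the sum of such a series. *)
Definition Gen (d n : nat) (f : 'rV[R]_d -> 'rV[R]_n) (z : R) : \bar R :=
  if `[< exists c, fourier_series f c >] then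
    (\esum_(a in [set: 'rV[int]_d])
       (expR (z * freq_norm a) * euclid_norm (fourier_coef f a))%:E)%E
  else +oo%E.

Definition realGen (d n : nat) (f : 'rV[R]_d -> 'rV[R]_n) (z : R) : R :=
  fine (Gen f z).

Definition Xspace (d n : nat) (rho : R) : set ('rV[R]_d -> 'rV[R]_n) :=
  [set u | (Gen u rho < +oo)%E].

End FourierSeries.

Section Evolution.
Context {R : realType}.

Definition analytic_at (F : R -> R) (y : R) : Prop :=
  exists (a : R^nat) (r : R), 0 < r /\
    forall h, `|h| < r ->
      series (fun k => a k * h ^+ k) @ \oo --> F (y + h).

(* The gradient of u is the matrix with entries (grad u)_(j, i) = d_j u_i. *)
Definition apply_grad (d n : nat) (A : 'rV[R]_n -> 'M[R]_(d, n) -> 'rV[R]_n)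
    (u : 'rV[R]_d -> 'rV[R]_n) : 'rV[R]_d -> 'rV[R]_n :=
  fun x => A (u x) (jacobian u x).

(* The left-hand side is extended real: the bound asserts in particular that
   Gen[A(u, grad u)](z) is finite. On the right, finiteness of Gen[u](z) and
   differentiability of Gen[u] at z say that both quantities are defined; when
   z >= 0 this makes u analytic, so that jacobian u is its actual gradient. *)
Definition Gen_bound (d n : nat) (A : 'rV[R]_n -> 'M[R]_(d, n) -> 'rV[R]_n)
    (C0 : R) (F : R -> R) : Prop :=
  forall (u : 'rV[R]_d -> 'rV[R]_n) (z : R), 0 <= z ->
    (Gen u z < +oo)%E -> derivable (realGen u) z 1 ->
    (Gen (apply_grad A u) z <=
       (C0 * F (realGen u z) * (1 + derive1 (realGen u) z))%:E)%E.

(* u : [0, T[ -> functions on the torus, where rhot is positive exactly on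
   [0, T[; the values of u at other times are irrelevant. *)
Definition solution (d n : nat) (A : 'rV[R]_n -> 'M[R]_(d, n) -> 'rV[R]_n)
    (u0 : 'rV[R]_d -> 'rV[R]_n) (rhot : R -> R)
    (u : R -> 'rV[R]_d -> 'rV[R]_n) : Prop :=
  [/\ u 0 = u0,
      forall t, 0 <= t -> 0 < rhot t -> Xspace (rhot t) (u t),
      forall t r, 0 <= t -> 0 <= r -> r < rhot t ->
        Gen (u s \- u t) r @[s --> within [set s | 0 <= s] (nbhs t)] --> 0%E
    & forall t x, 0 < t -> 0 < rhot t ->
        is_derive t 1 (fun s => u s x) (apply_grad A (u t) x)].

End Evolution.

(* Main.v *)
Require Import Defs.
From HB Require Import structures.
From mathcomp Require Import all_boot all_order all_algebra.
From mathcomp Require Import finmap.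
From mathcomp Require Import all_classical all_reals all_analysis.
From mathcomp Require Import complex.
From mathcomp Require Import ring lra zify.
Set Implicit Arguments.
Unset Strict Implicit.
Unset Printing Implicit Defensive.
Import Order.TTheory GRing.Theory Num.Theory.
Import numFieldNormedType.Exports.
Local Open Scope classical_set_scope.
Local Open Scope ring_scope.

(** The hypothesis bounds the image of every function under the nonlinearity, and
    thereby determines the form of the nonlinearity. Test it on trigonometric
    polynomials ([trigp_bound]). Two of them with the same 1-jet at a point close
    to the origin show that [A (u, p)] is continuous in [u] ([A_continuous]). Add to
    a constant [a] an oscillation of high frequency and small amplitude: the
    gradient runs through an ellipse while the function stays close to [a], and
    because the bound grows linearly in the derivative of [Gen], the second
    harmonics disappear in the limit. Hence [A (u, p)] is affine in [p]
    ([A_affine]). Finally, let the components of the test function be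
    [S cos (t_i + k_i x_j)]. The Fourier coefficients of its image decay like
    [e^(- z |m|)] for every [z], uniformly in the phases, so that [A (c, 0)] and the
    coefficients of [p] in [A (c, p)] have Chebyshev expansions in [c] that converge
    geometrically, at any rate and on cubes of any size ([zeroth_order_expandable],
    [gradient_coef_expandable]). The equation thus is

      [d_t u = a (u) + sum_j b_j (u) d_j u]

    where [a] and the [b_j] operate, as Lipschitz continuous maps on bounded sets,
    on every weighted convolution algebra of coefficients
    ([expandable_operates]).

    For existence, expand [u] in the monomials [e^{i al.x} t^k] and let the weight
    of a monomial be the maximum of [e^((rho - C1 t) |al|) t^k] over the life span
    [[0, rho / C1]]. These weights are submultiplicative, and the norm bounds
    [Gen (rho - C1 t)] for all [t]. The point of this choice is that the primitive
    in time of [f d_j g] has at most the norm of [f] times that of [g], divided by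
    [C1] ([evol_weight_deriv], [primitive_prod]): the derivative multiplies by [|al|],
    the primitive divides by the degree in [t], and the shrinking radius relates
    the two. For large [C1] the integral equation is therefore a contraction of a
    ball of the algebra ([picard]), and its fixed point is a solution ([existence]).

    Another solution need not have an expansion in powers of [t]. For uniqueness,
    compare two solutions on the scale of the norms [Gen r], where a derivative
    costs a loss of radius. A mean value inequality for these norms follows from
    pointwise differentiability in time alone, by means of averages over finite
    grids ([mean_value]). If two solutions agree at some time, [p] integrations,
    each with the loss [r0 / p] of radius, bound their difference after the time
    [h] by a constant times [(L p h / r0)^p / p!], which tends to [0] as [p] grows
    if [h] is small ([local_uniqueness]). By continuity the solutions agree as
    long as the radius is positive ([solution_uniq]). *)

(** * Absolutely convergent sums *)

Notation nc := (@ComplexField.Normc.normc _).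

Ltac nonneg := repeat first [assumption | done | apply: addr_ge0
  | apply: mulr_ge0 | apply: expR_ge0 | apply: normr_ge0 | apply: sqr_ge0
  | apply: ler0n ].

Section Modulus.
Context {R : realType}.
Implicit Types (z : R[i]) (x : R).

Lemma ncE z : `|z| = (nc z)%:C%C.
Proof. by case: z. Qed.

Lemma nc_ge0 z : 0 <= nc z.
Proof. by case: z => a b /=; rewrite sqrtr_ge0. Qed.

Lemma nc0 : nc (0 : R[i]) = 0.
Proof. by rewrite /ComplexField.Normc.normc /= expr0n /= addr0 sqrtr0. Qed.

Lemma ncM z1 z2 : nc (z1 * z2) = nc z1 * nc z2.
Proof. exact: ComplexField.Normc.normcM. Qed.

Lemma ncD z1 z2 : nc (z1 + z2) <= nc z1 + nc z2.
Proof. by rewrite -lecR rmorphD /= -!ncE ler_normD. Qed.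

Lemma ncN z : nc (- z) = nc z.
Proof. by apply: complexI; rewrite -!ncE normrN. Qed.

Lemma ncB z1 z2 : nc (z1 - z2) = nc (z2 - z1).
Proof. by rewrite -ncN opprB. Qed.

Lemma nc_eq0 z : nc z = 0 -> z = 0.
Proof. exact: ComplexField.Normc.eq0_normc. Qed.

Lemma ncR x : nc (x%:C%C : R[i]) = `|x|.
Proof. by rewrite /= expr0n /= addr0 sqrtr_sqr. Qed.

Lemma nc_Re z : `|complex.Re z| <= nc z.
Proof.
case: z => a b /=; rewrite -sqrtr_sqr ler_sqrt ?addr_ge0 ?sqr_ge0 //.
by rewrite lerDl sqr_ge0.
Qed.

Lemma nc_Im z : `|complex.Im z| <= nc z.
Proof.
case: z => a b /=; rewrite -sqrtr_sqr ler_sqrt ?addr_ge0 ?sqr_ge0 //.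
by rewrite lerDr sqr_ge0.
Qed.

Lemma nc_ReIm z : nc z <= `|complex.Re z| + `|complex.Im z|.
Proof.
rewrite {1}(complexE z); apply: le_trans (ncD _ _) _.
rewrite ncM !ncR; suff -> : nc ('i%C : R[i]) = 1 by rewrite mul1r.
by rewrite /= expr0n /= add0r expr1n sqrtr1.
Qed.

Lemma nc_sum (I : Type) (r : seq I) (P : pred I) (F : I -> R[i]) :
  nc (\sum_(i <- r | P i) F i) <= \sum_(i <- r | P i) nc (F i).
Proof.
elim/big_ind2: _ => //; first by rewrite nc0.
by move=> x1 x2 y1 y2 h1 h2; apply: le_trans (ncD _ _) (lerD _ _).
Qed.

End Modulus.

Section Sums.
Context {R : realType}.

(** A bound for all finite partial sums of a nonnegative family: the same as
  [\esum_i a i <= K], but finite sums keep the estimates inside [R]. *)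
Definition bsum (I : choiceType) (a : I -> R) (K : R) : Prop :=
  forall J : {fset I}, \sum_(i <- J) a i <= K.

(** [has_sum], with the distances measured in [R]. *)
Definition hsum (I : choiceType) (a : I -> R[i]) (l : R[i]) : Prop :=
  forall e : R, 0 < e -> exists J0 : {fset I}, forall J : {fset I},
    (J0 `<=` J)%fset -> nc (\sum_(i <- J) a i - l) < e.

Lemma has_sumP (I : choiceType) (a : I -> R[i]) l : has_sum a l <-> hsum a l.
Proof.
by split=> h e /h [J0 hJ]; exists J0 => J /hJ; rewrite ?ncE ltcR.
Qed.

Section OneIndex.
Context {I : choiceType}.
Implicit Types (a b : I -> R[i]) (p q : I -> R).

Lemma fsum_sub p (J0 J : {fset I}) : (J0 `<=` J)%fset ->
  \sum_(i <- J) p i = \sum_(i <- J0) p i + \sum_(i <- J | i \notin J0) p i.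
Proof.
move=> sJ; rewrite (bigID (mem J0)) /=; congr (_ + _).
rewrite -big_filter; apply: perm_big; apply: uniq_perm => //.
  by rewrite filter_uniq.
move=> i; rewrite mem_filter; apply/andP/idP => [[]//|iJ].
by split=> //; apply: (fsubsetP sJ).
Qed.

Lemma fsumC_sub a (J0 J : {fset I}) : (J0 `<=` J)%fset ->
  \sum_(i <- J) a i = \sum_(i <- J0) a i + \sum_(i <- J | i \notin J0) a i.
Proof.
move=> sJ; rewrite (bigID (mem J0)) /=; congr (_ + _).
rewrite -big_filter; apply: perm_big; apply: uniq_perm => //.
  by rewrite filter_uniq.
move=> i; rewrite mem_filter; apply/andP/idP => [[]//|iJ].
by split=> //; apply: (fsubsetP sJ).
Qed.

Lemma bsum_ge0 p K : bsum p K -> 0 <= K.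
Proof. by move/(_ fset0); rewrite big_seq_fset0. Qed.

Lemma bsum_le p K K' : bsum p K -> K <= K' -> bsum p K'.
Proof. by move=> h hK J; apply: le_trans (h J) hK. Qed.

Lemma le_bsum p q K : (forall i, p i <= q i) -> bsum q K -> bsum p K.
Proof. by move=> h hK J; apply: le_trans (hK J); apply: ler_sum. Qed.

Lemma bsumZ p K k : 0 <= k -> bsum p K -> bsum (fun i => k * p i) (k * K).
Proof. by move=> k0 h J; rewrite -mulr_sumr ler_wpM2l. Qed.

Lemma bsumD p q K L : bsum p K -> bsum q L -> bsum (fun i => p i + q i) (K + L).
Proof. by move=> hp hq J; rewrite big_split lerD. Qed.

(** A finite set whose sum comes close to the supremum leaves little for the
    finite sums outside it. *)
Lemma bsum_tail p K e : (forall i, 0 <= p i) -> bsum p K -> 0 < e ->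
  exists J0 : {fset I}, forall J : {fset I},
    \sum_(i <- J | i \notin J0) p i < e.
Proof.
move=> p0 hK e0; pose E := [set \sum_(i <- J) p i | J in @setT {fset I}].
have supE : has_sup E.
  split; first by exists (\sum_(i <- fset0) p i), fset0.
  by exists K => _ [J _ <-].
have [_ [J0 _ <-] hJ0] := sup_adherent e0 supE.
exists J0 => J.
have : \sum_(i <- (J0 `|` J)%fset) p i <= sup E.
  by apply: ub_le_sup; [case: supE|exists (J0 `|` J)%fset].
rewrite (fsum_sub _ (fsubsetUl J0 J)).
suff -> : \sum_(i <- (J0 `|` J)%fset | i \notin J0) p i
        = \sum_(i <- J | i \notin J0) p i.
  move: hJ0; generalize (sup E) (\sum_(i <- J0) p i) => s x h1 h2.
  by rewrite ltrBlDr in h1; rewrite -(ltrD2l x); apply: le_lt_trans h2 h1.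
rewrite -[LHS]big_filter -[RHS]big_filter; apply: perm_big; apply: uniq_perm; rewrite ?filter_uniq //.
move=> i; rewrite !mem_filter in_fsetU; case: (i \in J0) => //=.
Qed.

Lemma hsum_uniq a l l' : hsum a l -> hsum a l' -> l = l'.
Proof.
move=> h h'; apply/eqP; rewrite -subr_eq0; apply/eqP/nc_eq0/eqP.
rewrite eq_le nc_ge0 andbT; apply/ler_addgt0Pl => e e0; rewrite addr0.
have e2 : 0 < e / 2 by rewrite divr_gt0.
have [J hJ] := h _ e2; have [J' hJ'] := h' _ e2.
have := hJ _ (fsubsetUl J J'); have := hJ' _ (fsubsetUr J J').
set s := \sum_(i <- _) _ => h1 h2.
have -> : l - l' = (s - l') + (l - s) by ring.
apply: le_trans (ncD _ _) _; rewrite (ncB l); lra.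
Qed.

Lemma eq_hsum a b l : (forall i, a i = b i) -> hsum a l -> hsum b l.
Proof. by move=> /funext ->. Qed.

Lemma hsumD a b l m : hsum a l -> hsum b m ->
  hsum (fun i => a i + b i) (l + m).
Proof.
move=> h h' e e0; have e2 : 0 < e / 2 by rewrite divr_gt0.
have [J hJ] := h _ e2; have [J' hJ'] := h' _ e2.
exists (J `|` J')%fset => K; rewrite fsubUset => /andP[/hJ h1 /hJ' h2].
rewrite big_split /= opprD addrACA.
by apply: le_lt_trans (ncD _ _) _; rewrite [e]splitr ltrD.
Qed.

Lemma hsumZ a l k : hsum a l -> hsum (fun i => k * a i) (k * l).
Proof.
move=> h e e0.
have e2 : 0 < e / (nc k + 1) by rewrite divr_gt0 // ltr_wpDl ?nc_ge0.
have [J hJ] := h _ e2.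
exists J => K /hJ h1; rewrite -mulr_sumr -mulrBr ncM.
have k0 : 0 < nc k + 1 by rewrite ltr_wpDl ?nc_ge0.
move: h1; rewrite ltr_pdivlMr //; set x := nc (_ - _) => h1.
have x0 : 0 <= x by exact: nc_ge0.
apply: le_lt_trans h1; rewrite mulrDr mulr1 mulrC lerDl //.
Qed.

Lemma hsum0 : hsum (fun _ : I => 0) 0.
Proof. by move=> e e0; exists fset0 => J _; rewrite big1 // subrr nc0. Qed.

Lemma hsumB a b l m : hsum a l -> hsum b m ->
  hsum (fun i => a i - b i) (l - m).
Proof.
move=> ha hb; have := hsumD ha (hsumZ (-1) hb).
by rewrite mulN1r; apply: eq_hsum => i; rewrite mulN1r.
Qed.

Lemma hsum_finsum (T : Type) (r : seq T) (a : T -> I -> R[i]) (l : T -> R[i]) :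
  (forall t, hsum (a t) (l t)) ->
  hsum (fun i => \sum_(t <- r) a t i) (\sum_(t <- r) l t).
Proof.
move=> h; elim: r => [|t r IH].
  by rewrite big_nil; apply: eq_hsum hsum0 => i; rewrite big_nil.
by rewrite big_cons; apply: eq_hsum (hsumD (h t) IH) => i; rewrite big_cons.
Qed.

Lemma hsum_norm a l K : hsum a l -> bsum (fun i => nc (a i)) K -> nc l <= K.
Proof.
move=> h hK; apply/ler_addgt0Pl => e e0; have [J hJ] := h _ e0.
have := hJ _ (fsubset_refl J); set s := \sum_(i <- _) _ => h1.
have -> : l = (l - s) + s by ring.
apply: le_trans (ncD _ _) _; rewrite ncB; apply: lerD; first exact: ltW.
exact: le_trans (nc_sum _ _ _) (hK J).
Qed.

Lemma hsum_fin a (J : {fset I}) : (forall i, i \notin J -> a i = 0) ->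
  hsum a (\sum_(i <- J) a i).
Proof.
move=> h e e0; exists J => K sJ; rewrite (fsumC_sub _ sJ) addrC addKr.
by rewrite big1 ?nc0 // => i; apply: h.
Qed.

Lemma hsum_nonneg p K : (forall i, 0 <= p i) -> bsum p K ->
  exists l, hsum (fun i => (p i)%:C%C) l%:C%C.
Proof.
move=> p0 hK; pose E := [set \sum_(i <- J) p i | J in @setT {fset I}].
have supE : has_sup E.
  split; first by exists (\sum_(i <- fset0) p i), fset0.
  by exists K => _ [J _ <-].
exists (sup E) => e e0; have [_ [J0 _ <-] hJ0] := sup_adherent e0 supE.
exists J0 => J sJ; rewrite -rmorph_sum -rmorphB ncR.
set y := (X in `|X - _|).
have h3 : y <= sup E by apply: ub_le_sup; [case: supE|exists J].
have h2 : \sum_(i <- J0) p i <= y.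
  by rewrite /y (fsum_sub _ sJ) lerDl; apply: sumr_ge0.
rewrite ler0_norm ?subr_le0 // opprB ltrBlDl -ltrBlDr.
exact: lt_le_trans hJ0 h2.
Qed.

Lemma hsum_real p K : bsum (fun i => `|p i|) K ->
  exists l, hsum (fun i => (p i)%:C%C) l%:C%C.
Proof.
move=> hK.
have [l hl] := hsum_nonneg (fun i => normr_ge0 (p i)) hK.
have h2 : bsum (fun i => p i + `|p i|) (K + K).
  by apply: le_bsum (bsumD hK hK) => i; rewrite lerD2r ler_norm.
have [|m hm] := hsum_nonneg _ h2.
  by move=> i; rewrite -lerBlDr sub0r lerNl -normrN ler_norm.
exists (m - l); rewrite rmorphB; apply: eq_hsum (hsumB hm hl) => i.
by rewrite -rmorphB addrK.
Qed.

Lemma hsum_ex a K : bsum (fun i => nc (a i)) K -> exists l, hsum a l.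
Proof.
move=> hK.
have [|x hx] := @hsum_real (fun i => complex.Re (a i)) K.
  by apply: le_bsum hK => i; apply: nc_Re.
have [|y hy] := @hsum_real (fun i => complex.Im (a i)) K.
  by apply: le_bsum hK => i; apply: nc_Im.
exists (x%:C + 'i * y%:C)%C; apply: eq_hsum (hsumD hx (hsumZ 'i%C hy)) => i.
by rewrite -complexE.
Qed.

End OneIndex.

Section TwoIndices.
Context {I J : choiceType}.
Implicit Types (a : I -> R[i]) (g : I -> J).

Definition fiber g a (j : J) : I -> R[i] := fun i => if g i == j then a i else 0.

Lemma sum_pred1_fset (V : zmodType) (Q : {fset J}) (k : J) (v : V) :
  \sum_(j <- Q) (if k == j then v else 0) = if k \in Q then v else 0.
Proof.
case: ifP => kQ.
  rewrite (big_fsetD1 k) //= eqxx big1_fset ?addr0 // => j.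
  by rewrite in_fsetD1 => /andP[/negPf]; rewrite eq_sym => ->.
rewrite big1_fset // => j jQ _; case: eqP => // kj.
by rewrite kj jQ in kQ.
Qed.

Lemma fiber_bsum g a K j : bsum (fun i => nc (a i)) K ->
  bsum (fun i => nc (fiber g a j i)) K.
Proof.
by apply: le_bsum => i; rewrite /fiber; case: ifP => _; rewrite ?nc0 ?nc_ge0.
Qed.

(** Regrouping: the sums over the fibers of [g] have the same total sum. *)
Lemma hsum_fiber g a l (s : J -> R[i]) K : bsum (fun i => nc (a i)) K ->
  hsum a l -> (forall j, hsum (fiber g a j) (s j)) -> hsum s l.
Proof.
move=> hK hl hs e e0; have e2 : 0 < e / 2 by rewrite divr_gt0.
have [J0 hJ0] := bsum_tail (fun i => nc_ge0 (a i)) hK e2.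
exists [fset g i | i in J0]%fset => Q sQ.
have h1 := hsumB (hsum_finsum Q hs) hl.
apply: le_lt_trans (hsum_norm (K := e / 2) h1 _) _; last first.
  by rewrite ltr_pdivrMr // ltr_pMr // ltr1n.
move=> P; apply: le_trans (ltW (hJ0 P)).
rewrite big_mkcond [in leRHS]big_mkcond /=.
apply: ler_sum => i _; rewrite sum_pred1_fset.
case: ifP => giQ; first by rewrite subrr nc0; case: ifP => _ //; apply: nc_ge0.
rewrite sub0r ncN ifT //; apply: contraFN giQ => iJ0.
by apply: (fsubsetP sQ); apply/imfsetP; exists i.
Qed.

(** Summing over the fibers of [g] does not increase a norm that is weighted
    through [g]: rotate every fiber sum to a positive number and bound the
    total of the rotated family. *)
Lemma bsum_fiber g a (s : J -> R[i]) (w : J -> R) K : (forall j, 0 <= w j) ->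
  bsum (fun i => nc (a i) * w (g i)) K ->
  (forall j, hsum (fiber g a j) (s j)) -> bsum (fun j => nc (s j) * w j) K.
Proof.
move=> w0 hK hs Q.
have hj j : hsum (fun i => (w j)%:C%C * (fiber g a j i)) ((w j)%:C%C * s j).
  exact: hsumZ.
(* the partial sum is the value of the sum of a family with rotated phases *)
pose u j : R[i] := if nc (s j) == 0 then 0 else (nc (s j))%:C%C / s j.
have u1 j : nc (u j) <= 1.
  rewrite /u; case: eqP => [_|/eqP h]; first by rewrite nc0.
  by rewrite ncM ComplexField.Normc.normcV ncR ger0_norm ?nc_ge0 // divff.
have us j : u j * s j = (nc (s j))%:C%C.
  rewrite /u; case: eqP => [->|/eqP h]; first by rewrite mul0r.
  by rewrite divfK //; apply: contra h => /eqP ->; rewrite nc0.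
have := hsum_finsum Q (fun j => hsumZ (u j) (hj j)).
set S := \sum_(j <- Q) _ => hS.
have -> : \sum_(j <- Q) nc (s j) * w j = complex.Re S.
  rewrite /S; have -> : \sum_(j <- Q) u j * ((w j)%:C%C * s j)
    = \sum_(j <- Q) (nc (s j) * w j)%:C%C.
    by apply: eq_bigr => j _; rewrite mulrCA us -rmorphM mulrC.
  by rewrite -rmorph_sum.
apply: le_trans (ler_norm _) _; apply: le_trans (nc_Re _) _.
apply: hsum_norm hS _; apply: le_bsum hK => i.
have -> : \sum_(j <- Q) u j * ((w j)%:C%C * fiber g a j i)
  = \sum_(j <- Q) (if g i == j then u (g i) * ((w (g i))%:C%C * a i) else 0).
  by apply: eq_bigr => j _; rewrite /fiber; case: eqP => [->//|_]; rewrite !mulr0.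
rewrite sum_pred1_fset; case: ifP => _; last by rewrite nc0 mulr_ge0 ?nc_ge0.
rewrite !ncM ncR ger0_norm // mulrCA [nc (a i) * _]mulrC.
by rewrite ler_wpM2l // ler_piMl ?nc_ge0.
Qed.

Lemma fiber_ex g a K : bsum (fun i => nc (a i)) K ->
  exists s : J -> R[i], forall j, hsum (fiber g a j) (s j).
Proof.
move=> hK; have [j|s hs] := @choice _ _ (fun j sj => hsum (fiber g a j) sj).
  exact: hsum_ex (fiber_bsum g j hK).
by exists s.
Qed.

Lemma bsum_fst (p : I * J -> R) (q : I -> R) (K : R) :
  (forall i, bsum (fun j => p (i, j)) (q i)) -> (forall ij, 0 <= p ij) ->
  bsum q K -> bsum p K.
Proof.
move=> hp p0 hq Q.
pose Q1 := [fset ij.1 | ij in Q]%fset; pose Q2 := [fset ij.2 | ij in Q]%fset.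
apply: le_trans (hq Q1).
apply: (@le_trans _ _ (\sum_(i <- Q1) \sum_(j <- Q2) p (i, j))); last first.
  by apply: ler_sum => i _; apply: hp.
pose r := [seq (i, j) | i <- enum_fset Q1, j <- enum_fset Q2].
have <- : \sum_(ij <- r) p ij = \sum_(i <- Q1) \sum_(j <- Q2) p (i, j).
  by rewrite big_allpairs_dep.
have ur : uniq r by apply: allpairs_uniq => //; move=> [? ?] [? ?].
have sr : {subset Q <= r}.
  move=> [i j] ijQ; apply/allpairsP; exists (i, j); split=> //.
    by apply/imfsetP; exists (i, j).
  by apply/imfsetP; exists (i, j).
rewrite [leRHS](bigID (mem Q)) /= -[leLHS]addr0; apply: lerD; last first.
  by apply: sumr_ge0.
rewrite -[leRHS]big_filter le_eqVlt; apply/orP; left; apply/eqP.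
apply: perm_big; apply: uniq_perm; rewrite ?filter_uniq ?fset_uniq // => x.
rewrite mem_filter; apply/idP/andP => [xQ|[]//].
by split=> //; apply: sr.
Qed.

Lemma bsum_prod (p : I -> R) (q : J -> R) K L :
  (forall i, 0 <= p i) -> (forall j, 0 <= q j) -> bsum p K -> bsum q L ->
  bsum (fun ij => p ij.1 * q ij.2) (K * L).
Proof.
move=> p0 q0 hp hq; apply: (@bsum_fst _ (fun i => p i * L)).
- by move=> i; apply: (bsumZ (p0 i) hq).
- by move=> ij; rewrite mulr_ge0.
- by rewrite mulrC; apply: le_bsum (bsumZ (bsum_ge0 hq) hp) => i; rewrite mulrC.
Qed.

End TwoIndices.

Lemma hsum_slice (I J : choiceType) (b : I * J -> R[i]) i l :
  hsum (fun j => b (i, j)) l -> hsum (fiber fst b i) l.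
Proof.
move=> h e e0; have [Q hQ] := h _ e0.
exists [fset (i, j) | j in Q]%fset => P sP.
have -> : \sum_(k <- P) fiber fst b i k
        = \sum_(j <- [fset k.2 | k in [fset k in P | k.1 == i]]%fset) b (i, j).
  rewrite big_imfset /=; last first.
    move=> [i1 j1] [i2 j2]; rewrite !inE /= => /andP[_ /eqP ->] /andP[_ /eqP ->].
    by move=> ->.
  rewrite big_fset /= [in RHS]big_mkcond /=.
  by apply: eq_bigr => -[i1 j1] _; rewrite /fiber /=; case: eqP => // ->.
apply: hQ; apply/fsubsetP => j jQ; apply/imfsetP; exists (i, j) => //=.
rewrite !inE /= eqxx andbT; apply: (fsubsetP sP).
by apply/imfsetP; exists j.
Qed.

(** Fubini: an absolutely summable double family may be summed by rows. *)
Lemma hsum_rows (I J : choiceType) (b : I * J -> R[i]) (s : I -> R[i]) l K :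
  bsum (fun ij => nc (b ij)) K -> (forall i, hsum (fun j => b (i, j)) (s i)) ->
  hsum s l -> hsum b l.
Proof.
move=> hK hs hl; have [m hm] := hsum_ex hK.
have := hsum_fiber hK hm (fun i => hsum_slice (hs i)).
by move=> /(hsum_uniq hl) ->.
Qed.

Lemma hsum_prod (I J : choiceType) (a : I -> R[i]) (b : J -> R[i]) l m K L :
  bsum (fun i => nc (a i)) K -> bsum (fun j => nc (b j)) L ->
  hsum a l -> hsum b m -> hsum (fun ij : I * J => a ij.1 * b ij.2) (l * m).
Proof.
move=> hK hL ha hb.
apply: (@hsum_rows _ _ _ (fun i => a i * m) _ (K * L)).
- have := bsum_prod (fun i => nc_ge0 (a i)) (fun j => nc_ge0 (b j)) hK hL.
  by apply: le_bsum => -[i j]; rewrite ncM.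
- by move=> i; apply: (hsumZ (a i) hb).
- by rewrite mulrC; apply: eq_hsum (hsumZ m ha) => i; rewrite mulrC.
Qed.

Lemma esum_bsum (I : choiceType) (p : I -> R) (K : R) : (forall i, 0 <= p i) ->
  (\esum_(i in [set: I]) (p i)%:E <= K%:E)%E <-> bsum p K.
Proof.
move=> p0; split=> h.
  move=> J; rewrite -lee_fin; apply: le_trans h; apply: esum_ge.
  exists [set` J]; first by split=> //; apply: finite_fset.
  rewrite (fsbig_finite _ _ (finite_fset J)) /= set_fsetK.
  by rewrite sumEFin.
apply: ge_ereal_sup => _ [X [finX _] <-].
by rewrite fsbig_finite //= sumEFin lee_fin.
Qed.

Lemma esum_fin_bsum (I : choiceType) (p : I -> R) : (forall i, 0 <= p i) ->
  (\esum_(i in [set: I]) (p i)%:E < +oo)%E ->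
  bsum p (fine (\esum_(i in [set: I]) (p i)%:E)%E).
Proof.
move=> p0 h; apply/esum_bsum => //; rewrite fineK //.
by rewrite ge0_fin_numE //; apply: esum_ge0 => i _; rewrite lee_fin.
Qed.

End Sums.

(** * Fourier series *)

Section Characters.
Context {R : realType}.
Implicit Types (a b t : R).

Lemma expiD a b : expi (a + b) = expi a * expi b.
Proof. by rewrite /expi cosD sinD; apply/eqP; rewrite eq_complex /= addrC eqxx [X in _ == X]addrC eqxx. Qed.

Lemma expi0 : expi 0 = 1 :> R[i].
Proof. by rewrite /expi cos0 sin0. Qed.

Lemma nc_expi a : nc (expi a) = 1.
Proof. by rewrite /= cos2Dsin2 sqrtr1. Qed.

Lemma expiN_mul a : expi (- a) * expi a = 1.
Proof. by rewrite -expiD addNr expi0. Qed.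

Lemma expi_sum (I : Type) (r : seq I) (f : I -> R) :
  expi (\sum_(i <- r) f i) = \prod_(i <- r) expi (f i).
Proof.
elim: r => [|i r IH]; first by rewrite !big_nil expi0.
by rewrite !big_cons expiD IH.
Qed.

Lemma expi_mulrn a k : expi (a *+ k) = expi a ^+ k.
Proof.
elim: k => [|k IH]; first by rewrite mulr0n expr0 expi0.
by rewrite mulrS expiD IH exprS.
Qed.

Lemma expi_2pi_int (m : int) : expi (m%:~R * (pi *+ 2)) = 1 :> R[i].
Proof.
have h (k : nat) : expi (k%:R * (pi *+ 2)) = 1 :> R[i].
  rewrite mulr_natl expi_mulrn.
  by rewrite [expi _](_ : _ = 1) ?expr1n // /expi cos2pi sin2pi.
case: m => k; first exact: h.
rewrite NegzE mulrNz mulNr.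
by have := expiN_mul (k.+1%:R * (pi *+ 2)); rewrite h mulr1.
Qed.

Definition grid_angle (N : nat) (m : int) : R := m%:~R * (pi *+ 2) / N%:R.

Lemma grid_angleD N m1 m2 : grid_angle N (m1 + m2) = grid_angle N m1 + grid_angle N m2.
Proof. by rewrite /grid_angle rmorphD /= !mulrDl. Qed.

Lemma expi_grid_angle_eq1 (N : nat) (m : int) : (0 < N)%N ->
  (expi (grid_angle N m) == 1 :> R[i]) = (N %| m)%Z.
Proof.
move=> N0; have N0' : N%:R != 0 :> R by rewrite pnatr_eq0 -lt0n.
apply/eqP/idP => [h|/dvdzP[q ->]]; last first.
  rewrite /grid_angle rmorphM /= -[X in X / _]mulrA [N%:~R * _]mulrC mulrA mulfK //.
  exact: expi_2pi_int.
have Nz : (N : int) != 0 by rewrite -lt0n in N0 *; lia.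
have : expi (grid_angle N (m %% N)%Z) = 1 :> R[i].
  have := h; rewrite {1}(divz_eq m N) grid_angleD expiD.
  suff -> : expi (grid_angle N ((m %/ N)%Z * N)) = 1 :> R[i] by rewrite mul1r.
  rewrite /grid_angle rmorphM /= -[X in X / _]mulrA [N%:~R * _]mulrC mulrA mulfK //.
  exact: expi_2pi_int.
have r0 : 0 <= (m %% N)%Z by apply: modz_ge0.
have rN : ((m %% N)%Z < N) by apply: ltz_pmod; lia.
have -> : (N %| m)%Z = ((m %% N)%Z == 0) by apply/dvdz_mod0P/eqP.
set r := (m %% N)%Z in r0 rN *; move: r0 rN; case: r => // k _ kN [+ _].
have -> : grid_angle N k = (k%:R * pi / N%:R) *+ 2 by rewrite /grid_angle -[pi *+ 2]mulr_natr -[RHS]mulr_natr; ring.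
rewrite cos_mulr2n cos2sin2 => h2.
have s0 : sin (k%:R * pi / N%:R) = 0 :> R.
  by apply/eqP; rewrite -sqrf_eq0; apply/eqP; lra.
case: k kN {h2} s0 => [|k] kN s0; first by [].
have := @sin_gt0_pi R (k.+1%:R * pi / N%:R); rewrite s0 ltxx => H.
suff : false by []. apply: H; rewrite divr_gt0 ?mulr_gt0 ?pi_gt0 ?ltr0n //=.
rewrite ltr_pdivrMr ?ltr0n // mulrC ltr_pM2l ?pi_gt0 // ltr_nat; lia.
Qed.

End Characters.

Section Grid.
Context {R : realType}.

Lemma sum_expi_grid (N : nat) (m : int) : (0 < N)%N ->
  \sum_(k < N) expi (grid_angle N (m * k%:Z)) = (if (N %| m)%Z then N%:R else 0) :> R[i].
Proof.
move=> N0; have rk k : grid_angle N (m * k%:Z) = grid_angle N m *+ k :> R.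
  by rewrite /grid_angle rmorphM /= -mulr_natr; ring.
have -> : \sum_(k < N) expi (grid_angle N (m * k%:Z))
        = \sum_(k < N) expi (grid_angle N m) ^+ k :> R[i].
  by apply: eq_bigr => k _; rewrite rk expi_mulrn.
rewrite -(expi_grid_angle_eq1 (R := R) m N0); case: eqP => [->|/eqP z1].
  rewrite (eq_bigr (fun=> 1)) ?sumr_const ?card_ord // => k _.
  by rewrite expr1n.
have := subrX1 (expi (grid_angle N m) : R[i]) N.
have -> : expi (grid_angle N m) ^+ N = 1 :> R[i].
  rewrite -expi_mulrn -mulr_natr /grid_angle divfK ?expi_2pi_int //.
  by rewrite pnatr_eq0 -lt0n.
rewrite subrr => /esym/eqP; rewrite mulf_eq0 subr_eq0 (negPf z1) /=.
by move/eqP.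
Qed.

Lemma sum_cos_grid (N : nat) (m : int) : (0 < N)%N ->
  \sum_(k < N) cos (grid_angle N (m * k%:Z)) = (if (N %| m)%Z then N%:R else 0) :> R.
Proof.
move=> /(sum_expi_grid m) /(congr1 (@complex.Re R)).
rewrite (raddf_sum (@complex.Re R : Rcomplex R -> R)) /= => ->.
by case: ifP => //; rewrite -(rmorph_nat (real_complex R)).
Qed.

Variable d : nat.
Implicit Types (al be : 'rV[int]_d) (x y : 'rV[R]_d).

Lemma freq_dotDl al be x : freq_dot (al + be) x = freq_dot al x + freq_dot be x.
Proof.
rewrite /freq_dot -big_split; apply: eq_bigr => j _ /=.
by rewrite mxE rmorphD /= mulrDl.
Qed.

Lemma freq_dotDr al x y : freq_dot al (x + y) = freq_dot al x + freq_dot al y.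
Proof.
by rewrite /freq_dot -big_split; apply: eq_bigr => j _ /=; rewrite mxE mulrDr.
Qed.

Lemma freq_dotN al x : freq_dot (- al) x = - freq_dot al x.
Proof.
rewrite /freq_dot -sumrN; apply: eq_bigr => j _ /=.
by rewrite mxE rmorphN /= mulNr.
Qed.

Lemma freq_dotZr al k x : freq_dot al (k *: x) = k * freq_dot al x.
Proof.
rewrite /freq_dot mulr_sumr; apply: eq_bigr => j _ /=.
by rewrite mxE mulrCA.
Qed.

Lemma freq_dot0l x : freq_dot 0 x = 0.
Proof. by rewrite /freq_dot big1 // => j _; rewrite mxE mul0r. Qed.

Definition grid_pt (N : nat) (s : {ffun 'I_d -> 'I_N}) : 'rV[R]_d :=
  \row_j grid_angle N (s j)%:Z.

(** The coefficient of [e^{i be.x}] in the discrete Fourier transform of the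
    values of [F] on the grid. *)
Definition grid_avg (N : nat) be (F : 'rV[R]_d -> R[i]) : R[i] :=
  (N%:R ^+ d)^-1 * \sum_(s : {ffun 'I_d -> 'I_N})
    expi (- freq_dot be (grid_pt s)) * F (grid_pt s).

Definition cong (N : nat) al be := [forall j, (N %| (al 0 j - be 0 j)%R)%Z].

(** On the grid a character is orthogonal to all but its aliases. *)
Lemma grid_avg_char N al be : (0 < N)%N ->
  grid_avg N be (fun x => expi (freq_dot al x)) = (cong N al be)%:R.
Proof.
move=> N0; rewrite /grid_avg.
have -> : \sum_(s : {ffun 'I_d -> 'I_N})
   expi (- freq_dot be (grid_pt s)) * expi (freq_dot al (grid_pt s))
  = \sum_(s : {ffun 'I_d -> 'I_N})
     \prod_j expi (grid_angle N ((al 0 j - be 0 j) * (s j)%:Z)) :> R[i].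
  apply: eq_bigr => s _; rewrite -expiD -expi_sum -freq_dotN -freq_dotDl.
  congr expi; apply: eq_bigr => j _; rewrite !mxE /grid_angle rmorphM /= addrC.
  by rewrite [(_ + _)%R in LHS]addrC !mulrA [X in X%:~R]addrC.
rewrite -(bigA_distr_bigA (fun j (k : 'I_N) =>
  expi (grid_angle N ((al 0 j - be 0 j) * k%:Z)))) /=.
under eq_bigr => j _ do rewrite sum_expi_grid //.
have N0' : N%:R != 0 :> R[i] by rewrite pnatr_eq0 -lt0n.
rewrite /cong; case: forallP => [h|/forallP].
  rewrite (eq_bigr (fun=> N%:R)) => [|j _]; last by rewrite h.
  by rewrite prodr_const card_ord mulVf // expf_neq0.
rewrite negb_forall => /existsP[j hj].
by rewrite (bigD1 j) //= (negPf hj) mul0r mulr0.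
Qed.

Lemma cong_eq N al be : (forall j, (`|(al 0 j - be 0 j)%R|%N < N)%N) ->
  cong N al be = (al == be).
Proof.
move=> h; apply/forallP/eqP => [c|-> j]; last by rewrite subrr dvdz0.
apply/rowP => j; apply/eqP; rewrite -subr_eq0 -absz_eq0.
have := c j; rewrite dvdzE /= => /dvdnP [[|q] hq]; first by rewrite hq.
by have := h j; rewrite hq mulSn; lia.
Qed.

Lemma hsum_grid (I : choiceType) (C : I -> R[i]) (g : I -> 'rV[int]_d)
    (F : 'rV[R]_d -> R[i]) N be : (0 < N)%N ->
  (forall x, hsum (fun i => C i * expi (freq_dot (g i) x)) (F x)) ->
  hsum (fun i => C i * (cong N (g i) be)%:R) (grid_avg N be F).
Proof.
move=> N0 h; rewrite /grid_avg.
have h2 := hsum_finsum (index_enum {ffun 'I_d -> 'I_N})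
  (fun s => hsumZ (expi (- freq_dot be (grid_pt s))) (h (grid_pt s))).
apply: eq_hsum (hsumZ (N%:R ^+ d)^-1 h2) => i.
rewrite -grid_avg_char // /grid_avg [RHS]mulrCA; congr (_ * _).
by rewrite mulr_sumr; apply: eq_bigr => s _; rewrite mulrCA.
Qed.

(** Averaging against [e^{-i be.x}] over a grid replaces the coefficient of [be]
    by the sum over its aliases; if these lie outside [J0], the error is at most
    the mass outside [J0]. *)
Lemma grid_avg_close (c : 'rV[int]_d -> R[i]) (F : 'rV[R]_d -> R[i])
    (J0 : {fset 'rV[int]_d}) (e : R) N be : (0 < N)%N ->
  (forall x, hsum (fun al => c al * expi (freq_dot al x)) (F x)) ->
  (forall J : {fset 'rV[int]_d}, \sum_(al <- J | al \notin J0) nc (c al) < e) ->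
  (forall al, al \in J0 -> cong N al be = (al == be)) ->
  nc (grid_avg N be F - c be) <= e.
Proof.
move=> N0 h hJ0 hN; have h1 := hsum_grid be N0 h.
have h2 : hsum (fun al => if al == be then c be else 0) (c be).
  have := @hsum_fin R _ (fun al => if al == be then c be else 0) [fset be]%fset.
  rewrite big_seq_fset1 eqxx; apply => al; rewrite in_fset1.
  by move=> /negPf ->.
have h3 := hsumB h1 h2.
apply: (hsum_norm h3) => P; apply: le_trans (ltW (hJ0 P)).
rewrite [leRHS]big_mkcond /=; apply: ler_sum => al _.
case: (boolP (al \in J0)) => [alJ|_] /=.
  by rewrite hN //; case: eqP => [->|_]; rewrite ?mulr1 ?mulr0 ?subrr ?sub0r ?ncN nc0.
case: eqP => [->|_].
  case: (cong _ _ _); rewrite ?mulr1 ?subrr ?nc0 ?nc_ge0 //.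
  by rewrite mulr0 sub0r ncN.
rewrite subr0 ncM -[leRHS]mulr1 ler_wpM2l ?nc_ge0 //.
by case: (cong _ _ _); rewrite ?nc0 // -[1%:R]/(1%:C%C) ncR normr1.
Qed.

(** On finer and finer grids the aliases of [be] leave every finite set. *)
Lemma fourier_uniq0 (c : 'rV[int]_d -> R[i]) (K : R) :
  bsum (fun al => nc (c al)) K ->
  (forall x, hsum (fun al => c al * expi (freq_dot al x)) 0) ->
  forall be, c be = 0.
Proof.
move=> hK h be; apply: nc_eq0; apply/eqP; rewrite eq_le nc_ge0 andbT.
apply/ler_addgt0Pl => e e0; rewrite addr0.
have [J0 hJ0] := bsum_tail (fun al => nc_ge0 (c al)) hK e0.
pose N := (\max_(al <- J0) \max_(j < d) `|(al 0 j - be 0 j)%R|%N).+1.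
have hN al : al \in J0 -> cong N al be = (al == be).
  move=> alJ; apply: (cong_eq) => j; rewrite /N ltnS.
  apply: leq_trans (leq_bigmax_seq _ alJ isT).
  exact: (leq_bigmax (F := fun j : 'I_d => `|(al 0 j - be 0 j)%R|%N) j).
have := grid_avg_close (ltn0Sn _ : (0 < N)%N) h hJ0 hN.
rewrite (_ : grid_avg N be (fun=> 0) = 0) ?sub0r ?ncN //.
by rewrite /grid_avg big1 ?mulr0 // => s _; rewrite mulr0.
Qed.

Lemma fourier_uniq (c c' : 'rV[int]_d -> R[i]) (F : 'rV[R]_d -> R[i]) (K L : R) :
  bsum (fun al => nc (c al)) K -> bsum (fun al => nc (c' al)) L ->
  (forall x, hsum (fun al => c al * expi (freq_dot al x)) (F x)) ->
  (forall x, hsum (fun al => c' al * expi (freq_dot al x)) (F x)) ->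
  c = c'.
Proof.
move=> hK hL h h'; apply/funext => be; apply/eqP; rewrite -subr_eq0; apply/eqP.
apply: (@fourier_uniq0 (fun al => c al - c' al) (K + L)).
  apply: le_bsum (bsumD hK hL) => al.
  by apply: le_trans (ncD _ _) _; rewrite ncN.
move=> x; rewrite -(subrr (F x)).
by apply: eq_hsum (hsumB (h x) (h' x)) => al; rewrite mulrBl.
Qed.

End Grid.

Section Norms.
Context {R : realType}.

Lemma cauchy_schwarz (I : finType) (a b : I -> R) :
  (\sum_i a i * b i) ^+ 2 <= (\sum_i a i ^+ 2) * (\sum_i b i ^+ 2).
Proof.
have : 0 <= \sum_i \sum_j (a i * b j - a j * b i) ^+ 2.
  by apply: sumr_ge0 => i _; apply: sumr_ge0 => j _; apply: sqr_ge0.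
have -> : \sum_i \sum_j (a i * b j - a j * b i) ^+ 2
  = ((\sum_i a i ^+ 2) * (\sum_i b i ^+ 2) - (\sum_i a i * b i) ^+ 2) *+ 2.
  set P := (\sum_i a i ^+ 2) * _; set Q := (\sum_i a i * b i) ^+ 2.
  have hQ : Q = \sum_i \sum_j (a i * b i) * (a j * b j).
    by rewrite /Q expr2 big_distrlr.
  have hP : P = \sum_i \sum_j a i ^+ 2 * b j ^+ 2 by rewrite /P big_distrlr.
  have hP' : P = \sum_i \sum_j a j ^+ 2 * b i ^+ 2 by rewrite hP exchange_big.
  have -> : (P - Q) *+ 2 = P + P - (Q + Q) by rewrite mulr2n; ring.
  rewrite {1}hP hP' hQ -!big_split -sumrB; apply: eq_bigr => i _ /=.
  by rewrite -!big_split -sumrB; apply: eq_bigr => j _ /=; ring.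
by rewrite pmulrn_lge0 // subr_ge0.
Qed.

Lemma l2_triangle (I : finType) (a b : I -> R) :
  Num.sqrt (\sum_i (a i + b i) ^+ 2)
    <= Num.sqrt (\sum_i a i ^+ 2) + Num.sqrt (\sum_i b i ^+ 2).
Proof.
set A := \sum_i a i ^+ 2; set B := \sum_i b i ^+ 2.
have A0 : 0 <= A by apply: sumr_ge0 => i _; apply: sqr_ge0.
have B0 : 0 <= B by apply: sumr_ge0 => i _; apply: sqr_ge0.
rewrite -(ler_pXn2r (_ : (0 < 2)%N)) ?nnegrE ?addr_ge0 ?sqrtr_ge0 //.
rewrite sqr_sqrtr; last by apply: sumr_ge0 => i _; apply: sqr_ge0.
rewrite sqrrD !sqr_sqrtr //.
have -> : \sum_i (a i + b i) ^+ 2 = A + (\sum_i a i * b i) *+ 2 + B.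
  rewrite /A /B -sumrMnl -!big_split; apply: eq_bigr => i _ /=.
  by rewrite sqrrD.
rewrite lerD2r lerD2l lerMn2r /=.
apply: le_trans (ler_norm _) _.
rewrite -sqrtr_sqr -sqrtrM //; apply: ler_wsqrtr; exact: cauchy_schwarz.
Qed.

Variable d : nat.
Implicit Types (al be : 'rV[int]_d).

Lemma freq_norm_ge0 al : 0 <= freq_norm (R := R) al.
Proof. exact: sqrtr_ge0. Qed.

Lemma freq_normD al be :
  freq_norm (R := R) (al + be) <= freq_norm al + freq_norm be.
Proof.
apply: le_trans (l2_triangle _ _); rewrite /freq_norm le_eqVlt; apply/orP; left.
by apply/eqP; congr Num.sqrt; apply: eq_bigr => j _; rewrite mxE rmorphD.
Qed.

Lemma freq_normN al : freq_norm (R := R) (- al) = freq_norm al.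
Proof.
congr Num.sqrt; apply: eq_bigr => j _.
by rewrite mxE rmorphN /= sqrrN.
Qed.

Lemma freq_norm0 : freq_norm (R := R) (0 : 'rV[int]_d) = 0.
Proof.
by rewrite /freq_norm big1 ?sqrtr0 // => j _; rewrite mxE expr0n.
Qed.

Lemma freq_norm_coord al j : `|(al 0 j)%:~R : R| <= freq_norm al.
Proof.
rewrite -sqrtr_sqr; apply: ler_wsqrtr; rewrite (bigD1 j) //= lerDl.
by apply: sumr_ge0 => i _; apply: sqr_ge0.
Qed.

Lemma row_entry_le m (h : 'rV[R]_m) j : `|h 0 j| <= `|h|.
Proof.
rewrite [leRHS]/Num.Def.normr/= mx_normrE; apply/bigmax_geP; right => /=.
by exists (0, j).
Qed.

Lemma freq_dot_le al (h : 'rV[R]_d) :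
  `|freq_dot al h| <= d%:R * (freq_norm al * `|h|).
Proof.
apply: le_trans (ler_norm_sum _ _ _) _.
apply: le_trans (ler_sum (G := fun=> freq_norm al * `|h|) _ _) _.
  move=> j _; rewrite normrM ler_pM //; first exact: freq_norm_coord.
  exact: row_entry_le.
by rewrite sumr_const card_ord mulr_natl.
Qed.

Lemma nc_euclid n (v : 'rV[R[i]]_n) l : nc (v 0 l) <= euclid_norm v.
Proof.
rewrite /euclid_norm; case E: (v 0 l) => [x y] /=; apply: ler_wsqrtr.
rewrite (bigD1 l) //= E /= lerDl; apply: sumr_ge0 => i _.
by rewrite addr_ge0 ?sqr_ge0.
Qed.

Lemma euclid_norm_ge0 n (v : 'rV[R[i]]_n) : 0 <= euclid_norm v.
Proof. exact: sqrtr_ge0. Qed.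

Lemma euclid_nc n (v : 'rV[R[i]]_n) : euclid_norm v <= \sum_l nc (v 0 l).
Proof.
have h0 : 0 <= \sum_l nc (v 0 l) by apply: sumr_ge0 => l _; apply: nc_ge0.
rewrite -(ger0_norm h0) -sqrtr_sqr; apply: ler_wsqrtr.
have -> : \sum_l (complex.Re (v 0 l) ^+ 2 + complex.Im (v 0 l) ^+ 2)
        = \sum_l nc (v 0 l) ^+ 2.
  apply: eq_bigr => l _; case: (v 0 l) => x y /=.
  by rewrite sqr_sqrtr // addr_ge0 ?sqr_ge0.
rewrite [leRHS]expr2 mulr_suml; apply: ler_sum => l _.
rewrite expr2 ler_wpM2l ?nc_ge0 // (bigD1 l) //= lerDl.
by apply: sumr_ge0 => i _; apply: nc_ge0.
Qed.

End Norms.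

Section ScalarSeries.
Context {R : realType} {d : nat}.
Implicit Types (f : 'rV[R]_d -> R) (c : 'rV[int]_d -> R[i]).

(** The estimates are made for one component at a time; this is the scalar
    counterpart of [fourier_series]. *)
Definition fseries f c : Prop := (exists K, bsum (fun al => nc (c al)) K) /\
  forall x, hsum (fun al => c al * expi (freq_dot al x)) (f x)%:C%C.

Lemma fseries_uniq f c c' : fseries f c -> fseries f c' -> c = c'.
Proof.
by move=> [[K hK] h] [[L hL] h']; apply: (fourier_uniq hK hL h h').
Qed.

(** Any absolutely convergent sum of characters, indexed at will, is a Fourier
    series; every weighted norm of its coefficients is bounded by the same norm
    of the given family. *)
Lemma fseries_rep (I : choiceType) (C : I -> R[i]) (g : I -> 'rV[int]_d) f K0 :
  bsum (fun i => nc (C i)) K0 ->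
  (forall x, hsum (fun i => C i * expi (freq_dot (g i) x)) (f x)%:C%C) ->
  exists c, [/\ fseries f c,
    forall (w : 'rV[int]_d -> R) K, (forall al, 0 <= w al) ->
      bsum (fun i => nc (C i) * w (g i)) K -> bsum (fun al => nc (c al) * w al) K
    & forall al, (forall i, g i != al) -> c al = 0].
Proof.
move=> hK0 h; have [c hc] := fiber_ex g hK0; exists c.
have hw (w : 'rV[int]_d -> R) K : (forall al, 0 <= w al) ->
    bsum (fun i => nc (C i) * w (g i)) K -> bsum (fun al => nc (c al) * w al) K.
  by move=> w0 hw; apply: (bsum_fiber w0 hw hc).
split=> //; last first.
  move=> al nal; apply: (hsum_uniq (hc al)).
  by apply: eq_hsum hsum0 => i; rewrite /fiber (negPf (nal i)).
split.
  exists K0; have := hw (fun=> 1) K0 (fun=> ler01).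
  under eq_fun => i do rewrite mulr1.
  by move=> /(_ hK0); apply: le_bsum => al; rewrite mulr1.
move=> x; apply: (hsum_fiber (g := g) (K := K0) _ (h x)) => [|al].
  by apply: le_bsum hK0 => i; rewrite ncM nc_expi mulr1.
rewrite mulrC; apply: eq_hsum (hsumZ (expi (freq_dot al x)) (hc al)) => i.
by rewrite /fiber; case: eqP => [->|_]; rewrite ?mulr0 // mulrC.
Qed.

End ScalarSeries.

Section VectorSeries.
Context {R : realType} {d n : nat}.
Implicit Types (f : 'rV[R]_d -> 'rV[R]_n) (c : 'rV[int]_d -> 'rV[R[i]]_n).

Lemma fourier_seriesP f c : fourier_series f c <->
  forall l, fseries (fun x => f x 0 l) (fun al => c al 0 l) .
Proof.
split=> [[h1 h2] l|h].
  split; last by move=> x; apply/has_sumP; apply: h2.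
  exists (fine (\esum_(a in [set: 'rV[int]_d]) (euclid_norm (c a))%:E)%E).
  have := esum_fin_bsum (fun a => euclid_norm_ge0 (c a)) h1.
  by apply: le_bsum => al; apply: nc_euclid.
split; last by move=> x l; apply/has_sumP; apply: (h l).2.
have [K hK] := @choice _ _ (fun l K => bsum (fun al => nc (c al 0 l)) K)
   (fun l => (h l).1).
apply: (@le_lt_trans _ _ (\sum_l K l)%:E); last exact: ltry.
apply/esum_bsum => [al|J]; first exact: euclid_norm_ge0.
apply: le_trans (ler_sum (G := fun al => \sum_l nc (c al 0 l)) _ _) _.
  by move=> al _; apply: euclid_nc.
by rewrite exchange_big; apply: ler_sum => l _; apply: hK.
Qed.

Lemma fourier_series_uniq f c c' :
  fourier_series f c -> fourier_series f c' -> c = c'.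
Proof.
move=> /fourier_seriesP h /fourier_seriesP h'; apply/funext => al; apply/rowP => l.
by have := fseries_uniq (h l) (h' l) => /(congr1 (fun F => F al)).
Qed.

Lemma fourier_coefE f c : fourier_series f c -> fourier_coef f = c.
Proof.
move=> h; apply: (fourier_series_uniq (f := f)) => //.
by rewrite /fourier_coef; apply: (@xgetPex _ (fun=> 0) [set c | fourier_series f c]); exists c.
Qed.

Lemma Gen_series f c z : fourier_series f c -> Gen f z =
  (\esum_(a in [set: 'rV[int]_d]) (expR (z * freq_norm a) * euclid_norm (c a))%:E)%E.
Proof.
move=> h; rewrite /Gen (fourier_coefE h); case: asboolP => // -[].
by exists c.
Qed.

Lemma Gen_fin f z : (Gen f z < +oo)%E -> exists c, fourier_series f c /\
  bsum (fun al => expR (z * freq_norm al) * euclid_norm (c al)) (realGen f z).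
Proof.
move=> hf; have [c hc] : exists c, fourier_series f c.
  by move: hf; rewrite /Gen; case: asboolP => // _; rewrite ltxx.
exists c; split=> //; rewrite /realGen; move: hf; rewrite (Gen_series z hc).
apply: esum_fin_bsum => al; by rewrite mulr_ge0 ?expR_ge0 ?euclid_norm_ge0.
Qed.

Lemma Gen_ge0 f z : (0 <= Gen f z)%E.
Proof.
rewrite /Gen; case: asboolP => // _.
by apply: esum_ge0 => al _; rewrite lee_fin mulr_ge0 ?expR_ge0 ?euclid_norm_ge0.
Qed.

(** Up to a factor that depends on the number of components only, a bound on
    [Gen] is a bound on the weighted coefficients of every component: this lemma
    and its converse below are the only ones to see the Euclidean norm of the
    coefficients. *)
Lemma Gen_scalar f z K l : (Gen f z <= K%:E)%E -> exists c : 'rV[int]_d -> R[i],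
  fseries (fun x => f x 0 l) c /\
  bsum (fun al => nc (c al) * expR (z * freq_norm al)) K.
Proof.
move=> hf; have hf' : (Gen f z < +oo)%E by apply: le_lt_trans hf (ltry _).
have [c [hc hb]] := Gen_fin hf'; exists (fun al => c al 0 l).
split; first by have /fourier_seriesP := hc.
apply: bsum_le (le_bsum _ hb) _ => [al|].
  by rewrite mulrC ler_wpM2l ?expR_ge0 // nc_euclid.
by rewrite -lee_fin /realGen fineK // ge0_fin_numE // Gen_ge0.
Qed.

Lemma scalar_Gen f z (K : 'I_n -> R) :
  (forall l, exists c : 'rV[int]_d -> R[i], fseries (fun x => f x 0 l) c /\
    bsum (fun al => nc (c al) * expR (z * freq_norm al)) (K l)) ->
  (Gen f z <= (\sum_l K l)%:E)%E.
Proof.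
move=> h; have [c hc] := choice h.
have hs : fourier_series f (fun al => \row_l c l al).
  apply/fourier_seriesP => l; have [h1 _] := hc l.
  by rewrite (_ : (fun al => _) = c l) //; apply/funext => al; rewrite mxE.
rewrite (Gen_series z hs); apply/esum_bsum => [al|J].
  by rewrite mulr_ge0 ?expR_ge0 ?euclid_norm_ge0.
apply: le_trans (ler_sum (G := fun al => \sum_l nc (c l al) * expR (z * freq_norm al)) _ _) _.
  move=> al _; rewrite -mulr_suml mulrC ler_wpM2r ?expR_ge0 //.
  by apply: le_trans (euclid_nc _) _; apply: ler_sum => l _; rewrite mxE.
by rewrite exchange_big; apply: ler_sum => l _; apply: (hc l).2.
Qed.

End VectorSeries.

(** * Termwise differentiation in space *)
Section Taylor.
Context {R : realType}.

Lemma lip_of_deriv (f df : R -> R) (a b M : R) :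
  (forall x : R, is_derive x (1 : R) f (df x)) ->
  (forall x, `|x - a| <= `|b - a| -> `|df x| <= M) ->
  `|f b - f a| <= M * `|b - a|.
Proof.
move=> hd hM.
have cf : continuous f.
  by move=> x; apply/differentiable_continuous/derivable1_diffP; case: (hd x).
case: (leP a b) => [ab|/ltW ba].
  have [c c_ab ->] := MVT_segment ab (fun x _ => hd x) (continuous_subspaceT cf).
  rewrite normrM ler_wpM2r //; apply: hM; move: c_ab; rewrite in_itv /= => /andP[ac cb].
  by rewrite !ger0_norm ?subr_ge0 ?lerD2r.
have [c c_ab] := MVT_segment ba (fun x _ => hd x) (continuous_subspaceT cf).
rewrite distrC => ->; rewrite (distrC b) normrM ler_wpM2r //; apply: hM.
move: c_ab; rewrite in_itv /= => /andP[bc ca].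
by rewrite (distrC c) (distrC b) !ger0_norm ?subr_ge0 // lerD2l lerN2.
Qed.

Lemma sin_lip (a b : R) : `|sin b - sin a| <= `|b - a|.
Proof.
rewrite -[leRHS]mul1r; apply: (@lip_of_deriv sin cos) => x _.
exact: cos_max.
Qed.

Lemma cos_lip (a b : R) : `|cos b - cos a| <= `|b - a|.
Proof.
rewrite -[leRHS]mul1r; apply: (@lip_of_deriv cos (fun x => - sin x)) => x _.
by rewrite normrN; apply: sin_max.
Qed.

Lemma expi_lip (a b : R) : nc (expi b - expi a) <= 2 * `|b - a|.
Proof.
apply: le_trans (nc_ReIm _) _; rewrite /= mulr_natl mulr2n.
by apply: lerD; [apply: cos_lip|apply: sin_lip].
Qed.

Lemma expi_taylor (b : R) : nc (expi b - 1 - 'i%C * b%:C%C) <= 2 * b ^+ 2.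
Proof.
have -> : expi b - 1 - 'i%C * b%:C%C = Complex (cos b - 1) (sin b - b).
  by apply/eqP; rewrite eq_complex /=; apply/andP; split; apply/eqP; ring.
apply: le_trans (nc_ReIm _) _; rewrite /= mulr_natl mulr2n; apply: lerD.
  rewrite -cos0 -[b ^+ 2]ger0_norm ?sqr_ge0 // normrX expr2.
  have := @lip_of_deriv cos (fun x => - sin x) 0 b `|b|.
  rewrite !subr0; apply => x; rewrite ?subr0 ?normrN.
  by apply: le_trans; have := sin_lip 0 x; rewrite sin0 !subr0.
rewrite -[b ^+ 2]ger0_norm ?sqr_ge0 // normrX expr2.
have := @lip_of_deriv (fun x => sin x - x) (fun x => cos x - 1) 0 b `|b|.
rewrite /= sin0 !subr0; apply => x; rewrite ?subr0.
by apply: le_trans; have := cos_lip 0 x; rewrite cos0 subr0.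
Qed.

End Taylor.

Lemma mulmxr_cont (R : realType) (d n : nat) (D : 'M[R]_(d, n)) :
  continuous (mulmxr D : 'rV[R]_d -> 'rV[R]_n).
Proof.
pose B := \sum_j \sum_l `|D j l| + 1.
have B0 : 0 < B.
  by rewrite ltr_wpDl //; apply: sumr_ge0 => j _; apply: sumr_ge0.
apply: bounded_linear_continuous; apply/linear_boundedP.
exists B; split=> [|r Br h]; first by rewrite num_real.
apply: (@le_trans _ _ (B * `|h|)); last by rewrite ler_wpM2r // ltW.
rewrite [leLHS]/Num.Def.normr/= mx_normrE bigmax_le //.
  by rewrite mulr_ge0 ?(ltW B0).
move=> [i l] _ /=; rewrite !ord1 mxE; apply: le_trans (ler_norm_sum _ _ _) _.
apply: (@le_trans _ _ ((\sum_j \sum_l `|D j l|) * `|h|)); last first.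
  by rewrite ler_wpM2r // lerDl.
rewrite mulr_suml; apply: ler_sum => j _; rewrite normrM mulrC ler_pM //.
  by rewrite (bigD1 l) //= lerDl; apply: sumr_ge0.
exact: row_entry_le.
Qed.

Section Gradient.
Context {R : realType} {d n : nat}.
Variables (I : choiceType) (C : 'I_n -> I -> R[i]) (g : 'I_n -> I -> 'rV[int]_d).
Variables (u : 'rV[R]_d -> 'rV[R]_n) (K : R).
Hypothesis hC : forall l, bsum (fun i => nc (C l i) * (1 + freq_norm (g l i)) ^+ 2) K.
Hypothesis hu : forall x l,
  hsum (fun i => C l i * expi (freq_dot (g l i) x)) (u x 0 l)%:C%C.

Lemma grad_bound l j x : bsum (fun i =>
  nc ('i%C * ((g l i 0 j)%:~R)%:C%C * (C l i * expi (freq_dot (g l i) x)))) K.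
Proof.
apply: le_bsum (hC l) => i; rewrite !ncM nc_expi ncR mulr1 mulrC.
rewrite ler_wpM2l ?nc_ge0 //.
have -> : nc ('i%C : R[i]) = 1 by rewrite /= expr0n /= add0r expr1n sqrtr1.
rewrite mul1r; apply: le_trans (freq_norm_coord _ _) _.
have := freq_norm_ge0 (R := R) (g l i); set r := freq_norm _ => r0; nra.
Qed.

(** The quadratic remainder of the exponential, summed against the second
    moment of the coefficients. *)
Lemma taylor_rep (S : 'I_n -> 'I_d -> R[i]) x : (forall l j,
    hsum (fun i => 'i%C * ((g l i 0 j)%:~R)%:C%C * (C l i * expi (freq_dot (g l i) x)))
      (S l j)) ->
  forall l h, nc ((u (x + h) 0 l - u x 0 l)%:C%C - \sum_j (h 0 j)%:C%C * S l j)
    <= 2 * (d%:R ^+ 2) * K * `|h| ^+ 2.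
Proof.
move=> hS l h; rewrite rmorphB.
have hs := hsumB (hsumB (hu (x + h) l) (hu x l))
  (hsum_finsum (index_enum 'I_d) (fun j => hsumZ (h 0 j)%:C%C (hS l j))).
apply: (hsum_norm hs).
have -> : 2 * d%:R ^+ 2 * K * `|h| ^+ 2 = (2 * d%:R ^+ 2 * `|h| ^+ 2) * K by ring.
apply: (le_bsum (q := fun i => (2 * d%:R ^+ 2 * `|h| ^+ 2) * (nc (C l i) * (1 + freq_norm (g l i)) ^+ 2))); last first.
  by apply: bsumZ; rewrite ?mulr_ge0 ?sqr_ge0.
move=> i; set c := C l i; set t := freq_dot (g l i) x; set s := freq_dot (g l i) h.
have -> : c * expi (freq_dot (g l i) (x + h)) - c * expi t
    - \sum_j (h 0 j)%:C%C * ('i%C * ((g l i 0 j)%:~R)%:C%C * (c * expi t))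
  = c * expi t * (expi s - 1 - 'i%C * s%:C%C).
  rewrite freq_dotDr expiD -/t -/s.
  rewrite (_ : \sum_j _ = c * expi t * ('i%C * s%:C%C)); first by ring.
  rewrite /s /freq_dot rmorph_sum !mulr_sumr; apply: eq_bigr => j _.
  by rewrite rmorphM /=; ring.
rewrite !ncM nc_expi mulr1.
apply: le_trans (ler_wpM2l (nc_ge0 _) (expi_taylor s)) _.
have -> : 2 * d%:R ^+ 2 * `|h| ^+ 2 * (nc c * (1 + freq_norm (g l i)) ^+ 2)
  = nc c * (2 * (d%:R * ((1 + freq_norm (g l i)) * `|h|)) ^+ 2) by ring.
rewrite ler_wpM2l ?nc_ge0 // ler_wpM2l //.
rewrite -[s ^+ 2]ger0_norm ?sqr_ge0 // normrX.
apply: lerXn2r; rewrite ?nnegrE //.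
  by rewrite !mulr_ge0 ?addr_ge0 ?freq_norm_ge0.
apply: le_trans (freq_dot_le _ _) _.
by rewrite ler_wpM2l // ler_wpM2r // lerDr.
Qed.

(** The gradient of an absolutely convergent Fourier series with two
    derivatives to spare is the sum of the termwise gradients. *)
Lemma jacobian_rep x : differentiable u x /\ forall l j,
  hsum (fun i => 'i%C * ((g l i 0 j)%:~R)%:C%C * (C l i * expi (freq_dot (g l i) x)))
    (jacobian u x j l)%:C%C.
Proof.
have [S hS] : exists S : 'I_n * 'I_d -> R[i], forall lj,
   hsum (fun i => 'i%C * ((g lj.1 i 0 lj.2)%:~R)%:C%C *
     (C lj.1 i * expi (freq_dot (g lj.1 i) x))) (S lj).
  have [lj|S hS] := @choice _ _ (fun (lj : 'I_n * 'I_d) s =>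
     hsum (fun i => 'i%C * ((g lj.1 i 0 lj.2)%:~R)%:C%C *
     (C lj.1 i * expi (freq_dot (g lj.1 i) x))) s).
    exact: hsum_ex (grad_bound lj.1 lj.2 x).
  by exists S.
have ht := taylor_rep (fun l j => hS (l, j)).
pose B := 2 * d%:R ^+ 2 * `|K| + 1.
have B0 : 0 < B by rewrite ltr_wpDl // !mulr_ge0 ?sqr_ge0.
have htB l h : nc ((u (x + h) 0 l - u x 0 l)%:C%C - \sum_j (h 0 j)%:C%C * S (l, j))
    <= B * `|h| ^+ 2.
  apply: le_trans (ht l h) _; rewrite ler_wpM2r ?sqr_ge0 //.
  apply: (@le_trans _ _ (2 * d%:R ^+ 2 * `|K|)); last by rewrite /B lerDl.
  by apply: ler_wpM2l (ler_norm _); apply: mulr_ge0 => //; apply: sqr_ge0.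
have ImS l j : complex.Im (S (l, j)) = 0.
  apply/eqP; rewrite -normr_eq0 eq_le normr_ge0 andbT.
  apply/ler_addgt0Pl => e e0; rewrite addr0.
  pose s := e / B; have s0 : 0 < s by rewrite divr_gt0.
  have := htB l (s *: delta_mx 0 j).
  rewrite normrZ (gtr0_norm s0).
  have -> : \sum_j0 ((s *: (delta_mx 0 j : 'rV[R]_d)) 0 j0)%:C%C * S (l, j0) = s%:C%C * S (l, j).
    rewrite (bigD1 j) //= !mxE !eqxx mulr1 big1 ?addr0 // => k kj.
    by rewrite !mxE eqxx (negPf kj) mulr0 mul0r.
  have nd : `|delta_mx 0 j : 'rV[R]_d| <= 1.
    rewrite [leLHS]/Num.Def.normr/= mx_normrE bigmax_le // => -[i k] _ /=.
    by rewrite mxE; case: (_ && _); rewrite ?normr1 ?normr0.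
  move=> h1; have h2 : `|s * complex.Im (S (l, j))| <= B * (s * `|delta_mx 0 j : 'rV[R]_d|) ^+ 2.
    apply: le_trans h1; apply: le_trans (nc_Im _); rewrite -normrN.
    rewrite le_eqVlt; apply/orP; left; apply/eqP; congr (`|_|).
    by case: (S (l, j)) => a b /=; ring.
  move: h2; rewrite normrM (gtr0_norm s0) => h2.
  rewrite -(ler_pM2l s0); apply: le_trans h2 _.
  rewrite exprMn; apply: (@le_trans _ _ (B * (s ^+ 2 * 1))).
    by rewrite ler_wpM2l ?(ltW B0) // ler_wpM2l ?sqr_ge0 // exprn_ile1.
  by rewrite mulr1 expr2 mulrCA ler_wpM2l ?(ltW s0) // /s mulrCA divff ?mulr1 ?gt_eqF.
pose D : 'M[R]_(d, n) := \matrix_(j, l) complex.Re (S (l, j)).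
have SD l j : S (l, j) = (D j l)%:C%C.
  by rewrite /D mxE; have := ImS l j; case: (S (l, j)) => a b /= ->.
have hD h : `|u (x + h) - u x - h *m D| <= B * `|h| ^+ 2.
  rewrite [leLHS]/Num.Def.normr/= mx_normrE bigmax_le //.
    by rewrite mulr_ge0 ?(ltW B0) ?sqr_ge0.
  move=> [i l] _ /=; rewrite !ord1; apply: le_trans (htB l h).
  rewrite -ncR; rewrite le_eqVlt; apply/orP; left; apply/eqP; congr nc.
  rewrite !mxE rmorphB; congr (_ - _).
  by rewrite rmorph_sum; apply: eq_bigr => j _; rewrite SD -rmorphM.
have Dcont : continuous (mulmxr D : 'rV[R]_d -> 'rV[R]_n).
  exact: mulmxr_cont.
have Do : u \o shift x = cst (u x) + (mulmxr D : 'rV[R]_d -> 'rV[R]_n) +o_ 0 id.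
  apply/eqaddoP => e e0.
  suff : nbhs (0 : 'rV[R]_d) [set h | `|u (x + h) - u x - h *m D| <= e * `|h|].
    apply: filterS => h /=; apply: le_trans; rewrite le_eqVlt; apply/orP; left.
    by rewrite !fctE /= [h + x]addrC opprD addrA.
  apply: (proj2 (@nbhs_norm0P _ 'rV[R]_d _)); exists (e / B).
    by rewrite /= divr_gt0.
  move=> h /= hh.
  apply: le_trans (hD h) _; rewrite expr2 mulrA ler_wpM2r //=.
  by rewrite mulrC -ler_pdivlMr // ltW.
have dE : 'd u x = (mulmxr D : 'rV[R]_d -> 'rV[R]_n) :> (_ -> _).
  exact: diff_unique Dcont Do.
split.
  by apply/diff_locallyP; rewrite dE.
move=> l j; have := hS (l, j); rewrite SD.
suff -> : jacobian u x = D by [].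
apply/row_matrixP => k; rewrite /jacobian !rowE mul_rV_lin1 /=.
by have -> := congr1 (fun F => F (delta_mx 0 k)) dE.
Qed.

End Gradient.

(** * Trigonometric polynomials as test functions *)

Section AnalyticBound.
Context {R : realType}.

Lemma analytic_locally_bounded (F : R -> R) (y : R) : analytic_at F y ->
  exists r M : R, 0 < r /\ forall h, `|h| < r -> `|F (y + h)| <= M.
Proof.
move=> [a [r [r0 ha]]].
pose h0 := r / 2; have h00 : 0 < h0 by rewrite divr_gt0.
have hh0 : `|h0| < r by rewrite gtr0_norm // ltr_pdivrMr // ltr_pMr // ltr1n.
have /cvgP /cvg_series_cvg_0 c0 := ha _ hh0.
have [M [_ hM]] := cvg_seq_bounded (cvgP _ c0).
pose M1 := `|M| + 1.
have bM k : `|a k * h0 ^+ k| <= M1.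
  by apply: hM => //; rewrite /M1 (le_lt_trans (ler_norm M)) // ltrDl.
have M10 : 0 <= M1 by rewrite addr_ge0.
exists (h0 / 2), (M1 * 2 + 1); split; first by rewrite divr_gt0.
move=> h hh; have hr : `|h| < r.
  apply: lt_trans hh _; rewrite /h0 -mulrA gtr_pMr //.
  by rewrite -invfM invf_lt1 // -natrM ltr1n.
have /cvgrPdist_le /(_ _ ltr01) [N _ hN] := ha _ hr.
have := hN N (leqnn N); rewrite /= => hF.
have {1}-> : F (y + h) = (F (y + h) - series (fun k => a k * h ^+ k) N)
   + series (fun k => a k * h ^+ k) N by rewrite subrK.
apply: le_trans (ler_normD _ _) _; rewrite addrC; apply: lerD => //.
rewrite /series /=; apply: le_trans (ler_norm_sum _ _ _) _.
apply: (@le_trans _ _ (\sum_(0 <= k < N) M1 * 2^-1 ^+ k)).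
  apply: ler_sum => k _.
  have -> : a k * h ^+ k = (a k * h0 ^+ k) * (h / h0) ^+ k.
    by rewrite -mulrA -exprMn mulrCA divff ?mulr1 ?gt_eqF.
  rewrite normrM ler_pM // normrX lerXn2r ?nnegrE ?invr_ge0 //.
  rewrite normrM normfV (gtr0_norm h00) ler_pdivrMr // mulrC.
  exact: ltW.
rewrite -mulr_sumr ler_wpM2l //.
have -> : \sum_(0 <= k < N) 2^-1 ^+ k = 2 - 2 * 2^-1 ^+ N :> R.
  elim: (N) => [|m IH]; first by rewrite big_nil expr0 mulr1 subrr.
  by rewrite big_nat_recr //= IH exprS; field.
by rewrite lerBlDr lerDl mulr_ge0 // exprn_ge0 // invr_ge0.
Qed.

(** An analytic function is bounded near every point, hence on the compact
    interval from [0] to [K]. *)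
Lemma analytic_bounded (F : R -> R) (C0 K : R) :
  (forall y, 0 <= y -> analytic_at F y) ->
  exists M, 0 <= M /\ forall y, 0 <= y -> y <= K -> C0 * F y <= M.
Proof.
move=> hF.
have := (compact_near_coveringP `[0, K]%classic).1 (@segment_compact R 0 K) R
  (pinfty_nbhs R) (fun M x => C0 * F x <= M) _.
case=> [x|M0 [_ hM0]].
  rewrite /= in_itv /= => /andP[x0 xK].
  have [r [M [r0 hM]]] := analytic_locally_bounded (hF x x0).
  exists (ball x r, [set m | `|C0| * M < m]).
    split; first exact: nbhsx_ballx.
    by exists (`|C0| * M); split => //; rewrite num_real.
  move=> [x' m] /= [bx hm]; apply: le_trans (ltW hm).
  apply: le_trans (ler_norm _) _; rewrite normrM ler_wpM2l //.
  have -> : x' = x + (x' - x) by rewrite addrC subrK.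
  by apply: hM; rewrite distrC.
exists (`|M0| + 1); split=> [|y y0 yK]; first by rewrite addr_ge0.
apply: hM0; last by rewrite /= in_itv /= y0 yK.
by rewrite (le_lt_trans (ler_norm M0)) // ltrDl.
Qed.

End AnalyticBound.

Section FiniteSums.
Context {R : realType} {I : finType}.

Lemma hsum_finType (a : I -> R[i]) : hsum a (\sum_i a i).
Proof.
have -> : \sum_i a i = \sum_(i <- [fset i in I]%fset) a i.
  apply: perm_big; apply: uniq_perm; rewrite ?fset_uniq ?index_enum_uniq //.
  by move=> i; rewrite mem_index_enum !inE.
by apply: hsum_fin => i; rewrite !inE.
Qed.

Lemma bsum_finType (p : I -> R) (K : R) : (forall i, 0 <= p i) ->
  \sum_i p i <= K -> bsum p K.
Proof.
move=> p0 hK J; apply: le_trans hK; rewrite [leRHS](bigID (mem J)) /=.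
rewrite -[leLHS]addr0 lerD //; last by apply: sumr_ge0.
rewrite -[leRHS]big_filter le_eqVlt; apply/orP; left; apply/eqP.
apply: perm_big; apply: uniq_perm; rewrite ?filter_uniq ?fset_uniq ?index_enum_uniq //.
by move=> i; rewrite mem_filter mem_index_enum andbT.
Qed.

End FiniteSums.

Section TrigPoly.
Context {R : realType} {d n : nat} {J : finType}.
Variables (g : J -> 'rV[int]_d) (th : J -> R) (v : J -> 'rV[R]_n).

Definition trigp : 'rV[R]_d -> 'rV[R]_n :=
  fun x => \sum_i cos (freq_dot (g i) x + th i) *: v i.

Definition ampl (i : J) : R := \sum_l `|v i 0 l|.

Let sg (s : bool) : R := if s then 1 else -1.
Let tC (l : 'I_n) (i : J * bool) : R[i] :=
  (v i.1 0 l / 2)%:C%C * expi (sg i.2 * th i.1).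
Let tg (i : J * bool) : 'rV[int]_d := if i.2 then g i.1 else - g i.1.

Let cosE t : (cos t)%:C%C = (2^-1)%:C%C * (expi t + expi (- t)) :> R[i].
Proof.
rewrite /expi cosN sinN; apply/eqP; rewrite eq_complex /=.
by apply/andP; split; apply/eqP; field.
Qed.

Let sinE t : (sin t)%:C%C = (2^-1)%:C%C * 'i%C * (expi (- t) - expi t) :> R[i].
Proof.
rewrite /expi cosN sinN; apply/eqP; rewrite eq_complex /=.
by apply/andP; split; apply/eqP; field.
Qed.

Let sum_JB (V : nmodType) (F : J * bool -> V) :
  \sum_i F i = \sum_i (F (i, true) + F (i, false)).
Proof.
rewrite (eq_bigr (fun ij => F (ij.1, ij.2))) => [|[] //].
rewrite -(pair_bigA _ (fun i b => F (i, b))) /=.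
by apply: eq_bigr => i _; rewrite big_bool.
Qed.

Let tg_expi i (s : bool) x :
  expi (freq_dot (tg (i, s)) x) = expi (sg s * freq_dot (g i) x).
Proof. by case: s; rewrite /tg /sg /= ?freq_dotN ?mul1r ?mulN1r. Qed.

Let trig_hsum x l :
  hsum (fun i => tC l i * expi (freq_dot (tg i) x)) (trigp x 0 l)%:C%C.
Proof.
suff -> : (trigp x 0 l)%:C%C = \sum_i tC l i * expi (freq_dot (tg i) x).
  exact: hsum_finType.
rewrite sum_JB /trigp summxE rmorph_sum /=; apply: eq_bigr => i _.
rewrite mxE rmorphM /= cosE /tC /= !tg_expi /sg !mul1r !mulN1r.
by rewrite [freq_dot _ _ + _]addrC opprD !expiD rmorphM /=; ring.
Qed.

Let nc_tC l i : nc (tC l i) = `|v i.1 0 l| / 2.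
Proof. by rewrite /tC ncM nc_expi mulr1 ncR normrM normfV normr_nat. Qed.

Let tg_norm i : freq_norm (R := R) (tg i) = freq_norm (g i.1).
Proof. by case: i => i []; rewrite /tg //= freq_normN. Qed.

Let tC_bsum l (w : R -> R) : (forall r, 0 <= w r) ->
  bsum (fun i => nc (tC l i) * w (freq_norm (tg i)))
    (\sum_i `|v i 0 l| * w (freq_norm (g i))).
Proof.
move=> w0; apply: bsum_finType => [i|]; first by rewrite mulr_ge0 ?nc_ge0.
rewrite sum_JB; apply: ler_sum => i _; rewrite !nc_tC !tg_norm /=.
by rewrite -mulrDl -splitr.
Qed.

Lemma jacobian_trigp x : jacobian trigp x =
  \matrix_(j, l) \sum_i - sin (freq_dot (g i) x + th i) * (g i 0 j)%:~R * v i 0 l.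
Proof.
pose K := \sum_l \sum_i `|v i 0 l| * (1 + freq_norm (R := R) (g i)) ^+ 2.
have hC l : bsum (fun i => nc (tC l i) * (1 + freq_norm (tg i)) ^+ 2) K.
  apply: bsum_le (tC_bsum l (w := fun r => (1 + r) ^+ 2) _) _ => [r|].
    exact: sqr_ge0.
  rewrite /K [leRHS](bigD1 l) //= lerDl; apply: sumr_ge0 => k _.
  by apply: sumr_ge0 => i _; rewrite mulr_ge0 ?sqr_ge0.
have [_ hJ] := jacobian_rep hC (fun x l => trig_hsum x l) x.
apply/matrixP => j l; apply: complexI; apply: (hsum_uniq (hJ l j)); rewrite mxE.
rewrite (_ : (_%:C)%C = \sum_i 'i%C * ((tg i 0 j)%:~R)%:C%C *
   (tC l i * expi (freq_dot (tg i) x))); first exact: hsum_finType.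
rewrite sum_JB rmorph_sum /=; apply: eq_bigr => i _.
rewrite !rmorphM rmorphN /= sinE /tC /= !tg_expi /sg !mul1r !mulN1r /tg /= mxE.
rewrite [freq_dot _ _ + _]addrC opprD !expiD rmorphM rmorphN rmorphN /=; ring.
Qed.

(** Equal or opposite frequencies may cancel, so that only upper bounds hold;
    but the sums are finite, and [Gen] is a sum of exponentials in [z]. *)
Lemma trigp_Gen (z : R) : exists G G' : R,
  [/\ Gen trigp z = G%:E, derivable (realGen trigp) z 1 /\
      realGen trigp z = G /\ derive1 (realGen trigp) z = G',
      0 <= G <= \sum_i ampl i * expR (z * freq_norm (g i)) &
      0 <= G' <= \sum_i ampl i * (freq_norm (g i) * expR (z * freq_norm (g i)))].
Proof.
have hc l : exists c : 'rV[int]_d -> R[i], [/\ fseries (fun x => trigp x 0 l) c,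
    forall (w : R -> R), (forall r, 0 <= w r) ->
      bsum (fun al => nc (c al) * w (freq_norm al))
        (\sum_i `|v i 0 l| * w (freq_norm (g i)))
    & forall al, (forall i, tg i != al) -> c al = 0].
  have hb := tC_bsum l (w := fun=> 1) (fun=> ler01).
  have hb' : bsum (fun i => nc (tC l i)) (\sum_i `|v i 0 l| * 1).
    by apply: le_bsum hb => i; rewrite mulr1.
  have [c [h1 h2 h3]] := fseries_rep hb' (fun x => trig_hsum x l).
  exists c; split=> // w w0.
  exact: (h2 (fun al => w (freq_norm al)) _ (fun al => w0 _) (tC_bsum l w0)).
have [c hcl] := choice hc.
have hs : fourier_series trigp (fun al => \row_l c l al).
  apply/fourier_seriesP => l; have [h1 _ _] := hcl l.
  by rewrite (_ : (fun al => _) = c l) //; apply/funext => al; rewrite mxE.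
pose S := [fset al | al in codom tg]%fset.
pose E (al : 'rV[int]_d) : R := euclid_norm (\row_l c l al).
have E0 al : 0 <= E al by apply: euclid_norm_ge0.
have ES al : al \notin S -> E al = 0.
  move=> alS; rewrite /E; rewrite (_ : (\row_l c l al) = 0).
    by rewrite /euclid_norm big1 ?sqrtr0 // => i _; rewrite mxE /= expr0n addr0.
  apply/rowP => l; rewrite !mxE; have [_ _ ->] := hcl l => // i.
  by apply: contra alS => /eqP <-; rewrite inE codom_f.
have GE y : Gen trigp y = (\sum_(al <- S) expR (y * freq_norm al) * E al)%:E.
  rewrite (Gen_series y hs); apply/eqP; rewrite eq_le; apply/andP; split.
    apply/esum_bsum => [al|P]; first by rewrite mulr_ge0 ?expR_ge0 ?euclid_norm_ge0.
    apply: (@le_trans _ _ (\sum_(al <- P | al \in S) expR (y * freq_norm al) * E al)).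
      rewrite [leRHS]big_mkcond /=; apply: ler_sum => al _; case: ifPn => // alS.
      by have := ES _ alS; rewrite /E => ->; rewrite mulr0.
    rewrite [leRHS](bigID (mem P)) /= -[leLHS]addr0 lerD //=; last first.
      by apply: sumr_ge0 => al _; rewrite mulr_ge0 ?expR_ge0.
    rewrite -[leRHS]big_filter -[leLHS]big_filter le_eqVlt; apply/orP; left; apply/eqP.
    apply: perm_big; apply: uniq_perm; rewrite ?filter_uniq ?fset_uniq //.
    by move=> al; rewrite !mem_filter andbC.
  apply: esum_ge; exists [set` S]; first by split=> //; apply: finite_fset.
  by rewrite (fsbig_finite _ _ (finite_fset S)) /= set_fsetK sumEFin lee_fin.
have rE : realGen trigp = fun y => \sum_(al <- S) expR (y * freq_norm al) * E al.
  by apply/funext => y; rewrite /realGen GE.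
pose G' := \sum_(al <- S) freq_norm al * expR (z * freq_norm al) * E al.
have dG : is_derive z (1 : R) (realGen trigp) G'.
  rewrite rE /G'; elim: (enum_fset S) => [|al s IH].
    rewrite big_nil; rewrite (_ : (fun y : R => _) = cst 0).
      exact: is_derive_cst.
    by apply/funext => y; rewrite big_nil.
  rewrite big_cons (_ : (fun y : R => _) = (fun y => expR (y * freq_norm al) * E al) +
    (fun y => \sum_(al <- s) expR (y * freq_norm al) * E al)); last first.
    by apply/funext => y; rewrite big_cons fctE.
  apply: is_deriveD.
  have h1 : is_derive z (1 : R) (fun y : R => expR (y * freq_norm al))
    (freq_norm al * expR (z * freq_norm al)).
    have h0 : is_derive z (1 : R) (fun y : R => y * freq_norm al) (freq_norm al).
      by apply: is_derive_eq; rewrite scaler0 add0r; exact: mulr1.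
    by rewrite mulrC; exact: (is_derive1_comp (is_derive_expR _) h0).
  by apply: is_derive_eq; rewrite scaler0 add0r; exact: mulrC.
have bnd (w : R -> R) : (forall r, 0 <= w r) ->
   \sum_(al <- S) w (freq_norm al) * E al <= \sum_i ampl i * w (freq_norm (g i)).
  move=> w0.
  apply: le_trans (ler_sum (G := fun al => \sum_l nc (c l al) * w (freq_norm al)) _ _) _.
    move=> al _; rewrite -mulr_suml mulrC ler_wpM2r //.
    by apply: le_trans (euclid_nc _) _; apply: ler_sum => l _; rewrite mxE.
  rewrite exchange_big /=; apply: le_trans (ler_sum (G := fun l => \sum_i `|v i 0 l| * w (freq_norm (g i))) _ _) _.
    by move=> l _; have [_ h _] := hcl l; apply: h.
  by rewrite exchange_big /=; apply: ler_sum => i _; rewrite -mulr_suml.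
exists (realGen trigp z), G'; split.
- by rewrite rE GE.
- split; first by case: dG.
  by split=> //; rewrite derive1E; case: dG.
- rewrite rE; apply/andP; split.
    by apply: sumr_ge0 => al _; rewrite mulr_ge0 ?expR_ge0.
  exact: (bnd (fun r => expR (z * r)) (fun=> expR_ge0 _)).
- rewrite /G'; apply/andP; split.
    by apply: sumr_ge0 => al _; rewrite !mulr_ge0 ?expR_ge0 ?freq_norm_ge0.
  pose w (r : R) := `|r| * expR (z * r).
  have := bnd w (fun r => mulr_ge0 (normr_ge0 r) (expR_ge0 _)).
  rewrite /w; under eq_bigr do rewrite ger0_norm ?freq_norm_ge0 //.
  by under [X in _ <= X]eq_bigr do rewrite ger0_norm ?freq_norm_ge0 //.
Qed.

End TrigPoly.

Section TestFunctions.
Context {R : realType} {d n : nat}.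
Variables (A : 'rV[R]_n -> 'M[R]_(d, n) -> 'rV[R]_n) (C0 : R) (F : R -> R).
Hypothesis hA : Gen_bound A C0 F.

(** What the hypothesis on the nonlinearity says of one test function: since
    [F] enters through its bound up to [K0], the bound on the image is affine in
    the derivative of [Gen]. *)
Lemma trigp_bound (J : finType) (g : J -> 'rV[int]_d) th v (z M K0 K1 : R) :
  0 <= z -> 0 <= M -> (forall y, 0 <= y -> y <= K0 -> C0 * F y <= M) ->
  \sum_i ampl v i * expR (z * freq_norm (g i)) <= K0 ->
  \sum_i ampl v i * (freq_norm (g i) * expR (z * freq_norm (g i))) <= K1 ->
  forall l, exists c : 'rV[int]_d -> R[i],
    fseries (fun x => apply_grad A (trigp g th v) x 0 l) c /\
    bsum (fun al => nc (c al) * expR (z * freq_norm al)) (M * (1 + K1)).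
Proof.
move=> z0 M0 hM h0 h1 l; apply: Gen_scalar.
have [G [G' [hG [dG [rG dG']] /andP[G0 GK] /andP[G'0 G'K]]]] := trigp_Gen g th v z.
apply: le_trans (hA z0 _ dG) _; first by rewrite hG ltry.
rewrite lee_fin rG dG'; apply: ler_pM => //.
- have : (0 <= Gen (apply_grad A (trigp g th v)) z)%E by apply: Gen_ge0.
  move/le_trans => /(_ _ (hA z0 _ dG)); rewrite hG ltry => /(_ isT).
  by rewrite lee_fin rG dG' pmulr_lge0 // ltr_wpDr.
- by rewrite addr_ge0.
- by apply: hM => //; apply: le_trans GK h0.
- by rewrite lerD2l; apply: le_trans G'K h1.
Qed.

End TestFunctions.

(** * Structure of the nonlinearity *)

Section Lipschitz.
Context {R : realType} {d : nat}.

(** A bound on [Gen] at a positive radius is a Lipschitz bound. *)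
Lemma fseries_lip (h : 'rV[R]_d -> R) c (B : R) x y : fseries h c ->
  bsum (fun al => nc (c al) * expR (1 * freq_norm al)) B ->
  `|h x - h y| <= 2 * d%:R * B * `|x - y|.
Proof.
move=> [_ hc] hB; rewrite -ncR rmorphB.
apply: (hsum_norm (hsumB (hc x) (hc y))).
have -> : 2 * d%:R * B * `|x - y| = (2 * d%:R * `|x - y|) * B by ring.
have k0 : 0 <= 2 * d%:R * `|x - y| by rewrite !mulr_ge0.
apply: le_bsum (bsumZ k0 hB) => al.
rewrite -mulrBr ncM [leRHS]mulrCA ler_wpM2l ?nc_ge0 //.
apply: le_trans (expi_lip _ _) _.
have -> : freq_dot al x - freq_dot al y = freq_dot al (x - y).
  rewrite freq_dotDr; congr (_ + _).
  by rewrite -(scaleN1r y) freq_dotZr mulN1r.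
have -> : 2 * d%:R * `|x - y| * expR (1 * freq_norm al)
  = 2 * (d%:R * (expR (1 * freq_norm al) * `|x - y|)) by ring.
rewrite ler_wpM2l //; apply: le_trans (freq_dot_le _ _) _.
rewrite ler_wpM2l // ler_wpM2r // mul1r.
by apply: le_trans (expR_ge1Dx _); rewrite lerDr.
Qed.

Lemma ampl_le n (v : 'rV[R]_n) (J : finType) (f : J -> 'rV[R]_n) i :
  f i = v -> ampl f i <= n%:R * `|v|.
Proof.
move=> <-; rewrite /ampl.
apply: le_trans (ler_sum (G := fun=> `|f i|) _ _) _.
  by move=> l _; apply: row_entry_le.
by rewrite sumr_const card_ord mulr_natl.
Qed.

Definition axis_freq (j : 'I_d) : 'rV[int]_d := delta_mx 0 j.

Lemma axis_freqE j (k : nat) i : (axis_freq j *+ k) 0 i = if i == j then k%:Z else 0.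
Proof.
rewrite mulmxnE mxE eqxx /=; case: eqP => _; last by rewrite mulr0n mul0rn.
by rewrite mulr1n -natz.
Qed.

Lemma freq_norm_axis j (k : nat) : freq_norm (axis_freq j *+ k) = k%:R :> R.
Proof.
rewrite /freq_norm (bigD1 j) //= big1 ?addr0.
  by rewrite axis_freqE eqxx sqrtr_sqr ger0_norm.
by move=> i ij; rewrite axis_freqE (negPf ij) expr0n.
Qed.

Lemma freq_dot_axis j (k : nat) (x : 'rV[R]_d) :
  freq_dot (axis_freq j *+ k) x = k%:R * x 0 j.
Proof.
rewrite /freq_dot (bigD1 j) //= big1 ?addr0; first by rewrite axis_freqE eqxx.
by move=> i ij; rewrite axis_freqE (negPf ij) mul0r.
Qed.

End Lipschitz.

Section Continuity.
Context {R : realType} {d n : nat}.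
Variables (A : 'rV[R]_n -> 'M[R]_(d, n) -> 'rV[R]_n) (C0 : R) (F : R -> R).
Hypothesis hF : forall y : R, 0 <= y -> analytic_at F y.
Hypothesis hA : Gen_bound A C0 F.
Variable j0 : 'I_d.

(** The 1-jets at [0] of these trigonometric polynomials are [(c + w, q)], and
    their 1-jets at the point [ta] of the first axis do not depend on [w].  The
    amplitudes of the two terms in [w] are the solution of a linear system. *)
Let J : finType := ('I_d + 'I_4)%type.
Let a2 (ta : R) : R := (2 * (1 - cos ta) ^+ 2)^-1.
Let a1 (ta : R) : R := - 4 * a2 ta * cos ta.
Let cg (i : J) : 'rV[int]_d := match i with
  | inl j => axis_freq j *+ 1
  | inr k => axis_freq j0 *+ nth 0%N [:: 0; 0; 1; 2]%N k end.
Let cth (ta : R) (i : J) : R := match i with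
  | inl j => - (pi / 2)
  | inr k => nth 0 [:: 0; 0; - ta; - (2 * ta)] k end.
Let cv (c : 'rV[R]_n) (q : 'M[R]_(d, n)) (ta : R) (w : 'rV[R]_n) (i : J) :=
  match i with
  | inl j => row j q
  | inr k => nth 0 [:: c; (a1 ta + a2 ta) *: w; - a1 ta *: w; - a2 ta *: w] k end.
Let cu c q ta w := trigp cg (cth ta) (cv c q ta w).

Let sumJ (V : nmodType) (f : J -> V) :
  \sum_i f i = \sum_j f (inl j) + (f (inr 0) + (f (inr 1) + (f (inr 2%:R) + f (inr 3%:R)))).
Proof.
rewrite big_sumType /=; congr (_ + _).
rewrite !big_ord_recl big_ord0 addr0.
by congr (f (inr _) + (f (inr _) + (f (inr _) + f (inr _)))); apply/val_inj.
Qed.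

Let cosB2 (t : R) : cos (t - pi / 2) = sin t. Proof. exact: cosBpihalf. Qed.

Let jet0 c q ta w : 0 < ta <= 1 ->
  cu c q ta w 0 = c + w /\ jacobian (cu c q ta w) 0 = q.
Proof.
move=> /andP[ta0 ta1].
have t_pi : 0 < ta < pi by rewrite ta0 /= (le_lt_trans ta1) // (lt_le_trans _ (@pi_ge2 R)) // ltr1n.
have c1 : 1 - cos ta != 0.
  rewrite subr_eq0 eq_sym lt_eqF // -cos0 ltr_cos // in_itv /= ?lexx ?pi_ge0 //.
  by case/andP: t_pi => /ltW -> /ltW ->.
have fd0 al : freq_dot al (0 : 'rV[R]_d) = 0.
  by rewrite /freq_dot big1 // => j _; rewrite mxE mulr0.
have a2E : a2 ta * (2 * (1 - cos ta) ^+ 2) = 1.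
  by rewrite mulVf // mulf_neq0 ?pnatr_eq0 ?expf_neq0.
split.
  rewrite /cu /trigp sumJ /= big1; last first.
    by move=> j _; rewrite fd0 cosB2 sin0 scale0r.
  rewrite !fd0 !add0r cos0 !scale1r !cosN !scalerA -!scalerDl; congr (_ + _).
  rewrite -[RHS]scale1r; congr (_ *: _).
  rewrite -[RHS]a2E mulr_natl cos_mulr2n /a1; move: (cos ta) => C; move: (a2 ta) => a; ring.
apply/matrixP => j l; rewrite jacobian_trigp mxE sumJ /=.
rewrite (bigD1 j) //= big1; last first.
  by move=> k kj; rewrite mulmxnE !mxE eqxx eq_sym (negPf kj) mul0rn mulr0 mul0r.
rewrite !fd0 !add0r sinN sin_pihalf opprK !mulmxnE !mxE !eqxx /= !mulr0n !mulr0 !mul0r.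
rewrite !add0r !addr0 /= mul1r mulr1n mul1r !sinN !opprK -[RHS]addr0; congr (_ + _).
case: (j == j0); rewrite /= ?mulr0n ?mul0rn ?mulr0 ?mul0r ?addr0 //.
rewrite mulr_natl sin_mulr2n /a1 mulr1n.
move: (cos ta) (sin ta) (a2 ta) => C S a; rewrite -[2%N]/(2%N) -pmulrn; ring.
Qed.

Let jet1 c q ta w w' :
  cu c q ta w (ta *: delta_mx 0 j0) = cu c q ta w' (ta *: delta_mx 0 j0) /\
  jacobian (cu c q ta w) (ta *: delta_mx 0 j0)
    = jacobian (cu c q ta w') (ta *: delta_mx 0 j0).
Proof.
have fd k : freq_dot (axis_freq j0 *+ k) (ta *: delta_mx 0 j0 : 'rV[R]_d) = k%:R * ta.
  by rewrite freq_dot_axis !mxE !eqxx mulr1.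
split.
  rewrite /cu /trigp !sumJ /=; congr (_ + (_ + _)).
  rewrite !fd !mul0r !addr0 mul1r !subrr cos0 !scale1r.
  by rewrite -!scalerDl addrACA !subrr addr0 !scale0r.
apply/matrixP => j l; rewrite !jacobian_trigp !mxE !sumJ /=; congr (_ + (_ + _)).
by rewrite !fd !mul0r !addr0 mul1r !subrr sin0 oppr0 !mul0r.
Qed.

(** The test functions with 1-jets [(c + w, q)] and [(c, q)] at [0] have the same
    1-jet at the point [ta] of the first axis. For small [w] their images have
    the same Lipschitz constant, so that the values at [0] of the images differ by
    [O(ta)]. *)
Lemma A_continuous c q e : 0 < e -> exists2 de, 0 < de &
  forall w l, `|w| <= de -> `|A (c + w) q 0 l - A c q 0 l| <= e.
Proof.
move=> e0.
pose P (f : R -> R) := \sum_j ampl (cv c q 0 0) (inl j) * f 1.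
pose K0 : R := n%:R * `|c| + P expR + 1.
pose K1 : R := P expR + 1.
have [M [M0 hM]] := analytic_bounded C0 K0 hF.
pose B := M * (1 + K1).
have P0 : 0 <= P expR.
  apply: sumr_ge0 => j _; rewrite mulr_ge0 ?expR_ge0 //.
  by apply: sumr_ge0.
have B0 : 0 <= B by rewrite mulr_ge0 // !addr_ge0.
pose ta := Num.min 1 (e / (4 * d%:R * B + 1)).
have D0 : 0 < 4 * d%:R * B + 1 by apply: ltr_wpDl => //; nonneg.
have ta0 : 0 < ta by rewrite /ta lt_min ltr01 divr_gt0.
have ta1 : ta <= 1 by rewrite /ta ge_min lexx.
have tae : 4 * d%:R * B * ta <= e.
  apply: (@le_trans _ _ ((4 * d%:R * B + 1) * ta)).
    by rewrite ler_wpM2r ?(ltW ta0) // lerDl.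
  by rewrite mulrC -ler_pdivlMr // /ta ge_min lexx orbT.
(* for |w| <= 1 / W the terms in w add at most 1 to the norms of the test function *)
pose W := n%:R * (`|a1 ta + a2 ta| + `|a1 ta| * expR 1 + `|a2 ta| * (2 * expR 2)) + 1.
have W0 : 0 < W by apply: ltr_wpDl => //; nonneg.
have key w : `|w| <= W^-1 -> forall l, `|A (c + w) q 0 l -
    apply_grad A (cu c q ta w) (ta *: delta_mx 0 j0) 0 l| <= 2 * d%:R * B * ta.
  move=> hw l.
  have [amp0 amp1 amp2 amp3] : [/\ ampl (cv c q ta w) (inr 0) <= n%:R * `|c|,
      ampl (cv c q ta w) (inr 1) <= n%:R * (`|a1 ta + a2 ta| * `|w|),
      ampl (cv c q ta w) (inr 2%:R) <= n%:R * (`|a1 ta| * `|w|) &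
      ampl (cv c q ta w) (inr 3%:R) <= n%:R * (`|a2 ta| * `|w|)].
    split; [|rewrite -normrZ|rewrite -(normrN (a1 ta)) -normrZ|
      rewrite -(normrN (a2 ta)) -normrZ]; exact: ampl_le.
  have Ww : W * `|w| <= 1 by rewrite mulrC -ler_pdivlMr // mul1r.
  have e12 : expR (1 : R) <= expR 2 by rewrite ler_expR ler1n.
  have w0 := normr_ge0 w; have ee := expR_ge0 (1 : R).
  have ee2 := expR_ge0 (2 : R).
  have Psum (f : R -> R) : \sum_j ampl (cv c q ta w) (inl j) * f (freq_norm (cg (inl j))) = P f.
    by apply: eq_bigr => j _; rewrite /= freq_norm_axis.
  have n0 : 0 <= n%:R :> R by [].
  have x1 := normr_ge0 (a1 ta + a2 ta); have x2 := normr_ge0 (a1 ta).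
  have x3 := normr_ge0 (a2 ta).
  move: (ampl_le (v := c) (f := cv c q ta w) (i := inr 0) erefl) amp1 amp2 amp3 Ww.
  rewrite /W => {}amp0 amp1 amp2 amp3 Ww.
  have t2 := ler_wpM2r ee amp2; have t3 := ler_wpM2r ee2 amp3.
  have z1 : 0 <= n%:R * `|a1 ta + a2 ta| * `|w| by nonneg.
  have z2 : 0 <= n%:R * `|a2 ta| * `|w| * expR 2 by nonneg.
  have hK0 : \sum_i ampl (cv c q ta w) i * expR (1 * freq_norm (cg i)) <= K0.
    rewrite sumJ (Psum (fun r => expR (1 * r))) /P.
    under eq_bigr do rewrite mulr1.
    rewrite -/(P expR) /= !freq_norm_axis !mul1r !expR0 !mulr1 /K0.
    clear -amp0 amp1 t2 t3 Ww z1 z2 w0.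
    move: (ampl _ _) (ampl _ _) (ampl _ _) (ampl _ _) amp0 amp1 t2 t3.
    move: (P expR) (n%:R * `|c|) (expR 1) (expR 2) `|w| `|a1 ta| `|a2 ta|
      (`|a1 ta + a2 ta|) Ww z1 z2 w0.
    by move=> p Nc E1 E2 w' x2 x3 x1 Ww z1 z2 w0 b0 b1 b2 b3 h0 h1 h2 h3; lra.
  have hK1 : \sum_i ampl (cv c q ta w) i * (freq_norm (cg i) * expR (1 * freq_norm (cg i))) <= K1.
    rewrite sumJ (Psum (fun r => r * expR (1 * r))) /P.
    under eq_bigr do rewrite !mul1r.
    rewrite -/(P expR) /= !freq_norm_axis !mul1r !mul0r !mulr0 !add0r /K1.
    clear -amp0 amp1 t2 t3 Ww z1 z2 w0.
    move: (ampl _ _) (ampl _ _) t2 t3.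
    move: (P expR) (expR 1) (expR 2) `|w| `|a1 ta| `|a2 ta|
      (`|a1 ta + a2 ta|) Ww z1 z2 w0.
    by move=> p E1 E2 w' x2 x3 x1 Ww z1 z2 w0 b2 b3 h2 h3; lra.
  have [h [hs hb]] := trigp_bound hA (cth ta) ler01 M0 hM hK0 hK1 l.
  have [j1 j2] := jet0 c q w (ta := ta) (introT andP (conj ta0 ta1)).
  have := fseries_lip 0 (ta *: delta_mx 0 j0) hs hb.
  rewrite {1}/apply_grad -/(cu c q ta w) j1 j2 => /le_trans; apply.
  apply: (ler_wpM2l (mulr_ge0 (mulr_ge0 _ _) B0)) => //.
  rewrite sub0r normrN normrZ gtr0_norm // ler_piMr ?(ltW ta0) //.
  rewrite [leLHS]/Num.Def.normr/= mx_normrE bigmax_le // => -[i k] _ /=.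
  by rewrite mxE; case: (_ && _); rewrite ?normr1 ?normr0.
exists W^-1; first by rewrite invr_gt0.
move=> w l hw.
have h0 : `|0 : 'rV[R]_n| <= W^-1 by rewrite normr0 invr_ge0 ltW.
have := key w hw l; have := key 0 h0 l; rewrite addr0 /apply_grad.
have [-> ->] := jet1 c q ta w 0.
set X := A _ _ 0 l; set Y := A _ _ 0 l; set Z := A _ _ 0 l => h1 h2.
have -> : Z - X = (Z - Y) - (X - Y) by ring.
apply: le_trans (ler_normB _ _) _; apply: le_trans (lerD h2 h1) _.
by apply: le_trans tae; rewrite le_eqVlt; apply/orP; left; apply/eqP; ring.
Qed.

End Continuity.

Section Affine.
Context {R : realType} {d n : nat}.
Variables (A : 'rV[R]_n -> 'M[R]_(d, n) -> 'rV[R]_n) (C0 : R) (F : R -> R).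
Hypothesis hF : forall y : R, 0 <= y -> analytic_at F y.
Hypothesis hA : Gen_bound A C0 F.
Variable j0 : 'I_d.

(** A period of the function is a period of all the characters that occur. *)
Lemma fseries_periodic (h : 'rV[R]_d -> R) c v : fseries h c ->
  (forall x, h (x + v) = h x) ->
  forall al, c al != 0 -> expi (freq_dot al v) = 1.
Proof.
move=> [[K hK] hc] hv al cal.
have h1 : bsum (fun be => nc (c be * expi (freq_dot be v))) K.
  by apply: le_bsum hK => be; rewrite ncM nc_expi mulr1.
have h2 x : hsum (fun be => c be * expi (freq_dot be v) * expi (freq_dot be x)) (h x)%:C%C.
  rewrite -hv; apply: eq_hsum (hc (x + v)) => be.
  by rewrite freq_dotDr expiD -mulrA; congr (_ * _); apply: mulrC.
have /(congr1 (fun f => f al)) H := fourier_uniq h1 hK h2 hc.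
by apply: (mulfI cal); rewrite mulr1.
Qed.

(** The constant 7 / 5 is below [sqrt 2], the length of the shortest integer
    vectors other than [0] and the [+- e_j]. *)
Lemma low_freq (k : nat) (al : 'rV[int]_d) : (0 < k)%N ->
  (forall j, (k %| (al 0 j)%R)%Z) -> freq_norm al < (7 / 5 * k%:R : R) ->
  exists s : int, [|| s == 0, s == 1 | s == -1] /\
    \sum_j (al 0 j)%:~R = k%:R * s%:~R :> R.
Proof.
move=> k0 hk hn.
have k0R : 0 < k%:R :> R by rewrite ltr0n.
pose m j := ((al 0 j)%R %/ k)%Z.
have mE j : al 0 j = m j * k by rewrite /m divzK.
have hs : \sum_j (m j) ^+ 2 < 2.
  have : freq_norm al ^+ 2 < (7 / 5 * k%:R) ^+ 2 :> R.
    by rewrite ltrXn2r ?nnegrE ?freq_norm_ge0 // mulr_ge0 // ltW.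
  rewrite sqr_sqrtr; last by apply: sumr_ge0 => j _; apply: sqr_ge0.
  have -> : \sum_j (al 0 j)%:~R ^+ 2 = k%:R ^+ 2 * (\sum_j (m j) ^+ 2)%:~R :> R.
    rewrite rmorph_sum mulr_sumr; apply: eq_bigr => j _.
    by rewrite mE rmorphXn rmorphM /= exprMn mulrC.
  rewrite exprMn mulrC ltr_pM2r ?exprn_gt0 // => h.
  rewrite -(ltr_int R); apply: lt_trans h _; lra.
have hsum s : \sum_j m j = s -> \sum_j (al 0 j)%:~R = k%:R * s%:~R :> R.
  move=> <-; rewrite rmorph_sum mulr_sumr; apply: eq_bigr => j _.
  by rewrite mE rmorphM /= mulrC.
case: (boolP [forall j, m j == 0]) => [/forallP m0|].
  exists 0; split=> //; apply: hsum; rewrite big1 // => j _; exact/eqP.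
rewrite negb_forall => /existsP[j mj].
have mj1 : 1 <= (m j) ^+ 2.
  have : 0 < (m j) ^+ 2 by rewrite exprn_even_gt0.
  by [].
have other i : i != j -> m i = 0.
  move=> ij; apply/eqP; apply: contraTT hs => mi.
  have mi1 : 1 <= (m i) ^+ 2 by have : 0 < (m i) ^+ 2 by rewrite exprn_even_gt0.
  rewrite (bigD1 j) //= (bigD1 i) //= -leNgt.
  rewrite addrA -[2]addr0 lerD ?(lerD mj1 mi1) //.
  by apply: sumr_ge0 => ? _; apply: sqr_ge0.
exists (m j); split; last first.
  by apply: hsum; rewrite (bigD1 j) //= big1 ?addr0 // => i; apply: other.
move: hs; rewrite (bigD1 j) //= big1 ?addr0; last by move=> i /other ->; rewrite expr0n.
rewrite expr2; nia.
Qed.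

(** This combination of the values of a function of one variable vanishes on
    the trigonometric polynomials of degree at most one. *)
Definition defect1 (y : R) (H : R -> R[i]) : R[i] :=
  let mu := 2^-1 * (H 0 + H pi) in
  H y - mu - (cos y)%:C%C * (H 0 - mu) - (sin y)%:C%C * (H (pi / 2) - mu).

Lemma defect1_deg1 y (s : int) : [|| s == 0, s == 1 | s == -1] ->
  defect1 y (fun t => expi (t * s%:~R)) = 0.
Proof.
case/or3P => /eqP ->.
- rewrite (_ : (fun t : R => _) = fun=> 1) /defect1; last first.
    by apply/funext => t; rewrite mulr0 expi0.
  by field.
- rewrite (_ : (fun t : R => _) = expi) /defect1; last first.
    by apply/funext => t; rewrite mulr1.
  rewrite expi0; have -> : expi pi = - 1 :> R[i].
    by rewrite /expi cospi sinpi; apply/eqP; rewrite eq_complex /= oppr0 !eqxx.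
  rewrite subrr mulr0 !subr0 mulr1 /expi cos_pihalf sin_pihalf.
  by apply/eqP; rewrite eq_complex /=; apply/andP; split; apply/eqP; ring.
- rewrite (_ : (fun t : R => _) = fun t => expi (- t)) /defect1; last first.
    by apply/funext => t; rewrite mulrNz mulrN mulr1.
  rewrite oppr0 expi0; have -> : expi (- pi) = - 1 :> R[i].
    by rewrite /expi cosN sinN cospi sinpi oppr0; apply/eqP; rewrite eq_complex /= oppr0 !eqxx.
  rewrite subrr mulr0 !subr0 mulr1 /expi !cosN !sinN cos_pihalf sin_pihalf.
  by apply/eqP; rewrite eq_complex /=; apply/andP; split; apply/eqP; ring.
Qed.

Lemma defect1_bound y (H : R -> R[i]) b : (forall t, nc (H t) <= b) ->
  nc (defect1 y H) <= 6 * b.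
Proof.
move=> hb; rewrite /defect1; set mu := _ * _.
have b0 : 0 <= b by apply: le_trans (hb 0); apply: nc_ge0.
have hmu : nc mu <= b.
  rewrite /mu ncM ComplexField.Normc.normcV.
  have -> : nc (2 : R[i]) = 2 by rewrite -(rmorph_nat (real_complex R)) ncR normr_nat.
  rewrite ler_pdivrMl // mulr_natl mulr2n.
  by apply: le_trans (ncD _ _) (lerD (hb _) (hb _)).
have hd t : nc (H t - mu) <= b + b.
  by apply: le_trans (ncD _ _) _; rewrite ncN lerD.
have hk (r : R) z : `|r| <= 1 -> nc z <= b + b -> nc (r%:C%C * z) <= b + b.
  move=> r1 hz; rewrite ncM ncR; apply: le_trans hz.
  by rewrite -[leRHS]mul1r ler_wpM2r ?nc_ge0.
have -> : 6 * b = (b + b) + (b + b) + (b + b) by ring.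
apply: le_trans (ncD _ _) _; rewrite ncN lerD ?hk ?sin_max //.
by apply: le_trans (ncD _ _) _; rewrite ncN lerD ?hk ?cos_max.
Qed.

Lemma hsum_defect1 (I : choiceType) (a : I -> R -> R[i]) (H : R -> R[i]) y :
  (forall t, hsum (fun i => a i t) (H t)) ->
  hsum (fun i => defect1 y (a i)) (defect1 y H).
Proof.
move=> h; have hmu := hsumZ (2^-1) (hsumD (h 0) (h pi)).
exact: hsumB (hsumB (hsumB (h y) hmu) (hsumZ _ (hsumB (h 0) hmu)))
  (hsumZ _ (hsumB (h (pi / 2)) hmu)).
Qed.

(** The test function [a + k^-1 (sum_j sin (k x_j) M_j - cos (k x_j) M'_j)], where
    [M_j] and [M'_j] are the [j]-th rows: it stays close to [a], and the [j]-th row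
    of its gradient is [cos (k x_j) M_j + sin (k x_j) M'_j]. *)
Let J : finType := ('I_d + ('I_d + 'I_1))%type.
Let ag (k : nat) (i : J) : 'rV[int]_d := match i with
  | inl j | inr (inl j) => axis_freq j *+ k | _ => 0 end.
Let ath (i : J) : R := match i with inl j => - (pi / 2) | _ => 0 end.
Let av (a : 'rV[R]_n) (M M' : 'M[R]_(d, n)) (k : nat) (i : J) : 'rV[R]_n :=
  match i with inl j => k%:R^-1 *: row j M
  | inr (inl j) => - k%:R^-1 *: row j M' | _ => a end.
Let au a M M' k := trigp (ag k) ath (av a M M' k).

Let sumJ (V : nmodType) (f : J -> V) :
  \sum_i f i = \sum_j f (inl j) + (\sum_j f (inr (inl j)) + f (inr (inr 0))).
Proof. by rewrite !big_sumType /= big_ord1. Qed.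

Let ajac a M M' k x : (0 < k)%N -> jacobian (au a M M' k) x =
  \matrix_(j, l) (cos (k%:R * x 0 j) * M j l + sin (k%:R * x 0 j) * M' j l).
Proof.
move=> k0; have k0' : k%:R != 0 :> R by rewrite pnatr_eq0 -lt0n.
apply/matrixP => j l; rewrite jacobian_trigp !mxE sumJ /= mxE mulr0 mul0r addr0.
congr (_ + _); rewrite (bigD1 j) //= big1 ?addr0.
- by rewrite freq_dot_axis axis_freqE eqxx sinBpihalf opprK !mxE; field.
- by move=> i ij; rewrite axis_freqE eq_sym (negPf ij) mulr0 mul0r.
- by rewrite ?addr0 freq_dot_axis axis_freqE eqxx !mxE; field.
- by move=> i ij; rewrite axis_freqE eq_sym (negPf ij) mulr0 mul0r.
Qed.

Let au_near a M M' k x : (0 < k)%N -> exists w : 'rV[R]_n, au a M M' k x = a + w /\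
  `|w| <= k%:R^-1 * \sum_j (`|row j M| + `|row j M'|).
Proof.
move=> k0; rewrite /au /trigp sumJ /= freq_dot0l add0r cos0 scale1r addrA addrC.
eexists; split; first by [].
apply: le_trans (ler_normD _ _) _; rewrite big_split mulrDr /=.
have k1 : 0 <= k%:R^-1 :> R by rewrite invr_ge0.
by apply: lerD; apply: le_trans (ler_norm_sum _ _ _) _; rewrite mulr_sumr;
  apply: ler_sum => j _; rewrite !normrZ ?normrN (ger0_norm k1) ler_piMl ?cos_max
    // mulr_ge0.
Qed.

Let aperiod a M M' k j : (0 < k)%N -> forall x,
  apply_grad A (au a M M' k) (x + (pi *+ 2 / k%:R) *: delta_mx 0 j)
  = apply_grad A (au a M M' k) x.
Proof.
move=> k0 x; have k0' : k%:R != 0 :> R by rewrite pnatr_eq0 -lt0n.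
have kv i : k%:R * ((pi *+ 2 / k%:R) * (i == j)%:R) =
   if i == j then pi *+ 2 else 0 :> R.
  case: eqP => _; rewrite ?mulr0 // mulr1.
  by rewrite mulrCA divff ?mulr1.
have hcos i t : cos (t + (if i == j then pi *+ 2 else 0)) = cos t :> R.
  by case: ifP; rewrite ?addr0 // cosD2pi.
have hsin i t : sin (t + (if i == j then pi *+ 2 else 0)) = sin t :> R.
  by case: ifP; rewrite ?addr0 // sinD2pi.
rewrite /apply_grad !ajac //; congr A; last first.
  by apply/matrixP => i l; rewrite !mxE eqxx /= mulrDr kv hcos hsin.
rewrite /au /trigp !sumJ /=; congr (_ + (_ + _)); last by rewrite !freq_dot0l.
  by apply: eq_bigr => i _; rewrite !freq_dot_axis !mxE eqxx /= mulrDr kv addrAC hcos.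
by apply: eq_bigr => i _; rewrite !freq_dot_axis !mxE eqxx /= mulrDr kv addrAC hcos.
Qed.

(** Along a fast and small oscillation about [a] the gradient runs through the
    ellipse [cos y M + sin y M']. At the radius [z = Z / k] the derivative of [Gen]
    is of order [e^Z], and a bound that is linear in it leaves no room for
    frequencies of length at least [sqrt 2 k], whose weight is [e^(sqrt 2 Z)]: in
    the limit the nonlinearity has degree at most one along the ellipse. *)
Lemma A_ellipse a M M' y l :
  defect1 y (fun t => (A a (cos t *: M + sin t *: M') 0 l)%:C%C) = 0.
Proof.
pose p (t : R) : 'M[R]_(d, n) := cos t *: M + sin t *: M'.
pose Q : R := \sum_j (ampl (fun j => row j M) j + ampl (fun j => row j M') j).
pose Q' : R := \sum_j (`|row j M| + `|row j M'|).
pose K0 : R := ampl (fun _ : 'I_1 => a) 0 + 1.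
have [B [B0 hB]] := analytic_bounded C0 K0 hF.
have Q0 : 0 <= Q by apply: sumr_ge0 => j _; rewrite addr_ge0 //; apply: sumr_ge0.
have Q'0 : 0 <= Q' by apply: sumr_ge0 => j _; rewrite addr_ge0.
apply: nc_eq0; apply/eqP; rewrite eq_le nc_ge0 andbT.
apply/ler_addgt0Pl => e e0; rewrite addr0.
pose e1 := e / 12; have e10 : 0 < e1 by rewrite divr_gt0.
have cont t : exists2 de, 0 < de & forall w, `|w| <= de ->
   `|A (a + w) (p t) 0 l - A a (p t) 0 l| <= e1.
  have [de de0 h] := A_continuous hF hA j0 a (p t) e10.
  by exists de => // w; apply: h.
have [d1 d10 h1] := cont 0; have [d2 d20 h2] := cont pi.
have [d3 d30 h3] := cont (pi / 2); have [d4 d40 h4] := cont y.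
pose de := Num.min (Num.min d1 d2) (Num.min d3 d4).
have de0 : 0 < de by rewrite !lt_min d10 d20 d30.
(* Z makes the harmonics of order at least two small *)
pose Z := 5 / 2 * (B * (1 + Q) / e1); have Z0 : 0 <= Z.
  by rewrite /Z; apply: mulr_ge0 => //; apply: divr_ge0; rewrite ?(ltW e10) //; nonneg.
have hZ : B * (1 + Q * expR Z) * expR (- (7 / 5 * Z)) <= e1.
  have eZ : B * (1 + Q) / e1 <= expR (2 / 5 * Z).
    apply: le_trans (expR_ge1Dx _); rewrite /Z mulrA.
    have -> : 2 / 5 * (5 / 2) = 1 :> R by field.
    by rewrite mul1r lerDr.
  apply: (@le_trans _ _ (B * (1 + Q) * expR Z * expR (- (7 / 5 * Z)))).
    rewrite ler_wpM2r ?expR_ge0 // -mulrA ler_wpM2l //.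
    rewrite mulrDl mul1r lerD2r; apply: le_trans (expR_ge1Dx _).
    by rewrite lerDl.
  rewrite -mulrA -expRD (_ : Z + _ = - (2 / 5 * Z)); last by field.
  by rewrite expRN ler_pdivrMr ?expR_gt0 // [leRHS]mulrC -ler_pdivrMr.
(* k makes the oscillation small, also after multiplication by e^Z *)
pose k := (Num.truncn (Num.max (Q * expR Z) (Q' / de))).+1.
have k0 : (0 < k)%N by [].
have kR : 0 < k%:R :> R by rewrite ltr0n.
have kmax : Num.max (Q * expR Z) (Q' / de) <= k%:R.
  by apply: ltW; apply: truncnS_gt.
have kQ : k%:R^-1 * (Q * expR Z) <= 1.
  by rewrite ler_pdivrMl // mulr1; apply: le_trans kmax; rewrite le_max lexx.
have kQ' : k%:R^-1 * Q' <= de.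
  rewrite ler_pdivrMl // -ler_pdivrMr //; apply: le_trans kmax.
  by rewrite le_max lexx orbT.
pose z := Z / k%:R; have z0 : 0 <= z by rewrite divr_ge0.
have zk : z * k%:R = Z by rewrite /z divfK ?gt_eqF.
have amp1 j : ampl (av a M M' k) (inl j) = k%:R^-1 * ampl (fun j => row j M) j.
  rewrite /ampl mulr_sumr; apply: eq_bigr => i _; rewrite /= mxE normrM.
  by rewrite normfV normr_nat.
have amp2 j : ampl (av a M M' k) (inr (inl j)) = k%:R^-1 * ampl (fun j => row j M') j.
  rewrite /ampl mulr_sumr; apply: eq_bigr => i _; rewrite /= mxE normrM.
  by rewrite normrN normfV normr_nat.
have sumw (w : R -> R) : \sum_i ampl (av a M M' k) i * w (freq_norm (ag k i))
   = k%:R^-1 * Q * w k%:R + ampl (fun _ : 'I_1 => a) 0 * w 0.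
  rewrite sumJ addrA; congr (_ + _); last by rewrite /= freq_norm0.
  rewrite /Q big_split mulrDr mulrDl !mulr_sumr !mulr_suml; congr (_ + _).
    by apply: eq_bigr => j _; rewrite amp1 /= freq_norm_axis.
  by apply: eq_bigr => j _; rewrite amp2 /= freq_norm_axis.
have hK0 : \sum_i ampl (av a M M' k) i * expR (z * freq_norm (ag k i)) <= K0.
  rewrite (sumw (fun r => expR (z * r))) zk mulr0 expR0 mulr1 addrC lerD2l.
  by rewrite -mulrA.
have hK1 : \sum_i ampl (av a M M' k) i * (freq_norm (ag k i) * expR (z * freq_norm (ag k i)))
    <= Q * expR Z.
  rewrite (sumw (fun r => r * expR (z * r))) zk mul0r mulr0 addr0.
  by rewrite le_eqVlt; apply/orP; left; apply/eqP; field; rewrite gt_eqF.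
have [c [hc hb]] := trigp_bound hA ath z0 B0 hB hK0 hK1 l.
pose xt (t : R) : 'rV[R]_d := (t / k%:R) *: const_mx 1.
pose H (t : R) := (apply_grad A (au a M M' k) (xt t) 0 l)%:C%C : R[i].
have HE t : exists2 w : 'rV[R]_n, `|w| <= de & H t = (A (a + w) (p t) 0 l)%:C%C.
  have [w [hw1 hw2]] := au_near a M M' (xt t) k0.
  exists w; first exact: le_trans kQ'.
  rewrite /H /apply_grad hw1 ajac //; congr ((A _ _ 0 l)%:C%C).
  apply/matrixP => i j; rewrite !mxE mulr1.
  by rewrite mulrCA divff ?mulr1 ?gt_eqF.
have hsupp al : c al != 0 -> forall j, (k %| (al 0 j)%R)%Z.
  move=> cal j.
  have := fseries_periodic (v := (pi *+ 2 / k%:R) *: delta_mx 0 j) hc _ cal.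
  have -> : freq_dot al ((pi *+ 2 / k%:R) *: delta_mx 0 j) = grid_angle k (al 0 j) :> R.
    rewrite /freq_dot (bigD1 j) //= big1 ?addr0; last first.
      by move=> i ij; rewrite !mxE (negPf ij) andbF !mulr0.
    by rewrite !mxE !eqxx mulr1 /grid_angle mulrA.
  move=> h; rewrite -(expi_grid_angle_eq1 (R := R)) //; apply/eqP; apply: h => x.
  by rewrite aperiod.
have Hs t : hsum (fun al => c al * expi (t * (\sum_j (al 0 j)%:~R / k%:R))) (H t).
  apply: eq_hsum (hc.2 (xt t)) => al; congr (_ * expi _).
  rewrite /freq_dot mulr_sumr; apply: eq_bigr => j _; rewrite !mxE mulr1.
  by rewrite mulrCA mulrA.
have defH : nc (defect1 y H) <= 6 * e1.
  apply: (hsum_norm (hsum_defect1 y Hs)).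
  have hb2 := bsumZ (expR_ge0 (- (7 / 5 * Z))) hb.
  have : bsum (fun al => 6 * (expR (- (7 / 5 * Z)) * (nc (c al) * expR (z * freq_norm al)))) (6 * e1).
    apply: bsumZ => //; apply: bsum_le hb2 _.
    by rewrite mulrC.
  apply: le_bsum => al.
  have [->|cal] := eqVneq (c al) 0.
    rewrite nc0 mul0r !mulr0 (_ : defect1 _ _ = 0) ?nc0 //.
    rewrite /defect1 !mul0r; ring.
  case: (ltrP (freq_norm al : R) (7 / 5 * k%:R)) => [lo|hi].
    have [s [hs1 hs2]] := low_freq k0 (hsupp al cal) lo.
    rewrite (_ : defect1 _ _ = c al * defect1 y (fun t => expi (t * s%:~R))).
      by rewrite defect1_deg1 // mulr0 nc0; nonneg; apply: nc_ge0.
    have -> : \sum_j (al 0 j)%:~R / k%:R = s%:~R :> R.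
      by rewrite -mulr_suml hs2 mulrC mulKf ?gt_eqF.
    rewrite /defect1; ring.
  have dk t : nc (c al * expi (t * \sum_j (al 0 j)%:~R / k%:R))
     <= expR (- (7 / 5 * Z)) * (nc (c al) * expR (z * freq_norm al)).
    rewrite ncM nc_expi mulr1 mulrCA ler_peMr ?nc_ge0 //.
    rewrite -expRD -[leLHS]expR0 ler_expR addrC subr_ge0 -zk mulrCA.
    by rewrite ler_wpM2l.
  exact: (defect1_bound y dk).
have H1 : nc (H 0 - (A a (p 0) 0 l)%:C%C) <= e1.
  have [w hw ->] := HE 0; rewrite -rmorphB ncR; apply: h1; apply: le_trans hw _.
  by rewrite /de !ge_min lexx.
have H2 : nc (H pi - (A a (p pi) 0 l)%:C%C) <= e1.
  have [w hw ->] := HE pi; rewrite -rmorphB ncR; apply: h2; apply: le_trans hw _.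
  by rewrite /de !ge_min lexx !orbT.
have H3 : nc (H (pi / 2) - (A a (p (pi / 2)) 0 l)%:C%C) <= e1.
  have [w hw ->] := HE (pi / 2); rewrite -rmorphB ncR; apply: h3; apply: le_trans hw _.
  by rewrite /de !ge_min lexx !orbT.
have H4 : nc (H y - (A a (p y) 0 l)%:C%C) <= e1.
  have [w hw ->] := HE y; rewrite -rmorphB ncR; apply: h4; apply: le_trans hw _.
  by rewrite /de !ge_min lexx !orbT.
(* only four values enter the defect *)
pose D t := if (t == 0) || (t == pi) || (t == pi / 2) || (t == y) then
   H t - (A a (p t) 0 l)%:C%C else 0.
have hD t : nc (D t) <= e1.
  rewrite /D; case: ifP => [|_]; last by rewrite nc0 ltW.
  by case/orP => [/orP[/orP[]|]|] /eqP ->.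
pose a' t : R[i] := (A a (p t) 0 l)%:C%C.
have aE t : (t == 0) || (t == pi) || (t == pi / 2) || (t == y) -> a' t = H t - D t.
  by rewrite /D => ->; rewrite opprB addrC subrK.
have -> : defect1 y (fun t => (A a (cos t *: M + sin t *: M') 0 l)%:C%C)
  = defect1 y H - defect1 y D.
  rewrite -/a' -[LHS]/(defect1 y a') /defect1 !aE ?eqxx ?orbT //.
  move: (H 0) (H pi) (H (pi / 2)) (H y) (D 0) (D pi) (D (pi / 2)) (D y).
  by move=> *; ring.
apply: le_trans (ncD _ _) _; rewrite ncN.
apply: le_trans (lerD defH (defect1_bound y hD)) _.
by rewrite -mulr2n -mulr_natr /e1 le_eqVlt; apply/orP; left; apply/eqP; field.
Qed.

(** The mean value over an ellipse through [M] and [- M] does not depend on the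
    ellipse, and is the value at [0]: the degenerate ellipse of [0] and [M] passes
    through [0]. Minus its value at [0] the nonlinearity is then linear along
    ellipses, hence linear. *)
Lemma A_affine a p l : A a p 0 l = A a 0 0 l +
  \sum_j \sum_m p j m * (A a (delta_mx j m) 0 l - A a 0 0 l).
Proof.
pose G (M : 'M[R]_(d, n)) := A a M 0 l.
have ell M M' y : G (cos y *: M + sin y *: M') =
   (G M + G (- M)) / 2 + cos y * (G M - (G M + G (- M)) / 2)
   + sin y * (G M' - (G M + G (- M)) / 2).
  have := A_ellipse a M M' y l; rewrite /defect1 cos0 sin0 cospi sinpi cos_pihalf sin_pihalf.
  rewrite !scale1r !scale0r !addr0 !add0r scaleN1r -/(G M) -/(G (- M)) -/(G M') -/(G _).
  move/(congr1 (@complex.Re R)) => /=.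
  move: (G (cos y *: M + sin y *: M')) (G M) (G M') (G (- M)) (cos y) (sin y).
  move=> g1 g2 g3 g4 cy sy h; apply/eqP; rewrite -subr_eq0 -[X in _ == X]h.
  have k4 : (1 + 1) ^+ 2 + (0 + 0) ^+ 2 = 4 :> R by ring.
  by rewrite k4; apply/eqP; field.
have G0 M : (G M + G (- M)) / 2 = G 0.
  have := ell M 0 (- (pi / 2)).
  rewrite cosN sinN cos_pihalf sin_pihalf scale0r scaler0 addr0 mul0r => h; lra.
pose L M := G M - G 0.
have hL M M' y : L (cos y *: M + sin y *: M') = cos y * L M + sin y * L M'.
  by rewrite /L ell G0; ring.
have L0 : L 0 = 0 by rewrite /L subrr.
have s1 : 0 < sin 1 :> R by apply: sin2_gt0; rewrite ltr01 ltr1n.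
have LZ1 r M : `|r| <= 1 -> L (r *: M) = r * L M.
  move=> r1; have := hL M 0 (acos r).
  rewrite scaler0 addr0 L0 mulr0 addr0 acosK //.
  by rewrite in_itv /= -ler_norml.
have LZ r M : L (r *: M) = r * L M.
  have [|r1] := leP `|r| 1; first exact: LZ1.
  have r0 : r != 0 by rewrite -normr_gt0 (lt_trans ltr01).
  have := LZ1 r^-1 (r *: M); rewrite normfV invf_le1 ?normr_gt0 // => /(_ (ltW r1)).
  by rewrite scalerA mulVf // scale1r => ->; rewrite mulVKf.
have LD M M' : L (M + M') = L M + L M'.
  have := hL ((cos 1)^-1 *: M) ((sin 1)^-1 *: M') 1.
  have c1 : cos 1 != 0 :> R by rewrite gt_eqF ?cos1_gt0.
  by rewrite !scalerA !divff ?(gt_eqF s1) // !scale1r !LZ !mulrA !divff ?(gt_eqF s1) // !mul1r.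
have LS (I : finType) (f : I -> 'M[R]_(d, n)) : L (\sum_i f i) = \sum_i L (f i).
  by elim/big_rec2: _ => [|i y1 y2 _ <-]; rewrite ?L0 ?LD.
rewrite -[LHS]/(G p) (_ : G p = G 0 + L p); last by rewrite /L addrC subrK.
congr (_ + _); rewrite {1}(matrix_sum_delta p) LS; apply: eq_bigr => j _.
by rewrite LS; apply: eq_bigr => m _; rewrite LZ.
Qed.

End Affine.

(** * Cosine and sine expansions in several variables *)

Lemma bsum_ffun (R : realType) (n : nat) (w : nat -> R) (W : R) :
  (forall k, 0 <= w k) -> (forall r, \sum_(k < r) w k <= W) ->
  bsum (fun r : {ffun 'I_n -> nat} => \prod_i w (r i)) (W ^+ n).
Proof.
move=> w0 hW Q.
pose B := (\max_(r <- Q) \max_(i < n) r i).+1.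
have hB r i : r \in Q -> (r i < B)%N.
  move=> rQ; rewrite /B ltnS; apply: leq_trans (leq_bigmax_seq _ rQ isT).
  exact: (leq_bigmax (F := fun i : 'I_n => r i) i).
pose emb (m : {ffun 'I_n -> 'I_B}) : {ffun 'I_n -> nat} := [ffun i => m i : nat].
have emb_inj : injective emb.
  move=> m m' /ffunP h; apply/ffunP => i; apply/val_inj.
  by have := h i; rewrite !ffunE.
apply: (@le_trans _ _ (\sum_(m : {ffun 'I_n -> 'I_B}) \prod_i w (emb m i))); last first.
  under eq_bigr do under eq_bigr do rewrite ffunE.
  rewrite -(bigA_distr_bigA (fun i (k : 'I_B) => w k)) /= prodr_const card_ord.
  have h0 : 0 <= \sum_(k < B) w k by apply: sumr_ge0.
  by apply: lerXn2r; rewrite ?nnegrE ?hW ?(le_trans h0 (hW B)).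
rewrite [leRHS](_ : _ = \sum_(r <- [seq emb m | m <- index_enum {ffun 'I_n -> 'I_B}])
  \prod_i w (r i));  last by rewrite big_map.
rewrite [leRHS](bigID (mem Q)) /= -[leLHS]addr0 lerD //; last first.
  by apply: sumr_ge0 => r _; apply: prodr_ge0.
rewrite -[leRHS]big_filter le_eqVlt; apply/orP; left; apply/eqP.
apply: perm_big; apply: uniq_perm; rewrite ?fset_uniq //.
  by rewrite filter_uniq // map_inj_uniq // index_enum_uniq.
move=> r; rewrite mem_filter; apply/idP/andP => [rQ|[]//]; split=> //.
apply/mapP; exists [ffun i => inord (r i)]; first by rewrite mem_index_enum.
by apply/ffunP => i; rewrite !ffunE inordK // hB.
Qed.

Lemma eq_compl_mod (N x y q : nat) : (x < N)%N -> (y < N)%N -> (0 < y)%N ->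
  (x + y = q * N)%N -> x = (N - y)%N.
Proof. by case: q => [|[|q]]; rewrite ?mulSn ?mul0n; lia. Qed.

(** The [n]-fold analogues of the discrete cosine and sine transforms: [o] says in
    which variables the function is odd. *)
Section GridMean.
Context {R : realType} {n : nat}.
Variable N' : nat.
Let N := N'.+1.
Notation grid := {ffun 'I_n -> 'I_N}.
Implicit Types (Phi G : ('I_n -> R) -> R) (s : grid).

Definition theta s : 'I_n -> R := fun i => grid_angle N (s i)%:Z.

Definition mean Phi : R := (N%:R ^+ n)^-1 * \sum_(s : grid) Phi (theta s).

Definition periodic2pi Phi : Prop := forall (t : 'I_n -> R) (p : 'I_n -> int),
  Phi (fun i => t i + (p i)%:~R * (pi *+ 2)) = Phi t.

Definition flip (ep : {ffun 'I_n -> bool}) (t : 'I_n -> R) : 'I_n -> R :=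
  fun i => if ep i then - t i else t i.

Lemma grid_angleE (p : int) : exists q : int,
  grid_angle N p = grid_angle N (p %% N)%Z + q%:~R * (pi *+ 2) :> R.
Proof.
exists (p %/ N)%Z; rewrite {1}(divz_eq p N) grid_angleD addrC; congr (_ + _).
by rewrite /grid_angle rmorphM /= mulrAC mulfK // pnatr_eq0.
Qed.

Lemma mean_reindex Phi (h : grid -> grid) (f : grid -> 'I_n -> int) :
  periodic2pi Phi -> injective h -> (forall s i, (h s i : int) = (f s i %% N)%Z) ->
  mean Phi = (N%:R ^+ n)^-1 * \sum_(s : grid) Phi (fun i => grid_angle N (f s i)).
Proof.
move=> hP hi hf; rewrite /mean (reindex_inj hi) /=; congr (_ * _).
apply: eq_bigr => s _.
have [q hq] := choice (fun i => grid_angleE (f s i)).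
rewrite -[LHS](hP _ q); congr Phi; apply/funext => i.
by rewrite hq /theta hf.
Qed.

Lemma mean_shift Phi (k : 'I_n -> bool) (t : 'I_N) : periodic2pi Phi ->
  mean Phi = mean (fun a => Phi (fun i => a i + (k i)%:R * grid_angle N t%:Z)).
Proof.
move=> hP.
pose h s : grid := s + [ffun i => if k i then t else 0].
rewrite (@mean_reindex Phi h (fun s i => (s i)%:Z + (k i)%:Z * t%:Z)) //.
- rewrite /mean; congr (_ * _); apply: eq_bigr => s _; congr Phi.
  apply/funext => i; rewrite grid_angleD; congr (_ + _).
  by rewrite /grid_angle rmorphM /= -!mulrA.
- exact: addIr.
- move=> s i; rewrite !ffunE /=; case: (k i) => /=.
    by rewrite mul1r -PoszD modz_nat.
  by rewrite mul0r addn0 addr0 modz_nat.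
Qed.

Lemma mean_flip Phi ep : periodic2pi Phi -> mean Phi = mean (fun a => Phi (flip ep a)).
Proof.
move=> hP.
pose h s : grid := [ffun i => if ep i then - s i else s i].
rewrite (@mean_reindex Phi h (fun s i => if ep i then - (s i)%:Z else (s i)%:Z)) //.
- rewrite /mean; congr (_ * _); apply: eq_bigr => s _; congr Phi.
  apply/funext => i; rewrite /flip /theta; case: (ep i) => //.
  by rewrite /grid_angle rmorphN /= !mulNr.
- move=> s s' /ffunP hs; apply/ffunP => i; have := hs i; rewrite !ffunE.
  by case: (ep i) => // /oppr_inj.
- move=> s i; rewrite !ffunE; case: (ep i) => /=; last first.
    by rewrite modz_small // ltz_nat ltn_ord.
  have <- : ((N - s i)%N%:Z %% N = - (s i)%:Z %% N)%Z.
    by rewrite -subzn ?(ltnW (ltn_ord _)) // modzDl.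
  by rewrite modz_nat.
Qed.

Lemma mean_odd Phi ep : periodic2pi Phi -> (forall a, Phi (flip ep a) = - Phi a) ->
  mean Phi = 0.
Proof.
move=> hP ho; have := mean_flip ep hP; rewrite [in X in _ = X]/mean.
under eq_bigr do rewrite ho.
by rewrite sumrN mulrN -/(mean Phi) => h; lra.
Qed.

Definition trg (b : bool) (t : R) : R := if b then sin t else cos t.

Lemma trg_le1 b t : `|trg b t| <= 1.
Proof. by case: b; rewrite /trg ?sin_max ?cos_max. Qed.

Lemma trg_period b (m : nat) t (p : int) :
  trg b (m%:R * (t + p%:~R * (pi *+ 2))) = trg b (m%:R * t).
Proof.
have h : expi (m%:R * (t + p%:~R * (pi *+ 2))) = expi (m%:R * t) :> R[i].
  rewrite mulrDr expiD mulrA -[m%:R]/(m%:Z%:~R) -rmorphM /=.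
  by rewrite expi_2pi_int mulr1.
by move: h => [hc hs]; case: b; rewrite /trg ?hc ?hs.
Qed.

Lemma trg_flip b (m : nat) (e : bool) t :
  trg b (m%:R * (if e then - t else t)) = (-1) ^+ (b && e) * trg b (m%:R * t).
Proof.
by case: e; rewrite ?andbF ?mul1r ?andbT //; case: b; rewrite /trg mulrN ?sinN ?cosN ?mulN1r ?mul1r.
Qed.

Variable o : 'I_n -> bool.

Definition coef G (m : grid) : R :=
  mean (fun a => G a * \prod_i trg (o i) ((m i)%:R * a i)).

(** Cosines do not distinguish a grid point from its reflection, and sines only
    up to the sign. *)
Lemma trg_orth b (s s' : 'I_N) :
  \sum_(m < N) trg b (m%:R * grid_angle N s%:Z) * trg b (m%:R * grid_angle N s'%:Z)
  = N%:R * \sum_(e : bool) 2^-1 * (-1) ^+ (b && e) * (s == if e then - s' else s')%:R.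
Proof.
have eqD (x y : 'I_N) : (N %| x%:Z - y%:Z)%Z = (x == y).
  apply/idP/eqP => [|->]; last by rewrite subrr dvdz0.
  rewrite dvdzE /= => /dvdnP [[|q] hq].
    by apply/val_inj; move: hq => /eqP; rewrite mul0n absz_eq0 subr_eq0 => /eqP [].
  by have := ltn_ord x; have := ltn_ord y; rewrite mulSn in hq; rewrite -/N; lia.
have eqS (x y : 'I_N) : (N %| x%:Z + y%:Z)%Z = (x == - y).
  have xN := ltn_ord x; have yN := ltn_ord y.
  rewrite -PoszD dvdzE /=; apply/idP/eqP => [|->] /=; last first.
    by rewrite /dvdn modnDml subnK ?modnn // ltnW.
  move=> /dvdnP [q hq]; apply/val_inj => /=.
  have [y0|y0] := posnP y.
    rewrite y0 subn0 modnn; rewrite y0 addn0 in hq.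
    by case: q hq => [|q] // hq; move: xN; rewrite hq mulSn; lia.
  rewrite modn_small ?ltn_subrL ?y0 //.
  exact: eq_compl_mod hq.
rewrite big_bool /= andbT andbF mulr1 -(eqD s s') -(eqS s s').
have st (m : 'I_N) (x : 'I_N) : m%:R * grid_angle N x%:Z = grid_angle N (x%:Z * m%:Z) :> R.
  by rewrite /grid_angle rmorphM /=; ring.
have hcS : \sum_(m < N) cos (grid_angle N ((s%:Z + s'%:Z) * m%:Z)) = (if (N %| s%:Z + s'%:Z)%Z then N%:R else 0) :> R.
  exact: sum_cos_grid.
have hcD : \sum_(m < N) cos (grid_angle N ((s%:Z - s'%:Z) * m%:Z)) = (if (N %| s%:Z - s'%:Z)%Z then N%:R else 0) :> R.
  exact: sum_cos_grid.
have -> : \sum_(m < N) trg b (m%:R * grid_angle N s%:Z) * trg b (m%:R * grid_angle N s'%:Z)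
  = 2^-1 * (\sum_(m < N) cos (grid_angle N ((s%:Z - s'%:Z) * m%:Z))
    + (-1) ^+ b * \sum_(m < N) cos (grid_angle N ((s%:Z + s'%:Z) * m%:Z))) :> R.
  rewrite mulr_sumr -big_split mulr_sumr; apply: eq_bigr => m _ /=.
  rewrite !st !mulrDl mulNr !grid_angleD.
  have -> : grid_angle N (- (s'%:Z * m%:Z)) = - grid_angle N (s'%:Z * m%:Z) :> R.
    by rewrite /grid_angle rmorphN /= !mulNr.
  by rewrite cosB cosD; case: (b); rewrite /trg ?expr1 ?expr0; field.
by rewrite hcS hcD; case: (b); case: ifP => _; case: ifP => _;
  rewrite ?expr1 ?expr0 ?mulr1 ?mulr0; field.
Qed.

Lemma periodic_grid Phi s (f : 'I_n -> int) : periodic2pi Phi ->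
  (forall i, (s i : int) = (f i %% N)%Z) ->
  Phi (theta s) = Phi (fun i => grid_angle N (f i)).
Proof.
move=> hP hf; have [q hq] := choice (fun i => grid_angleE (f i)).
by rewrite -[LHS](hP _ q); congr Phi; apply/funext => i; rewrite hq /theta hf.
Qed.

Lemma periodic_flip Phi s (ep : {ffun 'I_n -> bool}) : periodic2pi Phi ->
  Phi (theta [ffun i => if ep i then - s i else s i]) = Phi (flip ep (theta s)).
Proof.
move=> hP; rewrite (@periodic_grid Phi _ (fun i => if ep i then - (s i)%:Z else (s i)%:Z)) //.
  congr Phi; apply/funext => i; rewrite /flip /theta; case: (ep i) => //.
  by rewrite /grid_angle rmorphN /= !mulNr.
move=> i; rewrite !ffunE; case: (ep i) => /=; last first.
  by rewrite modz_small // ltz_nat ltn_ord.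
have <- : ((N - s i)%N%:Z %% N = - (s i)%:Z %% N)%Z.
  by rewrite -subzn ?(ltnW (ltn_ord _)) // modzDl.
by rewrite modz_nat.
Qed.

Definition parity G : Prop := forall (ep : {ffun 'I_n -> bool}) t,
  G (flip ep t) = (\prod_i (-1) ^+ (o i && ep i)) * G t.

(** Discrete Fourier inversion; by parity the [2 ^ n] reflections of the grid point
    contribute equally. *)
Lemma inversion G s' : periodic2pi G -> parity G ->
  G (theta s') = \sum_(m : grid) coef G m * \prod_i trg (o i) ((m i)%:R * theta s' i).
Proof.
move=> hP hpar; rewrite /coef /mean.
have N0 : N%:R != 0 :> R by rewrite pnatr_eq0.
have -> : \sum_(m : grid) ((N%:R ^+ n)^-1 * \sum_(s : grid)
     (G (theta s) * \prod_i trg (o i) ((m i)%:R * theta s i)))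
     * \prod_i trg (o i) ((m i)%:R * theta s' i)
  = \sum_(s : grid) G (theta s) * \sum_(ep : {ffun 'I_n -> bool})
      (\prod_i (2^-1 * (-1) ^+ (o i && ep i))) *
      (s == [ffun i => if ep i then - s' i else s' i])%:R.
  under eq_bigr do rewrite -mulrA mulr_suml mulr_sumr.
  rewrite exchange_big /=; apply: eq_bigr => s _.
  under eq_bigr do rewrite -mulrA mulrCA -big_split /=.
  rewrite -mulr_sumr -mulr_sumr; congr (_ * _).
  rewrite -(bigA_distr_bigA (fun i (k : 'I_N) =>
    trg (o i) (k%:R * theta s i) * trg (o i) (k%:R * theta s' i))) /=.
  under eq_bigr do rewrite trg_orth.
  rewrite big_split /= prodr_const card_ord mulKf ?expf_neq0 //.
  rewrite bigA_distr_bigA; apply: eq_bigr => ep _.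
  rewrite big_split /=; congr (_ * _).
  case: eqP => [->|ne].
    by rewrite big1 // => i _; rewrite ffunE eqxx.
  have /existsP[i hi] : [exists i, s i != if ep i then - s' i else s' i].
    rewrite -negb_forall; apply/forallP => h; apply: ne; apply/ffunP => i.
    by rewrite ffunE; apply/eqP.
  by rewrite (bigD1 i) //= (negPf hi) mul0r.
under eq_bigr do rewrite mulr_sumr.
rewrite exchange_big /=.
transitivity (\sum_(ep : {ffun 'I_n -> bool}) \prod_(i < n) (2^-1 : R) * G (theta s')); last first.
  apply: eq_bigr => ep _; rewrite (bigD1 [ffun i => if ep i then - s' i else s' i]) //=.
  rewrite eqxx mulr1 [X in _ + X]big1 ?addr0; last by move=> s hs; rewrite (negPf hs) !mulr0.
  rewrite periodic_flip // hpar mulrAC; congr (_ * _).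
  rewrite -big_split /=; apply: eq_bigr => i _.
  by rewrite mulrCA -signr_addb addbb mulr1.
rewrite -mulr_suml -(bigA_distr_bigA (fun (i : 'I_n) (e : bool) => 2^-1 : R)) /=.
rewrite big1 ?mul1r // => i _; rewrite big_bool /=; by field.
Qed.

End GridMean.

Section Limit.
Context {R : realType} {n : nat}.
Variables (o : 'I_n -> bool) (G : ('I_n -> R) -> R) (C q : R).
Hypotheses (hP : periodic2pi G) (hpar : parity o G) (C0 : 0 <= C) (q0 : 0 <= q) (q1 : q < 1).
Hypothesis hcont : forall t e, 0 < e -> exists2 de, 0 < de &
  forall t', (forall i, `|t' i - t i| <= de) -> `|G t' - G t| <= e.
Hypothesis hbound : forall N' (m : {ffun 'I_n -> 'I_N'.+1}),
  `|coef o G m| <= C * \prod_i q ^+ minn (m i) (N'.+1 - m i).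

Let K : choiceType := ({ffun 'I_n -> nat} * {ffun 'I_n -> bool})%type.

(** On the grid the frequencies [k] and [N - k] coincide up to a sign. The code
    of a frequency consists of the smaller of the two and of which one it was. *)
Let enc N' (m : {ffun 'I_n -> 'I_N'.+1}) : K :=
  ([ffun i => minn (m i) (N'.+1 - m i)], [ffun i => (N'.+1 < 2 * m i)%N]).

Let enc_inj N' : injective (@enc N').
Proof.
move=> m m' [/ffunP h1 /ffunP h2]; apply/ffunP => i; apply/val_inj.
have := h1 i; have := h2 i; rewrite !ffunE; have := ltn_ord (m i); have := ltn_ord (m' i).
move=> /= a b c; case: (ltnP N'.+1 (2 * m i)) c => c /esym; lia.
Qed.

Let sgn (i : K) : R := \prod_j (-1) ^+ (o j && i.2 j).
Let psi (i : K) (t : 'I_n -> R) : R := \prod_j trg (o j) ((i.1 j)%:R * t j).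
Let bnd (i : K) : R := C * \prod_j q ^+ i.1 j.

(** The discrete coefficients for all the grids, on one index set. *)
Let kap N' (i : K) : R :=
  \sum_(m : {ffun 'I_n -> 'I_N'.+1}) if enc m == i then coef o G m * sgn i else 0.

Let psi_le1 i t : `|psi i t| <= 1.
Proof.
rewrite /psi normr_prod -[leRHS](prodr_const_nat 1 0 0) ?big_geq //.
by apply: prodr_ile1 => j _; rewrite normr_ge0 trg_le1.
Qed.

Let bnd_ge0 i : 0 <= bnd i.
Proof. by rewrite /bnd mulr_ge0 // prodr_ge0 // => j _; rewrite exprn_ge0. Qed.

Let kap_bound N' i : `|kap N' i| <= bnd i.
Proof.
rewrite /kap; case: (pickP (fun m => @enc N' m == i)) => [m /eqP mi|no]; last first.
  by rewrite big1 ?normr0 // => m _; rewrite no.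
rewrite (bigD1 m) //= mi eqxx big1 ?addr0; last first.
  move=> m' mm'; case: eqP => // m'i; case/eqP: mm'.
  by apply: (@enc_inj N'); rewrite m'i.
rewrite normrM /sgn normr_prod big1 ?mulr1; last by move=> j _; rewrite normr_sign.
apply: le_trans (hbound m) _; rewrite /bnd -mi.
by under [in leRHS]eq_bigr do rewrite ffunE.
Qed.

Let bnd_sum : bsum bnd (2 ^+ n * (C * (1 - q)^-1 ^+ n)).
Proof.
have hq r : \sum_(k < r) q ^+ k <= (1 - q)^-1.
  have h : (1 - q) * \sum_(k < r) q ^+ k = 1 - q ^+ r.
    by rewrite -[1 - q]opprB mulNr -subrX1 opprB.
  have q10 : 0 < 1 - q by rewrite subr_gt0.
  by rewrite -[leRHS]mul1r ler_pdivlMr // mulrC h lerBlDr lerDl exprn_ge0.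
have h1 := bsumZ C0 (bsum_ffun (n := n) (fun k => exprn_ge0 k q0) hq).
have h2 : bsum (fun e : {ffun 'I_n -> bool} => 1 : R) (2 ^+ n).
  apply: bsum_finType => //.
  by rewrite sumr_const card_ffun card_bool card_ord -natrX.
have b1 (r : {ffun 'I_n -> nat}) : 0 <= C * \prod_(i < n) q ^+ r i.
  by rewrite mulr_ge0 // prodr_ge0 // => j _; rewrite exprn_ge0.
have := bsum_prod b1 (fun _ => ler01) h1 h2.
by rewrite mulrC; apply: le_bsum => -[r e] /=; rewrite mulr1.
Qed.

Let trg_fold N' b (k s : 'I_N'.+1) :
  trg b (k%:R * grid_angle N'.+1 s%:Z) = (-1) ^+ (b && (N'.+1 < 2 * k)%N)
    * trg b ((minn k (N'.+1 - k))%:R * grid_angle N'.+1 s%:Z) :> R.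
Proof.
have kN := ltn_ord k.
case: ltnP => h; last first.
  rewrite andbF mul1r; congr (trg b (_%:R * _)); lia.
have -> : minn k (N'.+1 - k) = (N'.+1 - k)%N by lia.
rewrite natrB ?(ltnW kN) // mulrBl andbT.
have e1 : N'.+1%:R * grid_angle N'.+1 s%:Z = (s%:Z)%:~R * (pi *+ 2) :> R.
  by rewrite /grid_angle mulrC divfK // pnatr_eq0.
rewrite e1; set x := k%:R * _.
have h2 : expi ((s%:Z)%:~R * (pi *+ 2) - x) = expi (- x) :> R[i].
  by rewrite expiD expi_2pi_int mul1r.
move: h2 => [hc hs]; case: b; rewrite /trg ?hc ?hs ?sinN ?cosN.
  by rewrite expr1 mulrN mulN1r opprK.
by rewrite expr0 mul1r.
Qed.

Let kap_hsum N' (s : {ffun 'I_n -> 'I_N'.+1}) :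
  hsum (fun i => (kap N' i * psi i (theta s))%:C%C) (G (theta s))%:C%C.
Proof.
rewrite (inversion s hP hpar) rmorph_sum.
have h1 (m : {ffun 'I_n -> 'I_N'.+1}) :
    hsum (fun i => (if enc m == i then coef o G m * sgn i * psi i (theta s) else 0)%:C%C)
      (coef o G m * \prod_i trg (o i) ((m i)%:R * theta s i))%:C%C.
  have := @hsum_fin R _ (fun i => (if enc m == i then coef o G m * sgn i * psi i (theta s) else 0)%:C%C) [fset enc m]%fset.
  rewrite big_seq_fset1 eqxx.
  have -> : coef o G m * sgn (enc m) * psi (enc m) (theta s)
     = coef o G m * \prod_i trg (o i) ((m i)%:R * theta s i).
    rewrite -mulrA; congr (_ * _); rewrite /sgn /psi -big_split /=.
    by apply: eq_bigr => i _; rewrite !ffunE -trg_fold.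
  by apply => i; rewrite in_fset1 eq_sym => /negPf ->.
apply: eq_hsum (hsum_finsum (index_enum {ffun 'I_n -> 'I_N'.+1}) h1) => i.
rewrite -rmorph_sum /kap mulr_suml; congr (_%:C%C); apply: eq_bigr => m _.
by case: ifP => _; rewrite ?mul0r.
Qed.

Lemma image_ultra (T U : Type) (f : T -> U) (F : set_system T) :
  UltraFilter F -> UltraFilter (f @ F).
Proof.
move=> FU; split; first exact: fmap_proper_filter.
move=> H HP sub; apply/seteqP; split=> A HA; last exact: sub.
have [//|hc] := in_ultra_setVsetC (f @^-1` A) FU.
have : H (A `&` ~` A) by apply: filterI => //; apply: sub.
by rewrite setICr => /filter_not_empty.
Qed.

Let psi_cont i t t' : `|psi i t' - psi i t| <= \sum_j (i.1 j)%:R * `|t' j - t j|.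
Proof.
rewrite /psi.
suff [] : let x := \prod_j trg (o j) ((i.1 j)%:R * t' j) in
  let y := \prod_j trg (o j) ((i.1 j)%:R * t j) in
  `|y| <= 1 /\ `|x - y| <= \sum_j (i.1 j)%:R * `|t' j - t j| by [].
apply: (big_rec3 (fun x y z => `|y| <= 1 /\ `|x - y| <= z)) => [|j x y z _ [hy hxy]].
  by rewrite normr1 subrr normr0.
split; first by rewrite normrM mulr_ile1 ?trg_le1.
set a := trg _ _; set b := trg _ _.
have -> : a * x - b * y = (a - b) * y + a * (x - y) by ring.
apply: le_trans (ler_normD _ _) _; rewrite !normrM; apply: lerD.
  apply: le_trans (ler_piMr (normr_ge0 _) hy) _.
  rewrite -[(i.1 j)%:R]ger0_norm // -normrM mulrBr /a /b.
  by case: (o j); rewrite /trg; [apply: sin_lip|apply: cos_lip].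
apply: le_trans hxy; apply: ler_piMl => //; exact: trg_le1.
Qed.

Let inv_near (a c : R) : 0 < a -> 0 <= c ->
  \forall N' \near \oo, c / N'.+1%:R <= a.
Proof.
move=> a0 c0; exists (Num.truncn (c / a)) => // N' /= hN.
rewrite ler_pdivrMr // mulrC -ler_pdivrMr //.
apply: ltW; apply: lt_le_trans (truncnS_gt _) _.
by rewrite ler_nat ltnS.
Qed.

(** The coefficients converge as the grid shrinks along an ultrafilter, because
    they are bounded, and the sums converge with them because they are dominated.
    This replaces the integrals that define the coefficients. *)
Lemma trig_expansion : exists ka : K -> R,
  (forall i, `|ka i| <= bnd i) /\
  forall t : 'I_n -> R, (forall i, 0 <= t i < pi *+ 2) ->
    hsum (fun i => (ka i * psi i t)%:C%C) (G t)%:C%C.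
Proof.
have [U [UU sU]] := ultraFilterLemma (_ : ProperFilter (\oo : set_system nat)).
have kex i : exists k : R, (fun N' => kap N' i) @ U --> k /\ `|k| <= bnd i.
  have := @segment_compact R (- bnd i) (bnd i); rewrite compact_ultra.
  case/(_ ((fun N' => kap N' i) @ U) (image_ultra _ UU)) => [|k [/= hk1 hk2]].
    change (U [set N' | `[- bnd i, bnd i]%classic (kap N' i)]).
    by apply: filterE => N' /=; rewrite in_itv /=; have := kap_bound N' i; rewrite ler_norml.
  by exists k; split=> //; move: hk1; rewrite in_itv /= ler_norml.
have [ka hka] := choice kex.
exists ka; split=> [i|t ht]; first exact: (hka i).2.
(* the grid point just below t *)
pose sN N' : {ffun 'I_n -> 'I_N'.+1} :=
  [ffun i => inord (Num.truncn (N'.+1%:R * t i / (pi *+ 2)))].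
have pi20 : 0 < pi *+ 2 :> R by rewrite pmulrn_lgt0 // pi_gt0.
have hsN N' i : `|theta (sN N') i - t i| <= (pi *+ 2) / N'.+1%:R.
  have NR : 0 < N'.+1%:R :> R by [].
  have /andP[t0 tpi] := ht i.
  set x := N'.+1%:R * t i / (pi *+ 2).
  have x0 : 0 <= x by rewrite divr_ge0 ?mulr_ge0 // ltW.
  have /andP[h1 h2] := truncn_itv x0.
  have xN : x < N'.+1%:R by rewrite ltr_pdivrMr // ltr_pM2l.
  have tN : (Num.truncn x < N'.+1)%N by rewrite -(ltr_nat R); apply: le_lt_trans xN.
  rewrite /theta /sN ffunE -/x inordK //.
  have -> : t i = x * (pi *+ 2) / N'.+1%:R.
    by rewrite /x divfK ?gt_eqF // mulrAC divff ?mul1r // gt_eqF.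
  rewrite /grid_angle -mulrA -[x * _ / _]mulrA -mulrBl normrM.
  rewrite [X in _ * X]ger0_norm ?divr_ge0 ?(ltW pi20) //.
  rewrite ler_piMl ?divr_ge0 ?(ltW pi20) // distrC ger0_norm ?subr_ge0 //.
  by rewrite lerBlDl; apply: ltW; rewrite -natr1 in h2.
move=> e e0.
have e4 : 0 < e / 4 by rewrite divr_gt0.
have e8 : 0 < e / 8 by rewrite divr_gt0.
have [J0 hJ0] := bsum_tail bnd_ge0 bnd_sum e4.
exists J0 => J sJ; rewrite -rmorph_sum -rmorphB ncR.
have [de de0 hde] := hcont t e4.
pose Lp := \sum_(i <- J) bnd i * \sum_j (i.1 j)%:R.
have Lp0 : 0 <= Lp.
  by apply: sumr_ge0 => i _; rewrite mulr_ge0 // sumr_ge0.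
have near1 (s : seq K) (ep : R) : 0 < ep ->
    \forall N' \near U, \sum_(i <- s) `|ka i - kap N' i| <= ep.
  elim: s ep => [|i s IH] ep ep0.
    by apply: filterE => N'; rewrite big_nil ltW.
  have ep2 : 0 < ep / 2 by rewrite divr_gt0.
  have /cvgrPdist_le /(_ _ ep2) hi := (hka i).1.
  apply: filterS2 hi (IH _ ep2) => N' h1 h2.
  by rewrite big_cons [ep]splitr lerD.
have n1 := near1 J _ e8.
have n2 : \forall N' \near U, pi *+ 2 / N'.+1%:R <= de.
  by apply: sU; apply: inv_near => //; apply: ltW.
have n3 : \forall N' \near U, Lp * (pi *+ 2) / N'.+1%:R <= e / 8.
  by apply: sU; apply: inv_near => //; rewrite mulr_ge0 // ltW.
have [N' [[h1 h2] h3]] := filter_ex (filterI (filterI n1 n2) n3).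
pose tN : 'I_n -> R := theta (sN N').
have A3 : `|G tN - G t| <= e / 4 by apply: hde => i; apply: le_trans h2; apply: hsN.
have A2 : `|G tN - \sum_(i <- J) kap N' i * psi i tN| <= e / 4.
  have hJ : hsum (fun i => (if i \in J then kap N' i * psi i tN else 0)%:C%C)
      (\sum_(i <- J) kap N' i * psi i tN)%:C%C.
    have := @hsum_fin R _ (fun i => (if i \in J then kap N' i * psi i tN else 0)%:C%C) J.
    rewrite rmorph_sum (eq_big_seq (fun i => (kap N' i * psi i tN)%:C%C)) /=.
      by apply => i /negPf ->.
    by move=> i ->.
  rewrite -ncR rmorphB; apply: (hsum_norm (hsumB (kap_hsum (sN N')) hJ)) => P.
  apply: le_trans (ltW (hJ0 P)); rewrite [leRHS]big_mkcond; apply: ler_sum => i _.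
  rewrite -rmorphB ncR; case: (boolP (i \in J)) => [iJ|iJ].
    by rewrite subrr normr0; case: ifP.
  rewrite subr0 ifT; last by apply: contra iJ; apply: (fsubsetP sJ).
  rewrite normrM; apply: le_trans (kap_bound N' i).
  by apply: ler_piMr => //; apply: psi_le1.
have A1 : `|\sum_(i <- J) ka i * psi i t - \sum_(i <- J) kap N' i * psi i tN| <= e / 4.
  rewrite -sumrB; apply: le_trans (ler_norm_sum _ _ _) _.
  apply: (@le_trans _ _ (\sum_(i <- J) (`|ka i - kap N' i| +
      bnd i * (\sum_j (i.1 j)%:R) * (pi *+ 2 / N'.+1%:R)))).
    apply: ler_sum => i _.
    have -> : ka i * psi i t - kap N' i * psi i tN
      = (ka i - kap N' i) * psi i t - kap N' i * (psi i tN - psi i t) by ring.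
    apply: le_trans (ler_normB _ _) _; rewrite !normrM; apply: lerD.
      by apply: ler_piMr => //; apply: psi_le1.
    rewrite -mulrA; apply: ler_pM; [by []|by []|exact: kap_bound|].
    apply: le_trans (psi_cont _ _ _) _; rewrite mulr_suml; apply: ler_sum => j _.
    by rewrite ler_wpM2l //; apply: hsN.
  rewrite big_split /= -mulr_suml -/Lp mulrA.
  by apply: le_trans (lerD h1 h3) _; lra.
have -> : \sum_(i <- J) ka i * psi i t - G t
  = (\sum_(i <- J) ka i * psi i t - \sum_(i <- J) kap N' i * psi i tN)
    - (G tN - \sum_(i <- J) kap N' i * psi i tN) + (G tN - G t) by ring.
apply: le_lt_trans (ler_normD _ _) _.
apply: le_lt_trans (lerD (ler_normB _ _) (lexx _)) _.
apply: le_lt_trans (lerD (lerD A1 A2) A3) _.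
rewrite (_ : e / 4 + e / 4 + e / 4 = e * (3 / 4)); last by field.
by rewrite gtr_pMr // ltr_pdivrMr // mul1r ltr_nat.
Qed.

End Limit.

Section MeanFacts.
Context {R : realType} {n : nat} (N' : nat).
Implicit Types (Phi : ('I_n -> R) -> R).

Lemma mean_norm Phi B : (forall t, `|Phi t| <= B) -> `|mean N' Phi| <= B.
Proof.
move=> hB; rewrite /mean normrM ger0_norm; last by rewrite invr_ge0 exprn_ge0.
rewrite ler_pdivrMl ?exprn_gt0 //.
apply: le_trans (ler_norm_sum _ _ _) _.
apply: le_trans (ler_sum (G := fun=> B) _ _) _; first by move=> s _; apply: hB.
by rewrite sumr_const card_ffun !card_ord -natrX mulr_natl.
Qed.

Lemma meanD Phi1 Phi2 : mean N' (fun t => Phi1 t + Phi2 t) = mean N' Phi1 + mean N' Phi2.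
Proof. by rewrite /mean big_split mulrDr. Qed.

Lemma meanZ k Phi : mean N' (fun t => k * Phi t) = k * mean N' Phi.
Proof. by rewrite /mean -mulr_sumr mulrCA. Qed.

Lemma mean_sum (I : finType) (f : I -> ('I_n -> R) -> R) :
  mean N' (fun t => \sum_i f i t) = \sum_i mean N' (f i).
Proof. by rewrite /mean exchange_big mulr_sumr. Qed.

End MeanFacts.

(** * Chebyshev expansions of the nonlinearity *)
Section Coefficients.
Context {R : realType} {d n : nat}.
Variables (A : 'rV[R]_n -> 'M[R]_(d, n) -> 'rV[R]_n) (C0 : R) (F : R -> R).
Hypothesis hF : forall y : R, 0 <= y -> analytic_at F y.
Hypothesis hA : Gen_bound A C0 F.
Variables (j : 'I_d) (l0 : 'I_n) (S : R).
Hypothesis S0 : 0 < S.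

Definition zeroth_order (l : 'I_n) (c : 'rV[R]_n) : R := A c 0 0 l.
Definition gradient_coef (l : 'I_n) (k : 'I_d) (m : 'I_n) (c : 'rV[R]_n) : R :=
  A c (delta_mx k m) 0 l - A c 0 0 l.

Definition cos_point (t : 'I_n -> R) : 'rV[R]_n := \row_i (S * cos (t i)).
(** Testing functions with components [S cos (t_i + k_i x_j)], where all [k_i] are
    0 or 1. The value of [A (u, grad u)] at a point of the [j]-th axis is
    [line_value], by affinity a combination of [even_part] and [odd_part], whose
    parities in [t] differ. *)
Definition even_part (t : 'I_n -> R) : R := zeroth_order l0 (cos_point t).
Definition odd_part (m : 'I_n) (t : 'I_n -> R) : R := sin (t m) * gradient_coef l0 j m (cos_point t).
Definition line_value (k : 'I_n -> bool) (t : 'I_n -> R) : R :=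
  even_part t - S * \sum_i (k i)%:R * odd_part i t.

Let uu (k : 'I_n -> bool) (t : 'I_n -> R) : 'rV[R]_d -> 'rV[R]_n :=
  trigp (fun i => axis_freq j *+ k i) t (fun i : 'I_n => S *: delta_mx 0 i).

Let uuE k t x : uu k t x = cos_point (fun i => t i + (k i)%:R * x 0 j).
Proof.
apply/rowP => i; rewrite /uu /trigp summxE (bigD1 i) //= big1 ?addr0.
  by rewrite !mxE !eqxx mulr1 freq_dot_axis mulrC addrC.
by move=> l li; rewrite !mxE eqxx /= eq_sym (negPf li) !mulr0.
Qed.

Let line_valueE k t x : apply_grad A (uu k t) x 0 l0 = line_value k (fun i => t i + (k i)%:R * x 0 j).
Proof.
rewrite /apply_grad uuE (A_affine hF hA j) /line_value /even_part /zeroth_order; congr (_ + _).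
rewrite (bigD1 j) //= [X in _ + X]big1 ?addr0 => [|i ij].
  rewrite mulr_sumr -sumrN; apply: eq_bigr => m _.
  rewrite /uu jacobian_trigp mxE (bigD1 m) //= big1 ?addr0.
    rewrite !mxE !eqxx axis_freqE eqxx freq_dot_axis addrC /odd_part /gradient_coef /=.
    by rewrite -pmulrn; ring.
  by move=> i im; rewrite !mxE eqxx /= eq_sym (negPf im) !mulr0.
apply: big1 => m _; rewrite /uu jacobian_trigp mxE big1 ?mul0r // => l _.
by rewrite axis_freqE (negPf ij) mulr0 mul0r.
Qed.

Variable z : R.
Hypothesis z0 : 0 <= z.

(** The amplitudes and the frequencies are bounded whatever the phases [t] and the
    directions [k] are, so that one constant serves for all of them. *)
Lemma line_value_fseries : exists2 C, 0 <= C & forall k t, exists c : 'rV[int]_d -> R[i],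
  fseries (fun x => line_value k (fun i => t i + (k i)%:R * x 0 j)) c /\
  bsum (fun al => nc (c al) * expR (z * freq_norm al)) C.
Proof.
pose K : R := n%:R * (S * expR z).
have [M [M0 hM]] := analytic_bounded C0 K hF.
have K0 : 0 <= K by rewrite /K; nonneg; apply: ltW.
exists (M * (1 + K)); first by rewrite mulr_ge0 // addr_ge0.
move=> k t.
have amp i : ampl (fun i : 'I_n => S *: (delta_mx 0 i : 'rV[R]_n)) i = S.
  rewrite /ampl (bigD1 i) //= big1 ?addr0.
    by rewrite !mxE !eqxx mulr1 gtr0_norm.
  by move=> l li; rewrite !mxE eqxx (negPf li) mulr0 normr0.
have ez1 : 1 <= expR z by apply: le_trans (expR_ge1Dx _); rewrite lerDl.
have sumK (f : R -> R) : (forall b : bool, f b%:R <= expR z) ->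
   \sum_i ampl (fun i : 'I_n => S *: (delta_mx 0 i : 'rV[R]_n)) i * f (freq_norm (axis_freq j *+ k i)) <= K.
  move=> hf; apply: le_trans (ler_sum (G := fun=> S * expR z) _ _) _.
    by move=> i _; rewrite amp freq_norm_axis ler_wpM2l // ltW.
  by rewrite sumr_const card_ord /K mulr_natl.
have h0 := sumK (fun r => expR (z * r)).
have h1 := sumK (fun r => r * expR (z * r)).
have [||c [hc hb]] := trigp_bound hA t z0 M0 hM (h0 _) (h1 _) l0.
- by case; rewrite ?mulr1 ?mulr0 ?expR0.
- by case; rewrite ?mulr1 ?mul1r ?mul0r ?expR_ge0.
exists c; split=> //.
rewrite (_ : (fun x => _) = (fun x => apply_grad A (uu k t) x 0 l0)) //.
by apply/funext => x; rewrite line_valueE.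
Qed.

(** The average over a grid on the [j]-th axis retains the frequencies that are
    opposite to [M] modulo [N], which are at least [D] long. *)
Lemma line_avg (C : R) k t : 0 <= C -> (exists c : 'rV[int]_d -> R[i],
    fseries (fun x => line_value k (fun i => t i + (k i)%:R * x 0 j)) c /\
    bsum (fun al => nc (c al) * expR (z * freq_norm al)) C) ->
  forall (N' : nat) (M : int) (phi : R) (D : nat),
  (forall be : int, (N'.+1 %| be + M)%Z -> (D <= `|be|)%N) ->
  `|N'.+1%:R^-1 * \sum_(s < N'.+1) line_value k (fun i => t i + (k i)%:R * grid_angle N'.+1 s%:Z)
      * cos (M%:~R * grid_angle N'.+1 s%:Z + phi)| <= C * expR (- (z * D%:R)).
Proof.
move=> C_ge0 [c [[_ hc] hb]] N' M phi D hD.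
pose xt (s : 'I_N'.+1) : 'rV[R]_d := grid_angle N'.+1 s%:Z *: delta_mx 0 j.
have xtj s : xt s 0 j = grid_angle N'.+1 s%:Z by rewrite !mxE !eqxx mulr1.
pose h (x : 'rV[R]_d) := line_value k (fun i => t i + (k i)%:R * x 0 j).
pose V : R[i] := expi phi * (N'.+1%:R^-1 * \sum_(s < N'.+1)
   expi (grid_angle N'.+1 (M * s%:Z)) * (h (xt s))%:C%C).
have hV : hsum (fun al => expi phi * (c al * (if (N'.+1 %| (al 0 j + M)%R)%Z then 1 else 0))) V.
  apply: hsumZ.
  have h2 := hsum_finsum (index_enum 'I_N'.+1)
     (fun s => hsumZ (expi (grid_angle N'.+1 (M * s%:Z))) (hc (xt s) : hsum _ (h (xt s))%:C%C)).
  apply: eq_hsum (hsumZ (N'.+1%:R^-1) h2) => al.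
  under eq_bigr do rewrite mulrCA.
  rewrite -mulr_sumr mulrCA; congr (_ * _).
  have -> : \sum_(s < N'.+1) expi (grid_angle N'.+1 (M * s%:Z)) * expi (freq_dot al (xt s))
    = \sum_(s < N'.+1) expi (grid_angle N'.+1 ((al 0 j + M) * s%:Z)) :> R[i].
    apply: eq_bigr => s _; rewrite -expiD mulrDl grid_angleD addrC; congr (expi (_ + _)).
    rewrite freq_dotZr /freq_dot (bigD1 j) //= big1 ?addr0; last first.
      by move=> i ij; rewrite mxE (negPf ij) andbF mulr0.
    by rewrite mxE !eqxx mulr1 /grid_angle rmorphM /=; ring.
  rewrite sum_expi_grid //; case: ifP => _; last by rewrite mulr0.
  by rewrite mulVf // pnatr_eq0.
have -> : N'.+1%:R^-1 * \sum_(s < N'.+1) line_value k (fun i => t i + (k i)%:R * grid_angle N'.+1 s%:Z)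
      * cos (M%:~R * grid_angle N'.+1 s%:Z + phi) = complex.Re V.
  rewrite /V !mulr_sumr (raddf_sum (@complex.Re R : Rcomplex R -> R)) /=.
  apply: eq_bigr => s _.
  have -> : M%:~R * grid_angle N'.+1 s%:Z = grid_angle N'.+1 (M * s%:Z) :> R.
    by rewrite /grid_angle rmorphM /=; ring.
  rewrite -(rmorph_nat (real_complex R)) -(fmorphV (real_complex R)) /h xtj cosD /=.
  move: (line_value _ _) (N'.+1%:R^-1) => a b; ring.
apply: le_trans (nc_Re _) _; apply: (hsum_norm hV).
have e0 := expR_ge0 (- (z * D%:R)).
rewrite mulrC; apply: le_bsum (bsumZ e0 hb) => al.
rewrite !ncM nc_expi mul1r mulrCA; case: ifP => [dv|_]; last first.
  by rewrite nc0 mulr0 !mulr_ge0 ?nc_ge0 ?expR_ge0.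
have -> : nc (1 : R[i]) = 1 by rewrite -[1]/(1%:C%C) ncR normr1.
rewrite ler_wpM2l ?nc_ge0 // -expRD -[leLHS]expR0 ler_expR addrC subr_ge0.
rewrite ler_wpM2l //; apply: le_trans (freq_norm_coord al j).
by rewrite -intr_norm -[leLHS]/(D%:Z%:~R) ler_int -abszE lez_nat hD.
Qed.

(** By periodicity the average over all phases may first be taken over the phases
    on the line in the direction [k]. *)
Lemma mean_line_value (C : R) k Psi (N' : nat) (D : nat) : 0 <= C ->
  (forall t, exists c : 'rV[int]_d -> R[i],
    fseries (fun x => line_value k (fun i => t i + (k i)%:R * x 0 j)) c /\
    bsum (fun al => nc (c al) * expR (z * freq_norm al)) C) ->
  periodic2pi (fun t => line_value k t * Psi t) ->
  (forall t, exists w1 w2 (M1 M2 : int) (p1 p2 : R), [/\ `|w1| + `|w2| <= 1,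
    (forall be : int, (N'.+1 %| be + M1)%Z -> (D <= `|be|)%N),
    (forall be : int, (N'.+1 %| be + M2)%Z -> (D <= `|be|)%N) &
    forall x, Psi (fun i => t i + (k i)%:R * x) =
      w1 * cos (M1%:~R * x + p1) + w2 * cos (M2%:~R * x + p2)]) ->
  `|mean N' (fun t => line_value k t * Psi t)| <= C * expR (- (z * D%:R)).
Proof.
move=> C_ge0 hC hP hPsi.
have -> : mean N' (fun t => line_value k t * Psi t) = mean N' (fun t =>
    N'.+1%:R^-1 * \sum_(s < N'.+1) line_value k (fun i => t i + (k i)%:R * grid_angle N'.+1 s%:Z)
      * Psi (fun i => t i + (k i)%:R * grid_angle N'.+1 s%:Z)).
  rewrite meanZ mean_sum (eq_bigr (fun=> mean N' (fun t => line_value k t * Psi t))).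
    by rewrite sumr_const card_ord -(mulr_natl (mean _ _)) mulKf // pnatr_eq0.
  by move=> s _; rewrite [RHS](mean_shift k s hP).
apply: mean_norm => t.
have [w1 [w2 [M1 [M2 [p1 [p2 [hw h1 h2 hPt]]]]]]] := hPsi t.
under eq_bigr do rewrite hPt mulrDr !(mulrCA (line_value _ _)).
rewrite big_split mulrDr /= -!mulr_sumr !(mulrCA _^-1).
apply: le_trans (ler_normD _ _) _; rewrite (normrM w1) (normrM w2).
have l1 := line_avg C_ge0 (hC t) p1 h1; have l2 := line_avg C_ge0 (hC t) p2 h2.
apply: le_trans (lerD (ler_wpM2l (normr_ge0 w1) l1) (ler_wpM2l (normr_ge0 w2) l2)) _.
by rewrite -mulrDl ler_piMl // mulr_ge0 ?expR_ge0.
Qed.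

Definition trig_mono {N' : nat} (o : 'I_n -> bool) (m : {ffun 'I_n -> 'I_N'.+1}) (t : 'I_n -> R) : R :=
  \prod_i trg (o i) ((m i)%:R * t i).

Lemma trg1_period b (t : R) (p : int) : trg b (t + p%:~R * (pi *+ 2)) = trg b t.
Proof. by have := trg_period b 1 t p; rewrite !mul1r. Qed.

Lemma cos_point_period t (p : 'I_n -> int) : cos_point (fun i => t i + (p i)%:~R * (pi *+ 2)) = cos_point t.
Proof. by apply/rowP => i; rewrite !mxE; congr (_ * _); apply: (trg1_period false). Qed.

Lemma even_part_period : periodic2pi even_part.
Proof. by move=> t p; rewrite /even_part cos_point_period. Qed.

Lemma odd_part_period m : periodic2pi (odd_part m).
Proof. by move=> t p; rewrite /odd_part cos_point_period; congr (_ * _); apply: (trg1_period true). Qed.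

Lemma trig_mono_period N' (o : 'I_n -> bool) (m : {ffun 'I_n -> 'I_N'.+1}) : periodic2pi (trig_mono o m).
Proof. by move=> t p; apply: eq_bigr => i _; apply: trg_period. Qed.

Lemma periodicM (f g : ('I_n -> R) -> R) : periodic2pi f -> periodic2pi g ->
  periodic2pi (fun t => f t * g t).
Proof. by move=> hf hg t p; rewrite hf hg. Qed.

Lemma line_value_period k : periodic2pi (line_value k).
Proof.
move=> t p; rewrite /line_value even_part_period; congr (_ - S * _).
by apply: eq_bigr => i _; rewrite odd_part_period.
Qed.

Lemma cos_point_flip ep t : cos_point (flip ep t) = cos_point t.
Proof. by apply/rowP => i; rewrite !mxE /flip; case: (ep i); rewrite ?cosN. Qed.

Lemma even_part_parity : parity (fun=> false) even_part.
Proof. by move=> ep t; rewrite /even_part cos_point_flip big1 ?mul1r. Qed.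

Lemma odd_part_parity m : parity (fun i => i == m) (odd_part m).
Proof.
move=> ep t; rewrite /odd_part cos_point_flip (bigD1 m) //= eqxx big1; last first.
  by move=> i /negPf ->.
by rewrite mulr1 mulrA; congr (_ * _); rewrite /flip; case: (ep m); rewrite ?sinN ?mulN1r ?mul1r.
Qed.

Lemma trig_mono_parity N' (o : 'I_n -> bool) (m : {ffun 'I_n -> 'I_N'.+1}) : parity o (trig_mono o m).
Proof.
move=> ep t; rewrite /trig_mono -big_split /=; apply: eq_bigr => i _.
by rewrite /flip trg_flip.
Qed.

Let ep1 (i : 'I_n) : {ffun 'I_n -> bool} := [ffun i' => i' == i].

Let prod_ep1 (o : 'I_n -> bool) i : \prod_i' (-1) ^+ (o i' && ep1 i i') = (-1) ^+ o i :> R.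
Proof.
rewrite (bigD1 i) //= ffunE eqxx andbT big1 ?mulr1 // => i' /negPf hi.
by rewrite ffunE hi andbF.
Qed.

Lemma mean_even_part_odd N' (o : 'I_n -> bool) (m : {ffun 'I_n -> 'I_N'.+1}) i : o i ->
  mean N' (fun t => even_part t * trig_mono o m t) = 0.
Proof.
move=> oi; apply: (@mean_odd _ _ _ _ (ep1 i)); first by apply: periodicM; [exact: even_part_period|exact: trig_mono_period].
by move=> t; rewrite /even_part cos_point_flip trig_mono_parity prod_ep1 oi expr1 mulN1r mulrN.
Qed.

Lemma mean_odd_part_even N' (o : 'I_n -> bool) (m : {ffun 'I_n -> 'I_N'.+1}) i : ~~ o i ->
  mean N' (fun t => odd_part i t * trig_mono o m t) = 0.
Proof.
move=> oi; apply: (@mean_odd _ _ _ _ (ep1 i)); first by apply: periodicM; [exact: odd_part_period|exact: trig_mono_period].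
by move=> t; rewrite odd_part_parity trig_mono_parity !prod_ep1 eqxx (negPf oi) expr0 expr1 mul1r mulN1r mulNr.
Qed.

Lemma mean_line_value_trig_mono N' (o : 'I_n -> bool) (m : {ffun 'I_n -> 'I_N'.+1}) k :
  mean N' (fun t => line_value k t * trig_mono o m t) = mean N' (fun t => even_part t * trig_mono o m t)
   - S * \sum_i (k i)%:R * mean N' (fun t => odd_part i t * trig_mono o m t).
Proof.
have -> : (fun t => line_value k t * trig_mono o m t) = (fun t => even_part t * trig_mono o m t
   + (- S) * \sum_i (k i)%:R * (odd_part i t * trig_mono o m t)).
  apply/funext => t; rewrite /line_value mulrBl mulNr -mulrA mulr_suml; congr (_ - S * _).
  by apply: eq_bigr => i _; rewrite mulrA.
rewrite meanD meanZ mean_sum mulNr; congr (_ - S * _).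
by apply: eq_bigr => i _; rewrite meanZ.
Qed.

(** Averaging against a trigonometric monomial of the parity of one part
    eliminates the other parts. *)
Lemma coef_even_part N' (m : {ffun 'I_n -> 'I_N'.+1}) k :
  coef (fun=> false) even_part m = mean N' (fun t => line_value k t * trig_mono (fun=> false) m t).
Proof.
rewrite mean_line_value_trig_mono big1 ?mulr0 ?subr0 // => i _.
by rewrite mean_odd_part_even // mulr0.
Qed.

Lemma coef_odd_part N' (m : {ffun 'I_n -> 'I_N'.+1}) (k : 'I_n -> bool) m0 : k m0 ->
  coef (fun i => i == m0) (odd_part m0) m
   = - S^-1 * mean N' (fun t => line_value k t * trig_mono (fun i => i == m0) m t).
Proof.
move=> km; rewrite mean_line_value_trig_mono (@mean_even_part_odd _ _ _ m0) // (bigD1 m0) //= km big1.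
  by rewrite sub0r addr0 mul1r mulNr mulrN opprK mulKf // gt_eqF.
by move=> i im; rewrite mean_odd_part_even // mulr0.
Qed.

(** The distance from [x] to the multiples of [N], for [x <= N]. *)
Definition alias_dist (N x : nat) : nat := minn x (N - x).

Let alias_dist_single (N x : nat) (be : int) : (x < N)%N -> (N %| be + x%:Z)%Z -> (alias_dist N x <= `|be|)%N.
Proof.
move=> xN /dvdzP[q hq]; rewrite /alias_dist.
have [q0|q0] := lerP q 0.
  have : q * N <= 0 by rewrite mulr_le0_ge0.
  lia.
have : (N : int) <= q * N by rewrite ler_peMl.
lia.
Qed.

Let alias_dist_sum (N x y : nat) (be : int) : (x < N)%N -> (y < N)%N ->
  (N %| be + (x%:Z + y%:Z))%Z -> (maxn (alias_dist N x) (alias_dist N y) - minn (alias_dist N x) (alias_dist N y) <= `|be|)%N.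
Proof.
move=> xN yN /dvdzP[q hq]; rewrite /alias_dist.
have [q0|q0] := lerP q 0.
  have : q * N <= 0 by rewrite mulr_le0_ge0.
  lia.
have [q1|q1] := lerP q 1.
  have q1E : q = 1 by lia.
  rewrite q1E mul1r in hq; lia.
have : (N : int) * 2 <= q * N by rewrite mulrC ler_wpM2r.
lia.
Qed.

Let alias_dist_diff (N x y : nat) (be : int) : (x < N)%N -> (y < N)%N ->
  (N %| be + (x%:Z - y%:Z))%Z -> (maxn (alias_dist N x) (alias_dist N y) - minn (alias_dist N x) (alias_dist N y) <= `|be|)%N.
Proof.
move=> xN yN /dvdzP[q hq]; rewrite /alias_dist.
have [q0|q0] := lerP q (-1).
  have : q * N <= - (N : int) by rewrite -[leRHS]mulN1r ler_wpM2r.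
  lia.
have [q1|q1] := lerP q 0.
  have q1E : q = 0 by lia.
  rewrite q1E mul0r in hq; lia.
have : (N : int) <= q * N by rewrite ler_peMl.
lia.
Qed.

Let trg_cos b (x : R) : trg b x = cos (x - b%:R * (pi / 2)).
Proof. by case: b; rewrite /trg ?mul1r ?cosBpihalf ?mul0r ?subr0. Qed.

Let prod_trg_le1 (P : pred 'I_n) (o : 'I_n -> bool) (f : 'I_n -> R) : `|\prod_(i | P i) trg (o i) (f i)| <= 1.
Proof.
by rewrite normr_prod; apply: prodr_ile1 => i _; rewrite normr_ge0 trg_le1.
Qed.

Lemma trig_mono_single N' (o : 'I_n -> bool) (m : {ffun 'I_n -> 'I_N'.+1}) i t :
  exists w1 w2 (M1 M2 : int) (p1 p2 : R), [/\ `|w1| + `|w2| <= 1,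
    (forall be : int, (N'.+1 %| be + M1)%Z -> (alias_dist N'.+1 (m i) <= `|be|)%N),
    (forall be : int, (N'.+1 %| be + M2)%Z -> (alias_dist N'.+1 (m i) <= `|be|)%N) &
    forall x, trig_mono o m (fun i' => t i' + (i' == i)%:R * x) =
      w1 * cos (M1%:~R * x + p1) + w2 * cos (M2%:~R * x + p2)].
Proof.
exists (\prod_(i' | i' != i) trg (o i') ((m i')%:R * t i')), 0, (m i), (m i).
exists ((m i)%:R * t i - (o i)%:R * (pi / 2)), 0; split.
- by rewrite normr0 addr0 prod_trg_le1.
- by move=> be; apply: alias_dist_single.
- by move=> be; apply: alias_dist_single.
move=> x; rewrite mul0r addr0 /trig_mono (bigD1 i) //= eqxx mul1r mulrC; congr (_ * _).
  by apply: eq_bigr => i' /negPf ->; rewrite mul0r addr0.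
by rewrite trg_cos mulrDr addrAC addrC addrA.
Qed.

(** The product of a sine of frequency [m m0] and a cosine of frequency [m i] has
    the frequencies [m m0 +- m i]. *)
Lemma trig_mono_pair N' (m : {ffun 'I_n -> 'I_N'.+1}) m0 i t : i != m0 ->
  exists w1 w2 (M1 M2 : int) (p1 p2 : R), [/\ `|w1| + `|w2| <= 1,
    (forall be : int, (N'.+1 %| be + M1)%Z ->
      (maxn (alias_dist N'.+1 (m m0)) (alias_dist N'.+1 (m i)) - minn (alias_dist N'.+1 (m m0)) (alias_dist N'.+1 (m i)) <= `|be|)%N),
    (forall be : int, (N'.+1 %| be + M2)%Z ->
      (maxn (alias_dist N'.+1 (m m0)) (alias_dist N'.+1 (m i)) - minn (alias_dist N'.+1 (m m0)) (alias_dist N'.+1 (m i)) <= `|be|)%N) &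
    forall x, trig_mono (fun i' => i' == m0) m (fun i' => t i' + ((i' == m0) || (i' == i))%:R * x) =
      w1 * cos (M1%:~R * x + p1) + w2 * cos (M2%:~R * x + p2)].
Proof.
move=> im.
pose w := \prod_(i' | (i' != m0) && (i' != i)) trg (i' == m0) ((m i')%:R * t i').
have w1 : `|w| <= 1 by apply: prod_trg_le1.
pose a := (m m0)%:R * t m0; pose b := (m i)%:R * t i.
exists (w / 2), (w / 2), ((m m0)%:Z + (m i)%:Z), ((m m0)%:Z - (m i)%:Z).
exists (a + b - pi / 2), (a - b - pi / 2); split.
- by rewrite normrM normfV normr_nat -splitr.
- by move=> be; apply: alias_dist_sum.
- by move=> be; apply: alias_dist_diff.
move=> x; rewrite /trig_mono (bigD1 m0) //= (bigD1 i) //= !eqxx orbT (negPf im) !mul1r.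
have -> : \prod_(i' < n | (i' != m0) && (i' != i)) trg (i' == m0)
    ((m i')%:R * (t i' + ((i' == m0) || (i' == i))%:R * x)) = w.
  by apply: eq_bigr => i' /andP[/negPf h1 /negPf h2]; rewrite h1 h2 mul0r addr0.
rewrite /trg rmorphD rmorphB /=.
have -> : ((m m0)%:~R + (m i)%:~R) * x + (a + b - pi / 2)
   = ((m m0)%:R * (t m0 + x) + (m i)%:R * (t i + x)) - pi / 2 by rewrite /a /b -!pmulrn; ring.
have -> : ((m m0)%:~R - (m i)%:~R) * x + (a - b - pi / 2)
   = ((m m0)%:R * (t m0 + x) - (m i)%:R * (t i + x)) - pi / 2 by rewrite /a /b -!pmulrn; ring.
by rewrite !cosBpihalf sinD sinB; field.
Qed.

(** Decay in every single exponent is decay in their product, at the cost of a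
    factor [n] in the rate. *)
Lemma geo_max (X B q : R) (e : 'I_n -> nat) : 0 <= B -> 0 <= q <= 1 ->
  (forall i, X <= B * q ^+ (n * e i)) -> X <= B * \prod_i q ^+ e i.
Proof.
move=> B0 /andP[q0 q1] h.
have [i _ hi] := @arg_maxnP 'I_n l0 xpredT e isT.
apply: le_trans (h i) _; rewrite ler_wpM2l //.
rewrite -(big_morph _ (exprD q) (expr0 q)) ler_wiXn2l //.
have : (\sum_i' e i' <= \sum_(i' < n) e i)%N by apply: leq_sum => i' _; apply: hi.
by rewrite sum_nat_const card_ord.
Qed.

End Coefficients.

(** The Chebyshev polynomials [T_k], and [U_(k-1)] if [b] holds: [trg_cheb]. *)
Fixpoint cheb_pair {R : realType} (b : bool) (k : nat) (x : R) : R * R :=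
  match k with
  | 0 => ((~~ b)%:R, if b then 1 else x)
  | k'.+1 => let p := cheb_pair b k' x in (p.2, 2 * x * p.2 - p.1)
  end.

Definition cheb {R : realType} b k (x : R) : R := (cheb_pair b k x).1.

Lemma cheb0 (R : realType) b (x : R) : cheb b 0 x = (~~ b)%:R. Proof. by []. Qed.

Lemma cheb1 (R : realType) b (x : R) : cheb b 1 x = if b then 1 else x.
Proof. by []. Qed.

Lemma chebSS (R : realType) b k (x : R) :
  cheb b k.+2 x = 2 * x * cheb b k.+1 x - cheb b k x.
Proof. by []. Qed.

Lemma trg_cheb (R : realType) b k (t : R) :
  trg b (k%:R * t) = (if b then sin t else 1) * cheb b k (cos t).
Proof.
suff [] : trg b (k%:R * t) = (if b then sin t else 1) * cheb b k (cos t) /\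
  trg b (k.+1%:R * t) = (if b then sin t else 1) * cheb b k.+1 (cos t) by [].
elim: k => [|k [h1 h2]].
  rewrite mul0r mul1r cheb0 cheb1; case: b; rewrite /trg ?sin0 ?cos0 /=.
    by rewrite mulr0 mulr1.
  by rewrite !mul1r.
split=> //; rewrite chebSS mulrBr mulrCA -h2 -h1.
have -> : k.+2%:R * t = k.+1%:R * t + t by rewrite -natr1 mulrDl mul1r.
have -> : k%:R * t = k.+1%:R * t - t by rewrite -[k.+1%:R]natr1 mulrDl mul1r addrK.
by case: b {h1 h2}; rewrite /trg ?sinB ?sinD ?cosB ?cosD; ring.
Qed.

Section Expansion.
Context {R : realType} {d n : nat}.
Variables (A : 'rV[R]_n -> 'M[R]_(d, n) -> 'rV[R]_n) (C0 : R) (F : R -> R).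
Hypothesis hF : forall y : R, 0 <= y -> analytic_at F y.
Hypothesis hA : Gen_bound A C0 F.

Definition multi_index : Type := ({ffun 'I_n -> nat} * {ffun 'I_n -> bool})%type.

(** A series of products of Chebyshev polynomials of the first and second kind,
    in the variables [c_j / S], whose coefficients decay geometrically. *)
Definition expandable (S q : R) (f : 'rV[R]_n -> R) : Prop :=
  exists (C : R) (o : 'I_n -> bool) (ka : multi_index -> R), [/\ 0 <= C,
    forall i, `|ka i| <= C * \prod_j q ^+ i.1 j &
    forall c : 'rV[R]_n, (forall j, `|c 0 j| < S) ->
      hsum (fun i => (ka i * \prod_j cheb (o j) (i.1 j) (c 0 j / S))%:C%C) (f c)%:C%C].

Variables (j : 'I_d) (l0 : 'I_n) (S q : R).
Hypotheses (S0 : 0 < S) (q0 : 0 < q) (q1 : q < 1).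

(* at this radius the weight of a frequency e is q ^ (- 2 n e): geo_max divides the
   rate by n, and the comparison of two exponents below halves it *)
Let z : R := - (2 * n%:R) * ln q.

Let z0 : 0 <= z.
Proof.
rewrite /z mulNr -mulrN mulr_ge0 ?mulr_ge0 // oppr_ge0 ltW // ln_lt0 // q0 q1 //.
Qed.

Let zq (e : nat) : expR (- (z * e%:R)) = q ^+ (2 * n * e).
Proof.
rewrite /z mulNr mulNr opprK -[in RHS](lnK (x := q)) ?posrE // -expRM_natl.
by congr expR; rewrite !natrM; ring.
Qed.

Let cont_cos_point (f : 'rV[R]_n -> R) :
  (forall c e, 0 < e -> exists2 de, 0 < de & forall w, `|w| <= de -> `|f (c + w) - f c| <= e) ->
  forall t e, 0 < e -> exists2 de, 0 < de &
    forall t', (forall i, `|t' i - t i| <= de) -> `|f (cos_point S t') - f (cos_point S t)| <= e.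
Proof.
move=> hf t e e0; have [de de0 h] := hf (cos_point S t) e e0.
exists (de / S); first by rewrite divr_gt0.
move=> t' ht'; have -> : cos_point S t' = cos_point S t + (cos_point S t' - cos_point S t) by rewrite addrC subrK.
apply: h; rewrite [leLHS]/Num.Def.normr/= mx_normrE bigmax_le // ?ltW //.
move=> [i k] _ /=; rewrite !mxE -mulrBr normrM gtr0_norm // mulrC -ler_pdivlMr //.
by apply: le_trans (ht' k); apply: cos_lip.
Qed.

(** The coefficients of [even_part] are those of [line_value] with one moving
    component. The substitution [c_i = S cos t_i] turns the cosine series into a
    Chebyshev series. As [q] is arbitrary, so is the rate of convergence. *)
Lemma zeroth_order_expandable : expandable S q (zeroth_order A l0).
Proof.
have [C C_ge0 hC] := line_value_fseries hF hA j l0 S0 z0.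
have hcont := cont_cos_point (fun c e e0 => let: ex_intro2 de de0 h := A_continuous hF hA j c 0 e0 in
   ex_intro2 _ _ de de0 (fun w hw => h w l0 hw) ).
have hb N' (m : {ffun 'I_n -> 'I_N'.+1}) :
    `|coef (fun=> false) (even_part A l0 S) m| <= C * \prod_i q ^+ minn (m i) (N'.+1 - m i).
  apply: geo_max => // [|i]; first by rewrite !ltW.
  rewrite (coef_even_part A j l0 S m (fun i' => i' == i)).
  apply: (@le_trans _ _ (C * expR (- (z * (alias_dist N'.+1 (m i))%:R)))).
    apply: mean_line_value => // [|t]; last exact: trig_mono_single.
    by apply: periodicM; [exact: line_value_period|exact: trig_mono_period].
  rewrite zq ler_wpM2l // ler_wiXn2l ?(ltW q0) ?(ltW q1) //.
  by rewrite -mulnA leq_pmull.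
have [ka [hk1 hk2]] := trig_expansion (even_part_period A l0 S) (even_part_parity A l0 S) C_ge0 (ltW q0) q1 hcont hb.
exists C, (fun=> false), ka; split=> // c hc.
pose t i := acos (c 0 i / S).
have hS i : -1 <= c 0 i / S <= 1.
  by rewrite -ler_norml normrM normfV (gtr0_norm S0) ler_pdivrMr // mul1r ltW.
have ct i : cos (t i) = c 0 i / S by rewrite acosK // in_itv /= hS.
have cE : cos_point S t = c.
  by apply/rowP => i; rewrite mxE ct mulrC divfK // gt_eqF.
have ht i : 0 <= t i < pi *+ 2.
  rewrite acos_ge0 //=; apply: le_lt_trans (acos_lepi (hS i)) _.
  by rewrite mulr2n ltrDl pi_gt0.
have := hk2 t ht; rewrite /even_part cE; apply: eq_hsum => i; congr ((_ * _)%:C%C).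
by apply: eq_bigr => k _; rewrite trg_cheb mul1r ct.
Qed.

(** Moving only the component [m0] shows the decay in the exponent of [m0];
    for another component [i] both move, and the decay is in the difference of the
    exponents, which is large when that of [m0] is less than half of that of [i]. *)
Lemma gradient_coef_expandable m0 : expandable S q (gradient_coef A l0 j m0).
Proof.
have [C C_ge0 hC] := line_value_fseries hF hA j l0 S0 z0.
have hcontb : forall c e, 0 < e -> exists2 de, 0 < de &
    forall w, `|w| <= de -> `|gradient_coef A l0 j m0 (c + w) - gradient_coef A l0 j m0 c| <= e.
  move=> c e e0; have e2 : 0 < e / 2 by rewrite divr_gt0.
  have [d1 d10 h1] := A_continuous hF hA j c (delta_mx j m0) e2.
  have [d2 d20 h2] := A_continuous hF hA j c 0 e2.
  exists (Num.min d1 d2); first by rewrite lt_min d10 d20.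
  move=> w; rewrite le_min => /andP[w1 w2]; rewrite /gradient_coef.
  have -> : A (c + w) (delta_mx j m0) 0 l0 - A (c + w) 0 0 l0 -
      (A c (delta_mx j m0) 0 l0 - A c 0 0 l0)
    = (A (c + w) (delta_mx j m0) 0 l0 - A c (delta_mx j m0) 0 l0)
      - (A (c + w) 0 0 l0 - A c 0 0 l0) by ring.
  rewrite [e]splitr; apply: le_trans (ler_normB _ _) _.
  by apply: lerD; [apply: h1|apply: h2].
have hcont : forall t e, 0 < e -> exists2 de, 0 < de &
    forall t', (forall i, `|t' i - t i| <= de) -> `|odd_part A j l0 S m0 t' - odd_part A j l0 S m0 t| <= e.
  move=> t e e0; pose b0 := `|gradient_coef A l0 j m0 (cos_point S t)|.
  have e2 : 0 < e / 2 by rewrite divr_gt0.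
  have [d1 d10 h1] := cont_cos_point hcontb t e2.
  have b01 : 0 < b0 + 1 by rewrite ltr_wpDl /b0.
  exists (Num.min d1 (e / 2 / (b0 + 1))); first by rewrite lt_min d10 !divr_gt0.
  move=> t' ht'; rewrite /odd_part; set f' := gradient_coef _ _ _ _ _; set f := gradient_coef _ _ _ _ _.
  have -> : sin (t' m0) * f' - sin (t m0) * f
    = sin (t' m0) * (f' - f) + (sin (t' m0) - sin (t m0)) * f by ring.
  rewrite [e]splitr; apply: le_trans (ler_normD _ _) _; rewrite !normrM; apply: lerD.
    apply: le_trans (ler_piMl (normr_ge0 _) (sin_max _)) _.
    by apply: h1 => i; apply: le_trans (ht' i) _; rewrite ge_min lexx.
  apply: (@le_trans _ _ (e / 2 / (b0 + 1) * (b0 + 1))); last by rewrite divfK ?gt_eqF.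
  apply: ler_pM => //; last by rewrite lerDl.
  apply: le_trans (sin_lip _ _) _; apply: le_trans (ht' m0) _.
  by rewrite ge_min lexx orbT.
have CS0 : 0 <= C / S by rewrite divr_ge0 // ltW.
have hb N' (m : {ffun 'I_n -> 'I_N'.+1}) :
    `|coef (fun i => i == m0) (odd_part A j l0 S m0) m| <= C / S * \prod_i q ^+ minn (m i) (N'.+1 - m i).

  have h1 : `|coef (fun i => i == m0) (odd_part A j l0 S m0) m| <= C / S * q ^+ (2 * n * alias_dist N'.+1 (m m0)).
    rewrite (@coef_odd_part _ _ _ A j l0 S S0 N' m (fun i' => i' == m0) m0) // normrM normrN normfV (gtr0_norm S0).
    rewrite mulrC [C / S]mulrC -mulrA [_ * S^-1]mulrC ler_wpM2l ?invr_ge0 ?(ltW S0) //.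
    rewrite -zq; apply: mean_line_value => // [|t]; last exact: trig_mono_single.
    by apply: periodicM; [exact: line_value_period|exact: trig_mono_period].
  apply: geo_max => // [|i]; first by rewrite !ltW.
  have [->|im] := eqVneq i m0.
    apply: le_trans h1 _; rewrite ler_wpM2l // ler_wiXn2l ?(ltW q0) ?(ltW q1) //.
    by rewrite -mulnA leq_pmull.
  have h2 : `|coef (fun i => i == m0) (odd_part A j l0 S m0) m| <=
      C / S * q ^+ (2 * n * (maxn (alias_dist N'.+1 (m m0)) (alias_dist N'.+1 (m i)) - minn (alias_dist N'.+1 (m m0)) (alias_dist N'.+1 (m i)))).
    rewrite (@coef_odd_part _ _ _ A j l0 S S0 N' m (fun i' => (i' == m0) || (i' == i)) m0) ?eqxx //.
    rewrite normrM normrN normfV (gtr0_norm S0).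
    rewrite mulrC [C / S]mulrC -mulrA [_ * S^-1]mulrC ler_wpM2l ?invr_ge0 ?(ltW S0) //.
    rewrite -zq; apply: mean_line_value => // [|t]; last exact: trig_mono_pair.
    by apply: periodicM; [exact: line_value_period|exact: trig_mono_period].
  have [le1|le2] := leqP (alias_dist N'.+1 (m i)) (2 * alias_dist N'.+1 (m m0)).
    apply: le_trans h1 _; rewrite ler_wpM2l // ler_wiXn2l ?(ltW q0) ?(ltW q1) //.
    by rewrite [(2 * n)%N]mulnC -mulnA leq_mul2l le1 orbT.
  apply: le_trans h2 _; rewrite ler_wpM2l // ler_wiXn2l ?(ltW q0) ?(ltW q1) //.
  rewrite [(2 * n)%N]mulnC -mulnA leq_mul2l; apply/orP; right.
  by rewrite -/(alias_dist N'.+1 (m i)); lia.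
have [ka [hk1 hk2]] := trig_expansion (odd_part_period A j l0 S m0) (odd_part_parity A j l0 S m0) CS0 (ltW q0) q1 hcont hb.
exists (C / S), (fun i => i == m0), ka; split=> // c hc.
pose t i := acos (c 0 i / S).
have hS' i : -1 < c 0 i / S < 1.
  by rewrite -ltr_norml normrM normfV (gtr0_norm S0) ltr_pdivrMr // mul1r.
have hS i : -1 <= c 0 i / S <= 1 by case/andP: (hS' i) => /ltW -> /ltW ->.
have ct i : cos (t i) = c 0 i / S by rewrite acosK // in_itv /= hS.
have cE : cos_point S t = c.
  by apply/rowP => i; rewrite mxE ct mulrC divfK // gt_eqF.
have ht i : 0 <= t i < pi *+ 2.
  rewrite acos_ge0 //=; apply: le_lt_trans (acos_lepi (hS i)) _.
  by rewrite mulr2n ltrDl pi_gt0.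
have st : sin (t m0) != 0.
  rewrite gt_eqF // sin_gt0_pi // acos_gt0 ?acos_ltpi //.
    by case/andP: (hS' m0) => -> /ltW ->.
  by case/andP: (hS' m0) => /ltW -> ->.
have := hsumZ ((sin (t m0))^-1)%:C%C (hk2 t ht).
rewrite /odd_part cE -rmorphM mulKf //; apply: eq_hsum => i; rewrite -rmorphM; congr (_%:C%C).
rewrite mulrCA; congr (_ * _); rewrite (bigD1 m0) //= [in RHS](bigD1 m0) //=.
rewrite trg_cheb eqxx ct mulrA mulKf //; congr (_ * _).
by apply: eq_bigr => k /negPf km; rewrite trg_cheb km mul1r ct.
Qed.

End Expansion.

(** * Weighted algebras of series in e^(i al.x) t^k *)

Section Algebra.
Context {R : realType} {d : nat}.

Definition mono : Type := ('rV[int]_d * nat)%type.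
Implicit Types (x : 'rV[R]_d) (t : R).

Definition madd (g h : mono) : mono := (g.1 + h.1, (g.2 + h.2)%N).

(** The monomial [e^{i al.x} t^k]. *)
Definition chi (g : mono) x t : R[i] := expi (freq_dot g.1 x) * (t ^+ g.2)%:C%C.

Lemma chi_add g h x t : chi (madd g h) x t = chi g x t * chi h x t.
Proof. by rewrite /chi /= freq_dotDl expiD exprD rmorphM /= mulrACA. Qed.

Lemma nc_chi g x t : nc (chi g x t) = `|t| ^+ g.2.
Proof. by rewrite /chi ncM nc_expi mul1r ncR normrX. Qed.

(** Weights for which the series converge on the time interval [|t| < T]. *)
Record weight (T : R) (w : mono -> R) : Prop := Weight {
  weight_gt0 : forall g, 0 < w g;
  weight_adm : forall t, `|t| < T -> forall g, `|t| ^+ g.2 <= w g;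
  weight_add : forall g h, w (madd g h) <= w g * w h;
  weight_0 : w (0, 0%N) <= 1 }.

(** [f] is real, and the sum of a series in the monomials [chi] whose norm for the
    weight [w] is at most [K]. Its values for [T <= |t|] are arbitrary. *)
Definition Wn (T : R) (w : mono -> R) (f : 'rV[R]_d -> R -> R) (K : R) : Prop :=
  exists c : mono -> R[i], bsum (fun g => nc (c g) * w g) K /\
    forall x t, `|t| < T -> hsum (fun g => c g * chi g x t) (f x t)%:C%C.

Section FixedWeight.
Variables (T : R) (w : mono -> R).
Hypothesis hw : weight T w.
Let w0 g : 0 <= w g. Proof. exact: ltW (weight_gt0 hw g). Qed.
Notation W := (Wn T w).

(** It suffices to exhibit any family of terms, with repetitions. *)
Lemma W_rep (I : choiceType) (C : I -> R[i]) (g : I -> mono) f K :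
  bsum (fun i => nc (C i) * w (g i)) K ->
  (forall x t, `|t| < T -> hsum (fun i => C i * chi (g i) x t) (f x t)%:C%C) ->
  W f K.
Proof.
move=> hK hf.
have [|c hc] := @choice _ _ (fun a s => hsum (fiber g C a) s).
  move=> a; apply: (hsum_ex (K := (w a)^-1 * K)) => //.
  have wa : 0 <= (w a)^-1 by rewrite invr_ge0.
  apply: le_bsum (bsumZ wa hK) => i; rewrite /fiber; case: eqP => [->|_].
    by rewrite mulrC mulfK // gt_eqF // (weight_gt0 hw).
  by rewrite nc0 !mulr_ge0 ?nc_ge0.
exists c; split; first exact: bsum_fiber hc.
move=> x t tT; apply: (hsum_fiber (g := g) (K := K) _ (hf x t tT)) => [|a].
  apply: le_bsum hK => i; rewrite ncM nc_chi ler_wpM2l ?nc_ge0 //.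
  exact: weight_adm hw _ tT _.
rewrite mulrC; apply: eq_hsum (hsumZ (chi a x t) (hc a)) => i.
by rewrite /fiber; case: eqP => [->|_]; rewrite ?mulr0 // mulrC.
Qed.

Lemma W_ge0 f K : W f K -> 0 <= K.
Proof. by move=> [c [/bsum_ge0]]. Qed.

Lemma W_le f K L : W f K -> K <= L -> W f L.
Proof. by move=> [c [h1 h2]] hL; exists c; split=> //; apply: bsum_le hL. Qed.

Lemma W_ext f f' K : (forall x t, `|t| < T -> f x t = f' x t) -> W f K -> W f' K.
Proof.
by move=> e [c [h1 h2]]; exists c; split=> // x t tT; rewrite -e //; apply: h2.
Qed.

Lemma W_bound f K x t : W f K -> `|t| < T -> `|f x t| <= K.
Proof.
move=> [c [h1 h2]] tT; rewrite -ncR; apply: (hsum_norm (h2 x t tT)).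
apply: le_bsum h1 => g; rewrite ncM nc_chi ler_wpM2l ?nc_ge0 //.
exact: weight_adm hw _ tT _.
Qed.

(** Completeness: the coefficients of the sum of a series in the norm are the
    sums of the coefficients. *)
Lemma W_sum (I : choiceType) (f : I -> 'rV[R]_d -> R -> R) (K : I -> R) F L :
  (forall i, W (f i) (K i)) -> bsum K L ->
  (forall x t, `|t| < T -> hsum (fun i => (f i x t)%:C%C) (F x t)%:C%C) -> W F L.
Proof.
move=> hf hK hF; have [c hc] := choice hf.
apply: (@W_rep _ (fun ig => c ig.1 ig.2) (fun ig : I * mono => ig.2)).
  apply: (bsum_fst (q := K)) => // [i|ig]; first exact: (hc i).1.
  by rewrite mulr_ge0 ?nc_ge0.
move=> x t tT; apply: (hsum_rows (s := fun i => (f i x t)%:C%C) (K := L)).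
- apply: (bsum_fst (q := K)) => // [i|ig]; last exact: nc_ge0.
  apply: le_bsum (hc i).1 => g; rewrite ncM nc_chi ler_wpM2l ?nc_ge0 //.
  exact: weight_adm hw _ tT _.
- by move=> i; apply: (hc i).2.
- exact: hF.
Qed.

Lemma W_finsum (I : finType) (f : I -> 'rV[R]_d -> R -> R) (K : I -> R) :
  (forall i, W (f i) (K i)) -> W (fun x t => \sum_i f i x t) (\sum_i K i).
Proof.
move=> hf; apply: (W_sum hf).
  by apply: bsum_finType => // i; apply: W_ge0 (hf i).
by move=> x t _; rewrite rmorph_sum; apply: hsum_finType.
Qed.

Lemma W_add f g K L : W f K -> W g L -> W (fun x t => f x t + g x t) (K + L).
Proof.
move=> hf hg.
have := @W_finsum bool (fun b => if b then f else g) (fun b => if b then K else L).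
rewrite big_bool /= => h; apply: W_ext (h _) => [x t _|[]//].
by rewrite big_bool.
Qed.

Lemma W_scale k f K : W f K -> W (fun x t => k * f x t) (`|k| * K).
Proof.
move=> [c [h1 h2]]; exists (fun g => k%:C%C * c g); split.
  apply: le_bsum (bsumZ (normr_ge0 k) h1) => g.
  by rewrite ncM ncR mulrA.
move=> x t tT; rewrite rmorphM; apply: eq_hsum (hsumZ k%:C%C (h2 x t tT)) => g.
by rewrite mulrA.
Qed.

Lemma W_sub f g K L : W f K -> W g L -> W (fun x t => f x t - g x t) (K + L).
Proof.
move=> hf hg; have := W_add hf (W_scale (-1) hg).
rewrite normrN1 mul1r; apply: W_ext => x t _; by rewrite mulN1r.
Qed.

Lemma W_mul f g K L : W f K -> W g L -> W (fun x t => f x t * g x t) (K * L).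
Proof.
move=> [c [c1 c2]] [e [e1 e2]].
apply: (@W_rep _ (fun p => c p.1 * e p.2) (fun p : mono * mono => madd p.1 p.2)).
  have := bsum_prod (fun g => mulr_ge0 (nc_ge0 (c g)) (w0 g))
    (fun g => mulr_ge0 (nc_ge0 (e g)) (w0 g)) c1 e1.
  apply: le_bsum => -[a b] /=; rewrite ncM mulrACA ler_wpM2l ?mulr_ge0 ?nc_ge0 //.
  exact: (weight_add hw).
move=> x t tT; rewrite rmorphM.
have hb (a : mono -> R[i]) K0 : bsum (fun g => nc (a g) * w g) K0 ->
    bsum (fun g => nc (a g * chi g x t)) K0.
  apply: le_bsum => a'; rewrite ncM nc_chi ler_wpM2l ?nc_ge0 //.
  exact: weight_adm hw _ tT _.
apply: eq_hsum (hsum_prod (hb _ _ c1) (hb _ _ e1) (c2 x t tT) (e2 x t tT)) => -[a b] /=.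
by rewrite chi_add mulrACA.
Qed.

Lemma W_const k : W (fun _ _ => k) `|k|.
Proof.
apply: (@W_rep unit (fun=> k%:C%C) (fun=> (0, 0%N))).
  apply: bsum_finType => [i|]; first by rewrite mulr_ge0 ?nc_ge0.
  rewrite (big_pred1 tt) => [|[]//]; rewrite ncR -[leRHS]mulr1 ler_wpM2l //.
  exact: (weight_0 hw).
move=> x t _; have := @hsum_finType R unit (fun=> k%:C%C * chi (0, 0%N) x t).
rewrite (big_pred1 tt) => [|[]//].
by rewrite /chi /= freq_dot0l expi0 expr0 mulr1 mulr1.
Qed.

Lemma W_cst0 : W (fun _ _ => 0) 0.
Proof. by have := W_const 0; rewrite normr0. Qed.

End FixedWeight.

(** [f] acts on the balls of radius [r] of all these algebras at once, with
    values in the ball of radius [B] and Lipschitz constant [B]. *)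
Definition operates (n : nat) (r B : R) (f : 'rV[R]_n -> R) : Prop :=
  forall T w, weight T w ->
  forall (u v : 'I_n -> 'rV[R]_d -> R -> R) de,
    (forall l, Wn T w (u l) r) -> (forall l, Wn T w (v l) r) ->
    (forall l, Wn T w (fun x t => u l x t - v l x t) de) ->
    Wn T w (fun x t => f (\row_l u l x t)) B /\
    Wn T w (fun x t => f (\row_l u l x t) - f (\row_l v l x t)) (B * de).

Section Operating.
Context {n : nat}.
Variables (r S : R).
Hypotheses (r0 : 0 <= r) (rS : r < S) (S1 : 1 <= S).
Notation Op := (@operates n r).
Implicit Types (f : 'rV[R]_n -> R).

Hypothesis n0 : (0 < n)%N.
Let l1 : 'I_n := Ordinal n0.

Lemma Op_le f B B' : Op B f -> B <= B' -> Op B' f.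
Proof.
move=> hf hB T w hw u v de hu hv hd; have [h1 h2] := hf T w hw u v de hu hv hd.
split; first exact: W_le hB.
by apply: W_le h2 _; rewrite ler_wpM2r // (W_ge0 (hd l1)).
Qed.

Lemma Op_const k B : `|k| <= B -> Op B (fun=> k).
Proof.
move=> kB T w hw u v de hu hv hd; split; first exact: W_le (W_const hw k) kB.
apply: W_ext (W_le (W_cst0 hw) _) => [x t _|]; first by rewrite subrr.
by rewrite mulr_ge0 ?(W_ge0 (hd l1)) // (le_trans _ kB).
Qed.

Lemma Op_coord j : Op 1 (fun c => c 0 j / S).
Proof.
have S0 : 0 < S by apply: lt_le_trans S1.
move=> T w hw u v de hu hv hd; split.
  apply: (W_ext (f := fun x t => S^-1 * u j x t)) => [x t _|].
    by rewrite mxE mulrC.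
  apply: W_le (W_scale _ (hu j)) _; rewrite normfV gtr0_norm //.
  by rewrite mulrC ler_pdivrMr // mul1r ltW.
apply: (W_ext (f := fun x t => S^-1 * (u j x t - v j x t))) => [x t _|].
  by rewrite !mxE mulrC mulrBl.
apply: W_le (W_scale _ (hd j)) _; rewrite normfV gtr0_norm //.
by rewrite ler_wpM2r ?(W_ge0 (hd j)) // invf_le1.
Qed.

Lemma Op_mul f g B C : Op B f -> Op C g -> Op (2 * (B * C)) (fun c => f c * g c).
Proof.
move=> hf hg T w hw u v de hu hv hd.
have [f1 f2] := hf T w hw u v de hu hv hd; have [g1 g2] := hg T w hw u v de hu hv hd.
have hd' l : Wn T w (fun x t => v l x t - u l x t) de.
  have := W_scale (-1) (hd l); rewrite normrN1 mul1r; apply: W_ext => x t _; ring.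
have [g3 _] := hg T w hw v u de hv hu hd'.
have B0 := W_ge0 f1; have C00 := W_ge0 g1.
split.
  by apply: W_le (W_mul hw f1 g1) _; rewrite mulr_natl mulr2n lerDl mulr_ge0.
have := W_add hw (W_mul hw f1 g2) (W_mul hw f2 g3).
have -> : B * (C * de) + B * de * C = 2 * (B * C) * de by ring.
by apply: W_ext => x t _; ring.
Qed.

Lemma Op_lin k f g B C : Op B f -> Op C g -> Op (`|k| * B + C) (fun c => k * f c - g c).
Proof.
move=> hf hg T w hw u v de hu hv hd.
have [f1 f2] := hf T w hw u v de hu hv hd; have [g1 g2] := hg T w hw u v de hu hv hd.
split; first exact: (W_sub hw (W_scale k f1) g1).
have := W_sub hw (W_scale k f2) g2.
have -> : `|k| * (B * de) + C * de = (`|k| * B + C) * de by ring.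
by apply: W_ext => x t _; ring.
Qed.

Lemma Op_sum (I : choiceType) (f : I -> 'rV[R]_n -> R) (B : I -> R) F C :
  (forall i, Op (B i) (f i)) -> bsum B C ->
  (forall c : 'rV[R]_n, (forall j, `|c 0 j| < S) ->
     hsum (fun i => (f i c)%:C%C) (F c)%:C%C) -> Op C F.
Proof.
move=> hf hB hF T w hw u v de hu hv hd.
have de0 := W_ge0 (hd l1).
have small (v' : 'I_n -> 'rV[R]_d -> R -> R) x t : (forall l, Wn T w (v' l) r) ->
    `|t| < T -> forall j, `|(\row_l v' l x t) 0 j| < S.
  by move=> hv' tT j; rewrite mxE; apply: le_lt_trans rS; apply: W_bound (hv' j) tT.
split.
  apply: (W_sum hw (f := fun i x t => f i (\row_l u l x t)) (K := B)) => // [i|x t tT].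
    by have [] := hf i T w hw u v de hu hv hd.
  exact: hF (small u x t hu tT).
apply: (W_sum hw (f := fun i x t => f i (\row_l u l x t) - f i (\row_l v l x t)) (K := fun i => B i * de)) => [i||x t tT].
- by have [] := hf i T w hw u v de hu hv hd.
- by rewrite mulrC; apply: le_bsum (bsumZ de0 hB) => i; rewrite mulrC.
- rewrite rmorphB; apply: eq_hsum (hsumB (hF _ (small u x t hu tT)) (hF _ (small v x t hv tT))) => i.
  by rewrite rmorphB.
Qed.

(** The recurrence multiplies the bounds by at most [2 * 2 + 1], where [Op_mul]
    accounts for one of the factors 2. *)
Lemma Op_cheb b k j : Op (5 ^+ k) (fun c => cheb b k (c 0 j / S)).
Proof.
suff [] : Op (5 ^+ k) (fun c => cheb b k (c 0 j / S)) /\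
  Op (5 ^+ k.+1) (fun c => cheb b k.+1 (c 0 j / S)) by [].
elim: k => [|k [h1 h2]].
  split; first by apply: Op_const; rewrite expr0; case: b; rewrite /= ?normr0 ?normr1.
  rewrite expr1; case: b.
    by apply: Op_const; rewrite /= normr1 ler1n.
  by apply: Op_le (Op_coord j) _; rewrite ler1n.
split=> //.
have h := Op_lin 2 (Op_mul (Op_coord j) h2) h1.
suff e : (fun c : 'rV[R]_n => cheb b k.+2 (c 0 j / S))
   = (fun c => 2 * (c 0 j / S * cheb b k.+1 (c 0 j / S)) - cheb b k (c 0 j / S)).
  rewrite e; apply: Op_le h _; rewrite normr_nat mul1r !exprS.
  have := exprn_ge0 k (ler0n R 5).
  by move: (5 ^+ k) => y y0; lra.
by apply/funext => c; rewrite chebSS -!mulrA.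
Qed.

Lemma Op_prod_cheb (o : 'I_n -> bool) (e : 'I_n -> nat) :
  Op (\prod_j (2 * 5 ^+ e j)) (fun c => \prod_j cheb (o j) (e j) (c 0 j / S)).
Proof.
rewrite unlock; elim: (index_enum _) => [|j s IH] /=.
  by apply: Op_const; rewrite normr1.
by have := Op_mul (Op_cheb (o j) (e j) j) IH; rewrite mulrA.
Qed.

(** Chebyshev polynomials of degree [k] are bounded by [5 ^ k], each product costs a
    further factor 2, and the coefficients decay like [10 ^ - k]: what is left is
    the convergent series of the [2 * 2 ^ - k]. *)
Lemma expandable_operates f : expandable S (10^-1) f -> exists2 B, 0 <= B & Op B f.
Proof.
move=> [C [par [ka [CO hka hf]]]].
have hb : forall m, \sum_(k < m) 2 * (2^-1 : R) ^+ k <= 4.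
  move=> m; rewrite -mulr_sumr.
  have : (1 - 2^-1) * \sum_(k < m) 2^-1 ^+ k = 1 - 2^-1 ^+ m :> R.
    by rewrite -[1 - 2^-1]opprB mulNr -subrX1 opprB.
  have : 0 <= 2^-1 ^+ m :> R by rewrite exprn_ge0.
  by move: (\sum_(k < m) _) (2^-1 ^+ m) => x y y0 h; lra.
have h1 := bsumZ CO (bsum_ffun (n := n) (fun k => mulr_ge0 (ler0n R 2) (exprn_ge0 k (_ : 0 <= 2^-1))) hb).
have h2 : bsum (fun e : {ffun 'I_n -> bool} => 1 : R) (2 ^+ n).
  by apply: bsum_finType => //; rewrite sumr_const card_ffun card_bool card_ord -natrX.
have p0 (a : {ffun 'I_n -> nat}) : 0 <= C * \prod_(i < n) (2 * 2^-1 ^+ a i) :> R.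
  by rewrite mulr_ge0 // prodr_ge0 // => i _; rewrite mulr_ge0 // exprn_ge0.
have hB := bsum_prod p0 (fun _ => ler01) (h1 _) h2.
exists (C * 4 ^+ n * 2 ^+ n); first by rewrite !mulr_ge0 ?exprn_ge0.
apply: (Op_sum (f := fun i : multi_index => (fun c : 'rV[R]_n => ka i * \prod_j cheb (par j) (i.1 j) (c 0 j / S)))
   (B := fun i : multi_index => C * \prod_j (2 * 2^-1 ^+ i.1 j) * 1) _ _ hf) => [i|].
  have := Op_lin (ka i) (Op_prod_cheb par i.1) (@Op_const 0 0 _); rewrite normr0 => /(_ (lexx _)).
  rewrite addr0 => h.
  rewrite (_ : (fun c : 'rV[R]_n => ka i * \prod_j cheb (par j) (i.1 j) (c 0 j / S))
     = (fun c : 'rV[R]_n => ka i * \prod_j cheb (par j) (i.1 j) (c 0 j / S) - 0)).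
    apply: Op_le h _; rewrite mulr1.
    apply: le_trans (ler_wpM2r _ (hka i)) _.
      by apply: prodr_ge0 => j _; rewrite mulr_ge0 // exprn_ge0.
    rewrite -mulrA ler_wpM2l // -big_split /= le_eqVlt; apply/orP; left; apply/eqP.
    apply: eq_bigr => j _; rewrite mulrCA -exprMn; congr (_ * _ ^+ _).
    by field.
  by apply/funext => c; rewrite subr0.
exact: (hB).
Qed.

End Operating.

End Algebra.

(** * The weight of the existence proof *)

Section PowerBounds.
Context {R : realType}.
Implicit Types (s t tau de x : R).

Lemma pow_lip s t tau de k : 0 < de -> `|s| <= tau -> `|t| <= tau ->
  `|s ^+ k - t ^+ k| <= de^-1 * (tau + de) ^+ k * `|s - t|.
Proof.
move=> de0 hs ht; have tau0 : 0 <= tau by apply: le_trans hs.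
have d0 : 0 <= de^-1 by rewrite invr_ge0 ltW.
elim: k => [|k IH].
  by rewrite subrr normr0 !mulr_ge0 // exprn_ge0 // addr_ge0 // ltW.
have -> : s ^+ k.+1 - t ^+ k.+1 = s * (s ^+ k - t ^+ k) + t ^+ k * (s - t).
  by rewrite !exprS; ring.
apply: le_trans (ler_normD _ _) _; rewrite !normrM normrX.
have h1 : `|s| * `|s ^+ k - t ^+ k| <= tau * (de^-1 * (tau + de) ^+ k * `|s - t|).
  by apply: ler_pM.
have h2 : `|t| ^+ k * `|s - t| <= (tau + de) ^+ k * `|s - t|.
  apply: ler_wpM2r => //; apply: lerXn2r; rewrite ?nnegrE ?addr_ge0 ?(ltW de0) //.
  by apply: le_trans ht _; rewrite lerDl ltW.
apply: le_trans (lerD h1 h2) _; rewrite le_eqVlt exprS; apply/orP; left; apply/eqP.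
by field; rewrite gt_eqF.
Qed.

Lemma pow_taylor s t tau de k : 0 < de -> `|s| <= tau -> `|t| <= tau ->
  `|s ^+ k.+1 - t ^+ k.+1 - k.+1%:R * t ^+ k * (s - t)|
    <= k.+1%:R * (de^-1 * (tau + de) ^+ k * `|s - t| ^+ 2).
Proof.
move=> de0 hs ht; have tau0 : 0 <= tau by apply: le_trans hs.
have d0 : 0 <= de^-1 by rewrite invr_ge0 ltW.
have td0 : 0 <= tau + de by rewrite addr_ge0 // ltW.
elim: k => [|k IH].
  by rewrite !expr1 expr0 !mul1r subrr normr0 !mulr_ge0 ?sqr_ge0.
have -> : s ^+ k.+2 - t ^+ k.+2 - k.+2%:R * t ^+ k.+1 * (s - t)
  = s * (s ^+ k.+1 - t ^+ k.+1 - k.+1%:R * t ^+ k * (s - t))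
    + k.+1%:R * t ^+ k * (s - t) ^+ 2.
  by rewrite !exprS -[in k.+2%:R]natr1 expr0; ring.
apply: le_trans (ler_normD _ _) _; rewrite !normrM !normrX normr_nat.
have h1 := ler_pM (normr_ge0 s) (normr_ge0 _) hs IH.
have h2 : k.+1%:R * `|t| ^+ k * `|s - t| ^+ 2 <= k.+1%:R * (tau + de) ^+ k * `|s - t| ^+ 2.
  apply: ler_wpM2r; rewrite ?sqr_ge0 // ler_wpM2l //.
  apply: lerXn2r; rewrite ?nnegrE //.
  by apply: le_trans ht _; rewrite lerDl ltW.
apply: le_trans (lerD h1 h2) _.
have -> : tau * (k.+1%:R * (de^-1 * (tau + de) ^+ k * `|s - t| ^+ 2))
   + k.+1%:R * (tau + de) ^+ k * `|s - t| ^+ 2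
   = k.+1%:R * (de^-1 * (tau + de) ^+ k.+1 * `|s - t| ^+ 2).
  rewrite [_ ^+ k.+1]exprS; move: (`|s - t| ^+ 2) ((tau + de) ^+ k) (k.+1%:R) => X Y Z.
  by field; rewrite gt_eqF.
by rewrite ler_wpM2r ?ler_nat // !mulr_ge0 ?sqr_ge0 ?exprn_ge0.
Qed.

Lemma xexpN_le x : x * expR (- x) <= expR (- 1).
Proof.
have -> : expR (- 1) = expR (x - 1) * expR (- x) :> R.
  by rewrite -expRD; congr expR; ring.
rewrite ler_wpM2r ?expR_ge0 //; have := expR_ge1Dx (x - 1).
by rewrite addrCA subrr addr0.
Qed.

Lemma ratio_pow_ge j : expR (- 1) <= (j%:R / j.+1%:R : R) ^+ j.
Proof.
case: j => [|j]; first by rewrite expr0 -[leRHS]expR0 ler_expR; lra.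
have m0 : 0 < j.+1%:R :> R by rewrite ltr0n.
have -> : expR (- 1) = expR (- j.+1%:R^-1) ^+ j.+1 :> R.
  by rewrite -expRM_natl mulrN divff // gt_eqF.
apply: lerXn2r; rewrite ?nnegrE ?expR_ge0 ?divr_ge0 //.
rewrite expRN -[leRHS]invrK lef_pV2 ?posrE ?invr_gt0 ?divr_gt0 ?expR_gt0 ?ltr0n //.
apply: le_trans (expR_ge1Dx _); rewrite invf_div -[j.+2%:R]natr1 mulrDl divff ?gt_eqF //.
by rewrite mul1r.
Qed.

Lemma sqr_le_expR de x : 0 < de -> 0 <= x ->
  (1 + x) ^+ 2 <= (1 + 2 / de) ^+ 2 * expR (de * x).
Proof.
move=> de0 x0; have d1 : 0 <= 1 + 2 / de by rewrite addr_ge0 ?mulr_ge0 ?invr_ge0 ?(ltW de0).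
have -> : de * x = 2%:R * (de / 2 * x) by field.
rewrite expRM_natl -exprMn; apply: lerXn2r; rewrite ?nnegrE ?addr_ge0 //.
  by rewrite mulr_ge0 ?expR_ge0.
apply: le_trans (ler_wpM2l d1 (expR_ge1Dx (de / 2 * x))).
have -> : (1 + 2 / de) * (1 + de / 2 * x) = 1 + x + (2 / de + de / 2 * x).
  by field; rewrite gt_eqF.
by rewrite lerDl addr_ge0 ?mulr_ge0 ?invr_ge0 ?(ltW de0).
Qed.

End PowerBounds.

Section Weight.
Context {R : realType} {d : nat}.
Variables (rho C1 : R).
Hypotheses (rho0 : 0 < rho) (C10 : 0 < C1).
Notation mono := (@mono d).
Let T := rho / C1.

Definition evol (g : mono) (t : R) : R := expR ((rho - C1 * t) * freq_norm g.1) * t ^+ g.2.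

(** The norm that this weight defines bounds [Gen (rho - C1 * t)] uniformly in
    [t]. *)
Definition evol_weight (g : mono) : R := sup (evol g @` [set t | 0 <= t <= T]).

Let T0 : 0 < T. Proof. exact: divr_gt0. Qed.

Let radius_ge0 t : t <= T -> 0 <= rho - C1 * t.
Proof. by rewrite ler_pdivlMr // mulrC subr_ge0. Qed.

Lemma evol_le_weight g t : 0 <= t <= T -> evol g t <= evol_weight g.
Proof.
move=> tT; apply: ub_le_sup; last by exists t.
exists (expR (rho * freq_norm g.1) * T ^+ g.2) => _ [s /andP[s0 sT] <-].
apply: ler_pM; rewrite ?expR_ge0 ?exprn_ge0 //.
  rewrite ler_expR ler_wpM2r ?freq_norm_ge0 // lerBlDr lerDl.
  by rewrite mulr_ge0 // ltW.
by apply: lerXn2r; rewrite ?nnegrE // ltW.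
Qed.

Lemma evol_weight_le g X : (forall t, 0 <= t <= T -> evol g t <= X) -> evol_weight g <= X.
Proof.
move=> h; apply: ge_sup; last by move=> _ [t ht <-]; apply: h.
by exists (evol g 0); exists 0 => //=; rewrite lexx ltW.
Qed.

Lemma evol_ge0 g t : 0 <= t -> 0 <= evol g t.
Proof. by move=> t0; rewrite mulr_ge0 ?expR_ge0 ?exprn_ge0. Qed.

Lemma evol_weight_ge0 g : 0 <= evol_weight g.
Proof.
apply: le_trans (evol_ge0 g (ltW T0)) _; apply: evol_le_weight.
by rewrite lexx ltW.
Qed.

Lemma pow_le_weight g (t : R) : `|t| <= T -> `|t| ^+ g.2 <= evol_weight g.
Proof.
move=> tT; apply: le_trans (evol_le_weight g (t := `|t|) _); last by rewrite normr_ge0.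
rewrite -[leLHS]mul1r ler_wpM2r ?exprn_ge0 // -expR0 ler_expR.
by rewrite mulr_ge0 ?freq_norm_ge0 // radius_ge0.
Qed.

Lemma evol_weightP : weight T evol_weight.
Proof.
split=> [g|t /ltW tT g|g h|].
- apply: lt_le_trans (pow_le_weight g (t := T) _); last by rewrite gtr0_norm.
  by rewrite exprn_gt0 // gtr0_norm.
- exact: pow_le_weight.
- apply: evol_weight_le => t /andP[t0 tT].
  have ht : 0 <= t <= T by rewrite t0.
  apply: le_trans (ler_pM (evol_ge0 g t0) (evol_ge0 h t0) (evol_le_weight g ht)
    (evol_le_weight h ht)).
  rewrite /evol /= exprD mulrACA ler_wpM2r ?mulr_ge0 ?exprn_ge0 //.
  rewrite -expRD -mulrDr ler_expR ler_wpM2l ?freq_normD //; exact: radius_ge0.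
- apply: evol_weight_le => t /andP[t0 tT].
  by rewrite /evol /= freq_norm0 mulr0 expR0 expr0 mulr1.
Qed.

Lemma evol_weight_term g : evol_weight (g.1, g.2.+1) / g.2.+1%:R <= T * evol_weight g.
Proof.
apply: le_trans (_ : evol_weight (g.1, g.2.+1) <= _).
  rewrite ler_pdivrMr ?ltr0n // ler_peMr ?evol_weight_ge0 //.
  by rewrite ler1n.
apply: evol_weight_le => t /andP[t0 tT].
have -> : evol (g.1, g.2.+1) t = t * evol g t by rewrite /evol /= exprS; ring.
by apply: ler_pM => //; [apply: evol_ge0|apply: evol_le_weight; rewrite t0].
Qed.

(** The derivative in [x] costs a factor [|h.1|]; the primitive in [t] pays for
    it, because the radius is larger, by [C1 * t / (k + 1)], at the
    earlier time [t * k / (k + 1)]. *)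
Lemma evol_weight_deriv g h :
  evol_weight (g.1 + h.1, (g.2 + h.2).+1) * freq_norm h.1 / (g.2 + h.2).+1%:R
    <= C1^-1 * (evol_weight g * evol_weight h).
Proof.
have a0 := freq_norm_ge0 (R := R) h.1; set a := freq_norm h.1 in a0 *.
have m0 : 0 < (g.2 + h.2).+1%:R :> R by rewrite ltr0n.
have [a00|an0] := eqVneq a 0.
  by rewrite a00 mulr0 mul0r !mulr_ge0 ?evol_weight_ge0 // invr_ge0 ltW.
have ap : 0 < a by rewrite lt_neqAle eq_sym an0.
rewrite ler_pdivrMr // -ler_pdivlMr //.
apply: evol_weight_le => t /andP[t0 tT]; rewrite ler_pdivlMr //.
have ht : 0 <= t <= T by rewrite t0.
set j := h.2; have j0 : 0 < j.+1%:R :> R by rewrite ltr0n.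
pose s := t * (j%:R / j.+1%:R).
have hs : 0 <= s <= T.
  rewrite mulr_ge0 ?divr_ge0 //=; apply: le_trans tT.
  by rewrite ler_piMr // ler_pdivrMr // mul1r ler_nat.
(* the gain, x exp (- x) <= exp (- 1) <= (j / (j + 1)) ^ j at x = C1 t a / (j + 1) *)
have key : expR ((rho - C1 * t) * a) * t ^+ j.+1 * a <= j.+1%:R / C1 * evol h s.
  have -> : (rho - C1 * t) * a = (rho - C1 * s) * a + - (C1 * t * a / j.+1%:R).
    rewrite /s -natr1; field; by rewrite natr1 gt_eqF.
  set x := C1 * t * a / j.+1%:R.
  rewrite expRD /evol -/a -/j.
  have -> : expR ((rho - C1 * s) * a) * expR (- x) * t ^+ j.+1 * a
    = j.+1%:R / C1 * (expR ((rho - C1 * s) * a) * (x * expR (- x) * t ^+ j)).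
    by rewrite exprS /x; field; rewrite !gt_eqF.
  rewrite ler_wpM2l ?divr_ge0 ?(ltW C10) // ler_wpM2l ?expR_ge0 //.
  rewrite [s ^+ j]exprMn mulrC ler_wpM2l ?exprn_ge0 //.
  by apply: le_trans (xexpN_le _) (ratio_pow_ge _).
have h1 : evol (g.1 + h.1, (g.2 + h.2).+1) t * a
   <= evol g t * (expR ((rho - C1 * t) * a) * t ^+ j.+1 * a).
  rewrite /evol /= -addnS exprD.
  have -> : expR ((rho - C1 * t) * freq_norm g.1) * t ^+ g.2 *
      (expR ((rho - C1 * t) * a) * t ^+ j.+1 * a)
    = expR ((rho - C1 * t) * freq_norm g.1 + (rho - C1 * t) * a) * (t ^+ g.2 * t ^+ j.+1) * a.
    by rewrite expRD; ring.
  rewrite !ler_wpM2r ?mulr_ge0 ?exprn_ge0 // -mulrDr ler_expR.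
  by rewrite ler_wpM2l ?freq_normD // radius_ge0.
have h2 : j.+1%:R / C1 * evol h s <= (g.2 + h.2).+1%:R / C1 * evol_weight h.
  apply: ler_pM; rewrite ?evol_ge0 ?divr_ge0 ?(ltW C10) ?(andP hs).1 //.
    by rewrite ler_wpM2r ?invr_ge0 ?(ltW C10) // ler_nat ltnS leq_addl.
  exact: evol_le_weight.
apply: le_trans h1 _.
apply: le_trans (ler_pM (evol_ge0 g t0) _ (evol_le_weight g ht) (le_trans key h2)) _.
  by rewrite !mulr_ge0 ?expR_ge0 ?exprn_ge0.
by rewrite le_eqVlt; apply/orP; left; apply/eqP; field; rewrite gt_eqF.
Qed.

Lemma evol_weight_diff2 (t : R) : `|t| < T -> exists2 K, 0 <= K &
  forall g, (1 + freq_norm g.1) ^+ 2 * `|t| ^+ g.2 <= K * evol_weight g.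
Proof.
move=> tT; pose de := rho - C1 * `|t|.
have de0 : 0 < de by rewrite subr_gt0 mulrC -ltr_pdivlMr.
exists ((1 + 2 / de) ^+ 2) => [|g]; first exact: sqr_ge0.
apply: le_trans (ler_wpM2l (sqr_ge0 _) (evol_le_weight g (t := `|t|) _)); last first.
  by rewrite normr_ge0 ltW.
rewrite /evol mulrA ler_wpM2r ?exprn_ge0 // -/de.
by apply: sqr_le_expR => //; apply: freq_norm_ge0.
Qed.

End Weight.

(** * Primitives in time *)

Section Derivatives.
Context {R : realType}.

(** A quadratic remainder, which is what termwise estimates give. *)
Lemma is_derive_quad (f : R -> R) (t d M e : R) : 0 < e ->
  (forall h, `|h| < e -> `|f (h + t) - f t - h * d| <= M * h ^+ 2) ->
  is_derive t (1 : R) f d.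
Proof.
move=> e0 hM.
have M0 : 0 < `|M| + 1 by rewrite ltr_wpDl.
suff h : h^-1 *: (f (h *: (1 : R) + t) - f t) @[h --> (0 : R)^'] --> d.
  by apply: DeriveDef; [apply: cvgP h|apply: cvg_lim].
apply/cvgrPdist_le => eps eps0; near=> h.
have h0 : h != 0 by near: h; exact: nbhs_dnbhs_neq.
have hn : 0 < `|h| by rewrite normr_gt0.
have he : `|h| < e by near: h; apply: dnbhs0_lt.
have hs : `|h| <= eps / (`|M| + 1) by near: h; apply: dnbhs0_le; rewrite divr_gt0.
rewrite [h *: 1]mulr1.
have -> : d - h^-1 *: (f (h + t) - f t) = - (h^-1 * (f (h + t) - f t - h * d)).
  by rewrite /GRing.scale /=; field.
rewrite normrN normrM normfV mulrC ler_pdivrMr //.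
apply: le_trans (hM h he) _; rewrite -(real_normK (num_real h)) expr2 mulrA.
rewrite ler_wpM2r //; apply: le_trans (_ : (`|M| + 1) * `|h| <= _).
  by rewrite ler_wpM2r //; apply: le_trans (ler_norm _) _; rewrite lerDl.
by rewrite mulrC -ler_pdivlMr.
Unshelve. all: by end_near. Qed.

Lemma mvt_bound (f df : R -> R) (a b M : R) : a <= b ->
  (forall x, a < x -> x < b -> is_derive x (1 : R) f (df x)) ->
  {within `[a, b], continuous f} ->
  (forall x, a < x -> x < b -> `|df x| <= M) -> `|f b - f a| <= M * (b - a).
Proof.
rewrite le_eqVlt => /predU1P[->|ab] hd cf hM; first by rewrite !subrr normr0 mulr0.
have [x|c] := @MVT R f df a b ab _ cf.
  by rewrite in_itv /= => /andP[]; apply: hd.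
rewrite in_itv /= => /andP[ac cb] ->; rewrite normrM.
by rewrite (gtr0_norm (_ : 0 < b - a)) ?subr_gt0 // ler_wpM2r ?subr_ge0 ?(ltW ab) ?hM.
Qed.

Lemma derive0_const (T : R) (f : R -> R) t :
  (forall s, `|s| < T -> is_derive s (1 : R) f 0) -> `|t| < T -> f t = f 0.
Proof.
move=> hd tT; have cf s : `|s| < T -> {for s, continuous f}.
  by move=> /hd hs; apply/differentiable_continuous/derivable1_diffP; case: hs.
have cw a b : (forall x, a <= x <= b -> `|x| < T) -> {within `[a, b], continuous f}.
  move=> h; apply: continuous_in_subspaceT => x; rewrite inE /= in_itv /= => /h.
  exact: cf.
apply/eqP; rewrite -subr_eq0 -normr_le0; have [t0|/ltW t0] := leP 0 t.
  have i x : 0 <= x <= t -> `|x| < T.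
    by move=> /andP[x0 xt]; rewrite ger0_norm // (le_lt_trans xt) // -(ger0_norm t0).
  have := mvt_bound (f := f) (df := fun=> 0) (M := 0) t0; rewrite mul0r; apply=> //.
  - by move=> x x0 xt; apply/hd/i; rewrite !ltW.
  - exact: cw.
  - by move=> x _ _; rewrite normr0.
have i x : t <= x <= 0 -> `|x| < T.
  move=> /andP[tx x0]; rewrite ler0_norm //; apply: le_lt_trans tT.
  by rewrite ler0_norm // lerN2.
rewrite distrC.
have := mvt_bound (f := f) (df := fun=> 0) (M := 0) t0; rewrite mul0r; apply=> //.
- by move=> x tx x0; apply/hd/i; rewrite !ltW.
- exact: cw.
- by move=> x _ _; rewrite normr0.
Qed.

(** In a smaller disc the quadratic remainders of the powers are summable. *)
Lemma termwise_derive (I : choiceType) (C : I -> R[i]) (k : I -> nat) (G : R -> R[i])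
    (g : R[i]) (T t K : R) : `|t| < T ->
  bsum (fun i => nc (C i) * T ^+ k i) K ->
  (forall s, `|s| < T ->
    hsum (fun i => C i * (s ^+ (k i).+1 / (k i).+1%:R)%:C%C) (G s)) ->
  hsum (fun i => C i * (t ^+ k i)%:C%C) g ->
  is_derive t (1 : R) (fun s => complex.Re (G s)) (complex.Re g).
Proof.
move=> tT hK hG hg; pose de := (T - `|t|) / 2; have de0 : 0 < de by rewrite divr_gt0 ?subr_gt0.
apply: (is_derive_quad (M := de^-1 * K) de0) => h hde.
pose tau := `|t| + de; have tauT : tau + de = T by rewrite /tau /de; field.
have s1 : `|h + t| <= tau by apply: le_trans (ler_normD _ _) _; rewrite addrC lerD2l ltW.
have t1 : `|t| <= tau by rewrite lerDl ltW.
have sT : `|h + t| < T by apply: le_lt_trans s1 _; rewrite -tauT ltrDl.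
have := hsumB (hsumB (hG _ sT) (hG _ tT)) (hsumZ h%:C%C hg).
move=> /hsum_norm hs; have {hs}: nc (G (h + t) - G t - h%:C%C * g) <= de^-1 * K * h ^+ 2.
  apply: hs; rewrite mulrAC; apply: le_bsum (bsumZ (_ : 0 <= de^-1 * h ^+ 2) hK); last first.
    by rewrite mulr_ge0 ?sqr_ge0 ?invr_ge0 ?(ltW de0).
  move=> i; set c := C i; set m := k i.
  have -> : c * ((h + t) ^+ m.+1 / m.+1%:R)%:C%C - c * (t ^+ m.+1 / m.+1%:R)%:C%C
    - h%:C%C * (c * (t ^+ m)%:C%C)
    = c * ((((h + t) ^+ m.+1 - t ^+ m.+1 - m.+1%:R * t ^+ m * (h + t - t)) / m.+1%:R)%:C%C).
    have -> : ((h + t) ^+ m.+1 - t ^+ m.+1 - m.+1%:R * t ^+ m * (h + t - t)) / m.+1%:R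
       = (h + t) ^+ m.+1 / m.+1%:R - t ^+ m.+1 / m.+1%:R - h * t ^+ m.
      by rewrite addrK; field; rewrite ?natr1 gt_eqF.
    by rewrite !rmorphB rmorphM /=; ring.
  rewrite ncM ncR mulrCA ler_wpM2l ?nc_ge0 //.
  have := pow_taylor m de0 s1 t1; rewrite tauT addrK => hp.
  rewrite normrM normfV normr_nat ler_pdivrMr ?ltr0n //.
  apply: le_trans hp _; rewrite real_normK ?num_real //.
  by rewrite le_eqVlt; apply/orP; left; apply/eqP; ring.
apply: le_trans; apply: le_trans (nc_Re _); rewrite le_eqVlt; apply/orP; left; apply/eqP.
by congr (`|_|); move: (G _) (G _) (g) => [a b] [a' b'] [a2 b2] /=; ring.
Qed.

End Derivatives.

Section Primitives.
Context {R : realType} {d : nat}.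
Notation mono := (@mono d).

(** What the integral equation asks of a weight: primitives in time are
    bounded by [T], and a derivative in [x] followed by a primitive in time is
    bounded by [ka]. *)
Record evolution (T ka : R) (w : mono -> R) : Prop := Evolution {
  evolution_weight : weight T w;
  evolution_term : forall g, w (g.1, g.2.+1) / g.2.+1%:R <= T * w g;
  evolution_deriv : forall g h,
    w (g.1 + h.1, (g.2 + h.2).+1) * freq_norm h.1 / (g.2 + h.2).+1%:R
      <= ka * (w g * w h);
  evolution_diff2 : forall t : R, `|t| < T -> exists2 K, 0 <= K &
    forall g, (1 + freq_norm g.1) ^+ 2 * `|t| ^+ g.2 <= K * w g }.

Definition primitive (T : R) (f F : 'rV[R]_d -> R -> R) : Prop :=
  forall x, F x 0 = 0 /\ forall t, `|t| < T -> is_derive t (1 : R) (F x) (f x t).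

(** The partial derivative of a scalar function, as the Jacobian of a function
    with one component. *)
Definition pd (j : 'I_d) (v : 'rV[R]_d -> R -> R) (x : 'rV[R]_d) (t : R) : R :=
  jacobian (fun y => \row_(_ < 1) v y t) x j 0.

Variables (T ka : R) (w : mono -> R).
Hypothesis hw : evolution T ka w.
Let wt := evolution_weight hw.
Let w0 g : 0 <= w g. Proof. exact: ltW (weight_gt0 wt g). Qed.
Notation W := (Wn T w).
Notation Prim := (primitive T).

Lemma primitive_add f g F G : Prim f F -> Prim g G ->
  Prim (fun x t => f x t + g x t) (fun x t => F x t + G x t).
Proof.
move=> hF hG x; have [F0 dF] := hF x; have [G0 dG] := hG x.
split=> [|t tT]; first by rewrite F0 G0 addr0.
by have := is_deriveD (dF t tT) (dG t tT).
Qed.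

Lemma primitive_sub f g F G : Prim f F -> Prim g G ->
  Prim (fun x t => f x t - g x t) (fun x t => F x t - G x t).
Proof.
move=> hF hG x; have [F0 dF] := hF x; have [G0 dG] := hG x.
split=> [|t tT]; first by rewrite F0 G0 subr0.
by have := is_deriveB (dF t tT) (dG t tT).
Qed.

Lemma primitive_sum (I : Type) (s : seq I) (f F : I -> 'rV[R]_d -> R -> R) :
  (forall i, Prim (f i) (F i)) ->
  Prim (fun x t => \sum_(i <- s) f i x t) (fun x t => \sum_(i <- s) F i x t).
Proof.
move=> h; elim: s => [|i s IH].
  move=> x; split=> [|t tT]; first by rewrite big_nil.
  rewrite big_nil (_ : (fun t => _) = cst 0); first exact: is_derive_cst.
  by apply/funext => s; rewrite big_nil.
have := primitive_add (h i) IH.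
rewrite (_ : (fun x t => \sum_(k <- i :: s) f k x t)
    = (fun x t => f i x t + \sum_(k <- s) f k x t)); last first.
  by apply/funext => x; apply/funext => t; rewrite big_cons.
rewrite (_ : (fun x t => \sum_(k <- i :: s) F k x t)
    = (fun x t => F i x t + \sum_(k <- s) F k x t)) //.
by apply/funext => x; apply/funext => t; rewrite big_cons.
Qed.

Lemma primitive_ext f g F : (forall x t, `|t| < T -> f x t = g x t) ->
  Prim f F -> Prim g F.
Proof.
move=> e hF x; have [F0 dF] := hF x; split=> // t tT; rewrite -e //; exact: dF.
Qed.

Lemma primitive_uniq f F G x t : Prim f F -> Prim f G -> `|t| < T -> F x t = G x t.
Proof.
move=> hF hG tT; have [h0 hd] := primitive_sub hF hG x.
apply/eqP; rewrite -subr_eq0; apply/eqP; rewrite -[RHS]h0.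
apply: (derive0_const (f := fun s => F x s - G x s) _ tT) => s sT.
by have := hd s sT; rewrite subrr.
Qed.

(** The termwise primitive has a real sum because the derivative of its imaginary
    part is the imaginary part of [f x t], and it vanishes at [t = 0]. *)
Lemma primitive_rep (I : choiceType) (C : I -> R[i]) (g : I -> mono) f K :
  bsum (fun i => nc (C i) * (w ((g i).1, (g i).2.+1) / (g i).2.+1%:R)) K ->
  (forall t, 0 <= t < T -> exists L, bsum (fun i => nc (C i) * t ^+ (g i).2) L) ->
  (forall x t, `|t| < T -> hsum (fun i => C i * chi (g i) x t) (f x t)%:C%C) ->
  exists2 F, Prim f F & W F K.
Proof.
move=> hK hL hf.
pose a (x : 'rV[R]_d) i := C i * expi (freq_dot (g i).1 x).
pose P (x : 'rV[R]_d) (s : R) i := a x i * (s ^+ (g i).2.+1 / (g i).2.+1%:R)%:C%C.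
have na x i : nc (a x i) = nc (C i) by rewrite ncM nc_expi mulr1.
have hb x s : `|s| < T -> bsum (fun i => nc (P x s i)) K.
  move=> sT; apply: le_bsum hK => i; rewrite ncM na ncR ler_wpM2l ?nc_ge0 //.
  rewrite normrM normrX normfV normr_nat ler_wpM2r ?invr_ge0 //.
  exact: (weight_adm wt sT ((g i).1, (g i).2.+1)).
have [[x s]|G hG] := @choice _ _ (fun (xs : 'rV[R]_d * R) z => `|xs.2| < T -> hsum (P xs.1 xs.2) z).
  have [sT|] := boolP (`|s| < T); last by exists 0.
  by have [z hz] := hsum_ex (hb x s sT); exists z.
have Gd k x t : `|t| < T -> is_derive t (1 : R) (fun s => complex.Re (k * G (x, s)))
    (complex.Re (k * (f x t)%:C%C)).
  move=> tT; have [tau t1 t2] : exists2 tau, `|t| < tau & tau < T.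
    by exists ((`|t| + T) / 2); rewrite ?midf_lt.
  have tau0 : 0 <= tau by apply: le_trans (ltW t1).
  have [|L hLt] := hL tau; first by rewrite tau0.
  apply: (termwise_derive (C := fun i => k * a x i) (k := fun i => (g i).2) (T := tau) (K := nc k * L)) => //.
  - by apply: le_bsum (bsumZ (nc_ge0 k) hLt) => i; rewrite ncM na mulrA.
  - move=> s st; have sT := lt_trans st t2.
    by apply: eq_hsum (hsumZ k (hG (x, s) sT)) => i; rewrite /P /= mulrA.
  - by apply: eq_hsum (hsumZ k (hf x t tT)) => i; rewrite /a /chi !mulrA.
have G0 x : 0 < T -> G (x, 0) = 0.
  move=> T0; have := hG (x, 0) (_ : `|0| < T) => /=; rewrite normr0 => /(_ T0).
  move/hsum_uniq; apply; apply: eq_hsum (hsum0 (I := I)) => i.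
  by rewrite /P exprS mul0r mul0r mulr0.
pose F x t := if T <= 0 then 0 else complex.Re (G (x, t)).
have GE x t : `|t| < T -> G (x, t) = (F x t)%:C%C.
  move=> tT; have T0 : 0 < T by apply: le_lt_trans tT.
  have : complex.Re (- 'i%C * G (x, t)) = 0.
    have e0 : complex.Re (- 'i%C * G (x, 0)) = 0 by rewrite G0 // mulr0.
    rewrite -[RHS]e0.
    apply: (derive0_const (f := fun s => complex.Re (- 'i%C * G (x, s))) _ tT) => s sT.
    have := Gd (- 'i%C) x s sT.
    suff -> : complex.Re (- 'i%C * (f x s)%:C%C) = 0 by [].
    by rewrite /=; ring.
  rewrite /F leNgt T0 /=; case: (G (x, t)) => u v /= h.
  by have -> : v = 0 by move: h => <-; ring.
exists F => [x|].
  have [T0|T0] := ltP 0 T; last first.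
    split=> [|t tT]; first by rewrite /F T0.
    by move: (le_lt_trans (normr_ge0 t) tT); rewrite ltNge T0.
  rewrite /F leNgt T0 /=; split; first by rewrite G0.
  move=> t tT; have := Gd 1 x t tT; rewrite mul1r /=.
  by rewrite (_ : (fun s => complex.Re (1 * G (x, s))) = (fun s => complex.Re (G (x, s)))) //;
     apply/funext => s; rewrite mul1r.
apply: (W_rep wt (C := fun i => C i * ((g i).2.+1%:R^-1)%:C%C)
  (g := fun i => ((g i).1, (g i).2.+1))).
  apply: le_bsum hK => i; rewrite ncM ncR -mulrA ler_wpM2l ?nc_ge0 //.
  by rewrite ger0_norm ?invr_ge0 // mulrC.
move=> x t tT; rewrite -GE //; apply: eq_hsum (hG (x, t) tT) => i.
by rewrite /P /a /chi /= rmorphM /=; ring.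
Qed.

End Primitives.

Section Integration.
Context {R : realType} {d : nat}.
Notation mono := (@mono d).
Variables (T ka : R) (w : mono -> R).
Hypothesis (T0 : 0 < T) (hw : evolution T ka w).
Let wt := evolution_weight hw.
Let w0 g : 0 <= w g. Proof. exact: ltW (weight_gt0 wt g). Qed.
Notation W := (Wn T w).
Notation Prim := (primitive T).

Definition represents (c : mono -> R[i]) (v : 'rV[R]_d -> R -> R) : Prop :=
  (exists K, bsum (fun g => nc (c g) * w g) K) /\
  forall x t, `|t| < T -> hsum (fun g => c g * chi g x t) (v x t)%:C%C.

(** The coefficients of the [j]-th partial derivative. *)
Definition diff_coef (j : 'I_d) (c : mono -> R[i]) (g : mono) : R[i] :=
  'i%C * ((g.1 0 j)%:~R)%:C%C * c g.

Lemma nc_diff_coef j c g : nc (diff_coef j c g) <= nc (c g) * freq_norm g.1.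
Proof.
rewrite /diff_coef !ncM ncR mulrC ler_wpM2l ?nc_ge0 //.
have -> : nc ('i%C : R[i]) = 1 by rewrite /= expr0n /= add0r expr1n sqrtr1.
by rewrite mul1r; apply: freq_norm_coord.
Qed.

Lemma diff2_bsum c K (t : R) : bsum (fun g => nc (c g) * w g) K -> `|t| < T ->
  exists L, bsum (fun g => nc (c g) * ((1 + freq_norm g.1) ^+ 2 * `|t| ^+ g.2)) L.
Proof.
move=> hK tT; have [Q Q0 hQ] := evolution_diff2 hw tT; exists (Q * K).
apply: le_bsum (bsumZ Q0 hK) => g; rewrite [leRHS]mulrCA ler_wpM2l ?nc_ge0 //.
Qed.

Section Rows.
Variables (m : nat) (c : 'I_m -> mono -> R[i]) (u : 'I_m -> 'rV[R]_d -> R -> R).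
Hypothesis hc : forall l, represents (c l) (u l).

Lemma jacobian_row x t j l : `|t| < T ->
  hsum (fun g => diff_coef j (c l) g * chi g x t)
    (jacobian (fun y => \row_l u l y t) x j l)%:C%C.
Proof.
move=> tT; have [K hK] : exists K, forall l,
    bsum (fun g => nc (c l g * (t ^+ g.2)%:C%C) * (1 + freq_norm g.1) ^+ 2) K.
  have [l'|K hK] := @choice _ _ (fun l' K =>
    bsum (fun g => nc (c l' g) * ((1 + freq_norm g.1) ^+ 2 * `|t| ^+ g.2)) K).
    by have [[K hK] _] := hc l'; apply: diff2_bsum hK tT.
  have p0 l' g : 0 <= nc (c l' g) * ((1 + freq_norm g.1) ^+ 2 * `|t| ^+ g.2).
    by rewrite mulr_ge0 ?nc_ge0 // mulr_ge0 ?sqr_ge0 ?exprn_ge0.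
  exists (\sum_l' K l') => l'; apply: (bsum_le (K := K l')); last first.
    by rewrite (bigD1 l') //= lerDl sumr_ge0 // => i _; apply: bsum_ge0 (hK i).
  by apply: le_bsum (hK l') => g; rewrite ncM ncR normrX mulrAC [leRHS]mulrA.
have hu x' l' : hsum (fun g => c l' g * (t ^+ g.2)%:C%C * expi (freq_dot g.1 x'))
    ((\row_l u l x' t) 0 l')%:C%C.
  have [_ h] := hc l'; rewrite mxE; apply: eq_hsum (h x' t tT) => g.
  by rewrite /chi mulrA mulrAC.
have [_ h] := jacobian_rep hK hu x.
by apply: eq_hsum (h l j) => g; rewrite /diff_coef /chi; ring.
Qed.

End Rows.

Lemma pd_rep c v x t j : represents c v -> `|t| < T ->
  hsum (fun g => diff_coef j c g * chi g x t) (pd j v x t)%:C%C.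
Proof. by move=> hc; apply: (jacobian_row (m := 1) (fun=> hc)). Qed.

Lemma W_represents v K : W v K -> exists c, represents c v.
Proof. by move=> [c [h1 h2]]; exists c; split=> //; exists K. Qed.

Lemma jacobian_pd m (u : 'I_m -> 'rV[R]_d -> R -> R) (K : 'I_m -> R) x t j l :
  (forall l, W (u l) (K l)) -> `|t| < T ->
  jacobian (fun y => \row_l u l y t) x j l = pd j (u l) x t.
Proof.
move=> hu tT; have [c hc] := choice (fun l => W_represents (hu l)).
by have := hsum_uniq (jacobian_row hc x j l tT) (pd_rep x j (hc l) tT) => -[].
Qed.

Lemma pd_sub u v K L x t j : W u K -> W v L -> `|t| < T ->
  pd j (fun x t => u x t - v x t) x t = pd j u x t - pd j v x t.
Proof.
move=> /W_represents[c hc] /W_represents[e he] tT.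
have hce : represents (fun g => c g - e g) (fun x t => u x t - v x t).
  have [[Kc hK] h1] := hc; have [[Ke hL] h2] := he; split.
    exists (Kc + Ke); apply: le_bsum (bsumD hK hL) => g.
    by rewrite -mulrDl ler_wpM2r // (le_trans (ncD _ _)) // ncN.
  move=> x' s sT; rewrite rmorphB; apply: eq_hsum (hsumB (h1 x' s sT) (h2 x' s sT)) => g.
  by rewrite mulrBl.
have := hsumB (pd_rep x j hc tT) (pd_rep x j he tT); rewrite -rmorphB.
move=> /(eq_hsum (b := fun g => diff_coef j (fun g => c g - e g) g * chi g x t)) h.
have /h : forall g, diff_coef j c g * chi g x t - diff_coef j e g * chi g x t
  = diff_coef j (fun g => c g - e g) g * chi g x t.
  by move=> g; rewrite /diff_coef; ring.
by move=> /(hsum_uniq (pd_rep x j hce tT)) [].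
Qed.

Lemma primitive_term f K : W f K -> exists2 F, Prim f F & W F (T * K).
Proof.
move=> [c [h1 h2]]; apply: (primitive_rep hw (C := c) (g := id)) h2.
  apply: le_bsum (bsumZ (ltW T0) h1) => g.
  by rewrite [leRHS]mulrCA ler_wpM2l ?nc_ge0 // (evolution_term hw).
move=> t /andP[t0 tT]; exists K; apply: le_bsum h1 => g; rewrite ler_wpM2l ?nc_ge0 //.
by have := weight_adm wt (t := t) _ g; rewrite ger0_norm //; apply.
Qed.

(** The equation has no loss of derivatives in these algebras: the primitive in
    time recovers the derivative in space. *)
Lemma primitive_prod j f v K L : W f K -> W v L ->
  exists2 F, Prim (fun x t => f x t * pd j v x t) F & W F (ka * (K * L)).
Proof.
move=> [c [c1 c2]] [e [e1 e2]].
have he : represents e v by split=> //; exists L.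
have n0 (g : mono) : 0 <= freq_norm (R := R) g.1 by apply: freq_norm_ge0.
have hb0 : bsum (fun p => nc (c p.1) * w p.1 * (nc (e p.2) * w p.2)) (K * L).
  by apply: (bsum_prod _ _ c1 e1) => g; rewrite mulr_ge0 ?nc_ge0.
have hct x t : `|t| < T -> bsum (fun g => nc (c g * chi g x t)) K.
  move=> tT; apply: le_bsum c1 => g; rewrite ncM nc_chi ler_wpM2l ?nc_ge0 //.
  exact: weight_adm wt _ tT _.
have het x t : `|t| < T -> exists L', bsum (fun g => nc (diff_coef j e g * chi g x t)) L'.
  move=> tT; have [L' hL'] := diff2_bsum e1 tT; exists L'.
  apply: le_bsum hL' => g; rewrite ncM nc_chi mulrA ler_wpM2r ?exprn_ge0 //.
  apply: le_trans (nc_diff_coef _ _ _) _; rewrite ler_wpM2l ?nc_ge0 //.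
  by have := n0 g; move: (freq_norm _) => a; nra.
apply: (primitive_rep hw (C := fun p => c p.1 * diff_coef j e p.2)
  (g := fun p : mono * mono => madd p.1 p.2)).
- have k0 : 0 <= ka.
    have g := (0 : 'rV[int]_d, 0%N).
    have := evolution_deriv hw g g; have := weight_gt0 wt g => wg.
    move=> h; have : 0 <= ka * (w g * w g).
      by apply: le_trans h; rewrite !mulr_ge0 ?invr_ge0.
    by rewrite pmulr_lge0 // mulr_gt0.
  apply: le_bsum (bsumZ k0 hb0) => -[g h] /=.
  rewrite ncM.
  have -> : ka * (nc (c g) * w g * (nc (e h) * w h))
     = nc (c g) * nc (e h) * (ka * (w g * w h)) by ring.
  apply: le_trans (_ : nc (c g) * (nc (e h) * freq_norm h.1) *
     (w (g.1 + h.1, (g.2 + h.2).+1) / (g.2 + h.2).+1%:R) <= _).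
    rewrite ler_wpM2r ?mulr_ge0 ?invr_ge0 // ler_wpM2l ?nc_ge0 //.
    exact: nc_diff_coef.
  have := ler_wpM2l (mulr_ge0 (nc_ge0 (c g)) (nc_ge0 (e h))) (evolution_deriv hw g h).
  apply: le_trans; rewrite le_eqVlt; apply/orP; left; apply/eqP.
  by move: (w _) (freq_norm _) (_.+1%:R) => X Y Z; ring.
- move=> t /andP[t0 tT]; have tT' : `|t| < T by rewrite ger0_norm.
  have [L' hL'] := het 0 t tT'; exists (K * L').
  apply: le_bsum (bsum_prod _ _ (hct 0 t tT') hL') => [[g h]||] /=; try by move=> *; apply: nc_ge0.
  by rewrite (ncM (c g) (chi _ _ _)) (ncM (diff_coef j e h) (chi _ _ _)) (ncM (c g)) !nc_chi (ger0_norm t0) exprD le_eqVlt; apply/orP; left; apply/eqP; ring.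
move=> x t tT; have [L' hL'] := het x t tT; rewrite rmorphM.
apply: eq_hsum (hsum_prod (hct x t tT) hL' (c2 x t tT) (pd_rep x j he tT)) => -[g h] /=.
by rewrite chi_add; ring.
Qed.

End Integration.

(** * Contraction *)

Section Halving.
Context {R : realType}.

Lemma bsum_nat (p : nat -> R) K : (forall k, 0 <= p k) ->
  (forall N, \sum_(k < N) p k <= K) -> bsum p K.
Proof.
move=> p0 hK J; pose N := (\max_(k <- J) k).+1; apply: le_trans (hK N).
have -> : \sum_(i <- J) p i = \sum_(i <- iota 0 N | i \in J) p i.
  rewrite -[RHS]big_filter; apply: perm_big; apply: uniq_perm => //.
    by rewrite filter_uniq // iota_uniq.
  move=> i; rewrite mem_filter mem_iota leq0n add0n ltnS /=.
  by case iJ : (i \in J) => //=; apply/esym/leq_bigmax_seq.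
rewrite -(big_mkord xpredT p) /index_iota subn0 big_mkcond.
by apply: ler_sum => i _; case: ifP.
Qed.

Lemma hsum_prefix (a : nat -> R[i]) p :
  hsum (fun k => if (k < p)%N then a k else 0) (\sum_(k < p) a k).
Proof.
elim: p => [|p IH]; first by rewrite big_ord0; apply: eq_hsum (hsum0 (I := nat)).
rewrite big_ord_recr /=.
have h1 : hsum (fun k => if k == p then a p else 0) (a p).
  have := @hsum_fin R nat (fun k => if k == p then a p else 0) [fset p]%fset.
  rewrite big_seq_fset1 eqxx; apply=> k; rewrite inE => /negPf -> //.
apply: eq_hsum (hsumD IH h1) => k; rewrite ltnS.
by have [kp|kp|->] := ltngtP k p; rewrite ?addr0 ?add0r.
Qed.

Lemma le_pow2_eq0 (x K : R) : (forall p, `|x| <= K / 2 ^+ p) -> x = 0.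
Proof.
move=> h; apply/eqP; rewrite -normr_le0; apply: contraT; rewrite -ltNge => x0.
pose p := (Num.truncn (K / `|x|)).+1.
have /(lt_le_trans) : K / `|x| < p%:R by apply: truncnS_gt.
move=> /(_ (2 ^+ p)) /(_ _)/wrap[].
  by rewrite -natrX ler_nat ltnW // ltn_expl.
rewrite ltr_pdivrMr // => hK; have := h p.
by rewrite ler_pdivlMr ?exprn_gt0 // leNgt mulrC hK.
Qed.

End Halving.

Section Contraction.
Context {R : realType} {d n : nat}.
Variables (A : 'rV[R]_n -> 'M[R]_(d, n) -> 'rV[R]_n).
Hypothesis affine : forall a p l, A a p 0 l = zeroth_order A l a + \sum_j \sum_m p j m * gradient_coef A l j m a.
Variables (T ka : R) (w : @mono d -> R).
Hypotheses (T0 : 0 < T) (hw : evolution T ka w).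
Let wt := evolution_weight hw.
Notation W := (Wn T w).
Notation Prim := (primitive T).
Implicit Types (u v U V : 'I_n -> 'rV[R]_d -> R -> R).

(** The right-hand side of the equation, componentwise and with the gradient of
    the components, the form in which the algebra estimates apply to it. *)
Definition rhs (l : 'I_n) u (x : 'rV[R]_d) (t : R) : R :=
  zeroth_order A l (\row_l u l x t)
  + \sum_(jm : 'I_d * 'I_n) gradient_coef A l jm.1 jm.2 (\row_l u l x t) * pd jm.1 (u jm.2) x t.

Lemma rhs_apply_grad u (K : 'I_n -> R) l x t : (forall l, W (u l) (K l)) -> `|t| < T ->
  rhs l u x t = apply_grad A (fun y => \row_l u l y t) x 0 l.
Proof.
move=> hu tT; rewrite /apply_grad affine /rhs pair_big /=; congr (_ + _).
by apply: eq_bigr => -[j m] _ /=; rewrite (jacobian_pd hw x j m hu tT) mulrC.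
Qed.

Variables (B K0 : R) (u0 : 'I_n -> 'rV[R]_d -> R).
Let r := 2 * (K0 + 1).
Hypotheses (K00 : 0 <= K0) (B0 : 0 <= B) (ka0 : 0 <= ka).
Hypothesis u0K : forall l, W (fun x _ => u0 l x) K0.
Hypothesis zeroth_orderB : forall l, @operates R d n r B (zeroth_order A l).
Hypothesis gradient_coefB : forall l j m, @operates R d n r B (gradient_coef A l j m).
Hypothesis small : 2 * (T * B + (d * n)%:R * (ka * (B * (r + 1)))) <= 1.

Let r0 : 0 <= r. Proof. by rewrite mulr_ge0 ?addr_ge0. Qed.

Definition ball u := forall l, W (u l) r.

Definition iterate u U := forall l, Prim (rhs l u) (fun x t => U l x t - u0 l x).

(** The difference of two products [b d_j u] is [(b - b') d_j u + b' d_j (u - u')]. *)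
Lemma rhs_primitive u v de l : ball u -> ball v ->
  (forall l, W (fun x t => u l x t - v l x t) de) ->
  exists2 G, Prim (fun x t => rhs l u x t - rhs l v x t) G & W G (de / 2).
Proof.
move=> hu hv hd; have de0 := W_ge0 (hd l).
have [_ h0] := zeroth_orderB l wt hu hv hd.
have [G0 P0 W0] := primitive_term T0 hw h0.
have [jm|G1 h1] := @choice _ _ (fun (jm : 'I_d * 'I_n) G =>
    Prim (fun x t => (gradient_coef A l jm.1 jm.2 (\row_l u l x t) - gradient_coef A l jm.1 jm.2 (\row_l v l x t))
       * pd jm.1 (u jm.2) x t) G /\ W G (ka * (B * de * r))).
  have [_ h] := gradient_coefB l jm.1 jm.2 wt hu hv hd.
  by have [G ? ?] := primitive_prod hw jm.1 h (hu jm.2); exists G.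
have [jm|G2 h2] := @choice _ _ (fun (jm : 'I_d * 'I_n) G =>
    Prim (fun x t => gradient_coef A l jm.1 jm.2 (\row_l v l x t)
       * pd jm.1 (fun x t => u jm.2 x t - v jm.2 x t) x t) G /\ W G (ka * (B * de))).
  have hd' l' : W (fun x t => v l' x t - u l' x t) de.
    have := W_scale (-1) (hd l'); rewrite normrN1 mul1r; apply: W_ext => x t _; ring.
  have [h _] := gradient_coefB l jm.1 jm.2 wt hv hu hd'.
  by have [G ? ?] := primitive_prod hw jm.1 h (hd jm.2); exists G.
exists (fun x t => G0 x t + \sum_jm (G1 jm x t + G2 jm x t)).
  apply: primitive_ext (primitive_add P0 (primitive_sum (index_enum _)
    (fun jm => primitive_add (proj1 (h1 jm)) (proj1 (h2 jm))))) => x t tT.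
  rewrite /rhs opprD addrACA -sumrB; congr (_ + _); apply: eq_bigr => jm _.
  by rewrite (pd_sub hw x jm.1 (hu jm.2) (hv jm.2) tT) mulrBl mulrBr addrA subrK.
apply: W_le (W_add wt W0 (W_finsum wt (fun jm => W_add wt (proj2 (h1 jm)) (proj2 (h2 jm))))) _.
rewrite sumr_const card_prod !card_ord -[X in _ + X <= _]mulr_natl.
have hs := small; set dn := (d * n)%:R in hs *.
have -> : T * (B * de) + dn * (ka * (B * de * r) + ka * (B * de))
   = de * (T * B + dn * (ka * (B * (r + 1)))) by ring.
by rewrite ler_wpM2l // -[leRHS]div1r ler_pdivlMr // mulrC.
Qed.

Lemma iterate_contracts u v U V de : ball u -> ball v ->
  (forall l, W (fun x t => u l x t - v l x t) de) -> iterate u U -> iterate v V ->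
  forall l, W (fun x t => U l x t - V l x t) (de / 2).
Proof.
move=> hu hv hd hU hV l; have [G hG WG] := rhs_primitive l hu hv hd.
apply: W_ext WG => x t tT; rewrite (primitive_uniq x hG (primitive_sub (hU l) (hV l)) tT).
by rewrite opprB addrA subrK.
Qed.

Lemma iterate_ex u : ball u -> exists2 U, iterate u U & forall l, W (U l) (K0 + 1).
Proof.
move=> hu.
suff h l : exists2 F, Prim (rhs l u) F & W F 1.
  have [l|F hF] := @choice _ _ (fun l F => Prim (rhs l u) F /\ W F 1).
    by have [F ? ?] := h l; exists F.
  exists (fun l x t => F l x t + u0 l x) => l.
    have [h1 _] := hF l; rewrite (_ : (fun x t => _) = F l) //.
    by apply/funext => x; apply/funext => t; rewrite addrK.
  by rewrite (addrC K0); apply: (W_add wt (proj2 (hF l)) (u0K l)).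
have hd l' : W (fun x t => u l' x t - u l' x t) 0.
  by apply: W_ext (W_cst0 wt) => x t _; rewrite subrr.
have [h0 _] := zeroth_orderB l wt hu hu hd.
have [G0 P0 W0] := primitive_term T0 hw h0.
have [jm|G1 h1] := @choice _ _ (fun (jm : 'I_d * 'I_n) G =>
    Prim (fun x t => gradient_coef A l jm.1 jm.2 (\row_l u l x t) * pd jm.1 (u jm.2) x t) G
    /\ W G (ka * (B * r))).
  have [h _] := gradient_coefB l jm.1 jm.2 wt hu hu hd.
  by have [G ? ?] := primitive_prod hw jm.1 h (hu jm.2); exists G.
exists (fun x t => G0 x t + \sum_jm G1 jm x t).
  exact: primitive_add P0 (primitive_sum (index_enum _) (fun jm => proj1 (h1 jm))).
apply: W_le (W_add wt W0 (W_finsum wt (fun jm => proj2 (h1 jm)))) _.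
rewrite sumr_const card_prod !card_ord -[X in _ + X <= _]mulr_natl.
have dn0 : 0 <= (d * n)%:R * (ka * B) by rewrite !mulr_ge0.
have TB : 0 <= T * B by rewrite mulr_ge0 // ltW.
have := small; move: ((d * n)%:R) dn0 (T * B) TB => dn dn0 tb tb0 hs.
have -> : dn * (ka * (B * r)) = dn * (ka * B) * r by ring.
move: hs; have -> : dn * (ka * (B * (r + 1))) = dn * (ka * B) * r + dn * (ka * B) by ring.
have := mulr_ge0 dn0 r0; move: (dn * _ * r) => z; lra.
Qed.

(** The differences of successive iterates decay like [2 ^ - k], so that their sum
    exists in the algebra; an iterate of the sum has the same values, and is the
    solution. *)
Theorem picard : exists2 u, ball u & iterate u u.
Proof.
have [u|phi hphi] := @choice _ _ (fun u U => ball u -> iterate u U /\ forall l, W (U l) (K0 + 1)).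
  have [hu|] := pselect (ball u); last by exists u.
  by have [U ? ?] := iterate_ex hu; exists U.
have K1r : K0 + 1 <= r by rewrite /r mulr_natl mulr2n lerDl addr_ge0.
pose us := fix us (k : nat) := if k is k'.+1 then phi (us k') else fun _ _ _ => 0.
have bus k : ball (us k).
  elim: k => [|k IH] l; first exact: W_le (W_cst0 wt) r0.
  by have [_ h] := hphi _ IH; apply: W_le (h l) K1r.
have itus k : iterate (us k) (us k.+1) by have [] := hphi _ (bus k).
pose D k := (K0 + 1) / 2 ^+ k.
have D0 k : 0 <= D k by rewrite divr_ge0 ?addr_ge0 ?exprn_ge0.
have hD k l : W (fun x t => us k.+1 l x t - us k l x t) (D k).
  elim: k l => [|k IH] l.
    have [_ h] := hphi _ (bus 0); rewrite /D expr0 divr1.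
    by apply: W_ext (h l) => x t _; rewrite /= subr0.
  have := iterate_contracts (bus k.+1) (bus k) IH (itus k.+1) (itus k) l.
  by rewrite /D exprSr invfM mulrA.
have DS k : D k = 2 * D k.+1 by rewrite /D exprS; field; rewrite expf_neq0.
(* the differences from the p-th on *)
pose K p k := if (k < p)%N then 0 else D k.
have geo p : bsum (K p) (2 * D p).
  apply: bsum_nat => [k|N]; first by rewrite /K; case: ifP.
  suff : \sum_(k < N) K p k <= 2 * D p - 2 * D (maxn p N).
    by move=> h; apply: le_trans h _; rewrite lerBlDr lerDl mulr_ge0.
  elim: N => [|N IH]; first by rewrite big_ord0 maxn0 subrr.
  rewrite big_ord_recr /=; apply: le_trans (lerD IH (lexx _)) _.
  rewrite /K; case: (ltnP N p) => Np.
    by rewrite addr0 (maxn_idPl Np) ?(maxn_idPl (ltnW Np)).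
  by rewrite ?(maxn_idPr Np) (maxn_idPr (leqW Np)) -DS; have := DS N; lra.
have [[[l x] t]|g hg] := @choice _ _ (fun (lxt : 'I_n * 'rV[R]_d * R) s =>
   let: (l, x, t) := lxt in `|t| < T ->
   hsum (fun k => (us k.+1 l x t - us k l x t)%:C%C) s%:C%C).
  have [tT|] := boolP (`|t| < T); last by exists 0.
  have [|s hs] := @hsum_real R nat (fun k => us k.+1 l x t - us k l x t) (2 * D 0%N).
    by apply: le_bsum (geo 0%N) => k; apply: W_bound (hD k l) tT.
  by exists s.
pose u l x t := g (l, x, t).
have hu p l : W (fun x t => u l x t - us p l x t) (2 * D p).
  apply: (W_sum wt (f := fun k x t => if (k < p)%N then 0 else us k.+1 l x t - us k l x t) _ (geo p)).
    by move=> k; rewrite /K; case: ifP => _; [apply: W_cst0 wt|apply: hD].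
  move=> x t tT; rewrite rmorphB.
  have := hsumB (hg (l, x, t) tT) (hsum_prefix (fun k => (us k.+1 l x t - us k l x t)%:C%C) p).
  have -> : \sum_(k < p) (us k.+1 l x t - us k l x t)%:C%C = (us p l x t)%:C%C.
    rewrite -(big_mkord xpredT (fun k => (us k.+1 l x t - us k l x t)%:C%C)).
    rewrite (eq_bigr (fun k => (us k.+1 l x t)%:C%C - (us k l x t)%:C%C)).
      by rewrite telescope_sumr //= subr0.
    by move=> k _; rewrite rmorphB.
  by apply: eq_hsum => k; case: ifP => _; rewrite ?subr0 ?subrr.
have bu : ball u.
  move=> l; have := hu 0%N l; rewrite /D expr0 divr1; apply: W_ext => x t _.
  by rewrite /= subr0.
have [U itU WU] := iterate_ex bu.
have bU : ball U by move=> l; apply: W_le (WU l) K1r.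
have uU l x t : `|t| < T -> u l x t = U l x t.
  move=> tT; apply/eqP; rewrite -subr_eq0; apply/eqP.
  apply: (le_pow2_eq0 (K := r)) => p.
  have h1 := iterate_contracts (bus p) bu _ (itus p) itU l.
  have h := W_add wt (hu p.+1 l) (W_scale 1 (h1 (2 * D p) _)).
  have : W (fun x t => u l x t - U l x t) (2 * D p.+1 + `|1| * (2 * D p / 2)).
    apply: W_ext (h _) => [y s _|l'].
      by move: (u l y s) (us p.+1 l y s) (U l y s) => a b c; rewrite mul1r addrA subrK.
    by have := W_scale (-1) (hu p l'); rewrite normrN1 mul1r; apply: W_ext => y s _; rewrite mulN1r opprB.
  move=> h'; apply: le_trans (W_bound wt x h' tT) _.
  by rewrite normr1 mul1r -(DS p) /D /r le_eqVlt; apply/orP; left; apply/eqP; field; rewrite expf_neq0.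
exists U; first exact: bU.
move=> l; apply: (primitive_ext (f := rhs l u)) (itU l) => x t tT.
apply: etrans (rhs_apply_grad (K := fun=> r) l x bu tT) _.
apply: etrans (esym (rhs_apply_grad (K := fun=> r) l x bU tT)).
have -> // : (fun y => \row_l u l y t) = (fun y => \row_l U l y t).
by apply/funext => y; apply/rowP => m; rewrite !mxE; apply: uU.
Qed.

End Contraction.

(** * Existence *)

Section Existence.
Context {R : realType} {d n : nat}.

(** There are finitely many functions of [u] in the equation; a common bound for
    their action on a ball exists for every radius. *)
Lemma nonlinearity_operates (A : 'rV[R]_n -> 'M[R]_(d, n) -> 'rV[R]_n) (C0 : R) (F : R -> R)
    (r : R) (j0 : 'I_d) :
  (forall y : R, 0 <= y -> analytic_at F y) -> Gen_bound A C0 F -> 0 <= r ->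
  exists2 B, 0 <= B & (forall l, @operates R d n r B (zeroth_order A l)) /\
    forall l j m, @operates R d n r B (gradient_coef A l j m).
Proof.
move=> hF hA r0; have rS : r < r + 1 by rewrite ltrDl.
have S1 : 1 <= r + 1 by rewrite lerDr.
have S0 : 0 < r + 1 by apply: lt_le_trans S1.
have q0 : 0 < 10^-1 :> R by rewrite invr_gt0.
have q1 : 10^-1 < 1 :> R by rewrite invf_lt1 // ltr1n.
have n0 (l : 'I_n) : (0 < n)%N by apply: leq_ltn_trans (ltn_ord l).
have [l|Bz hz] := @choice _ _ (fun l B => 0 <= B /\ @operates R d n r B (zeroth_order A l)).
  have [B B0 hB] := expandable_operates (d := d) rS S1 (n0 l)
    (zeroth_order_expandable hF hA j0 l S0 q0 q1).
  by exists B.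
have [[[l j] m]|Bf hf] := @choice _ _ (fun (ljm : 'I_n * 'I_d * 'I_n) B =>
    0 <= B /\ @operates R d n r B (gradient_coef A ljm.1.1 ljm.1.2 ljm.2)).
  have [B B0 hB] := expandable_operates (d := d) rS S1 (n0 l)
    (gradient_coef_expandable hF hA j l S0 q0 q1 m).
  by exists B.
have sz : 0 <= \sum_l Bz l by apply: sumr_ge0 => l _; case: (hz l).
have sf : 0 <= \sum_x Bf x by apply: sumr_ge0 => x _; case: (hf x).
exists (\sum_l Bz l + \sum_x Bf x); first exact: addr_ge0.
split=> [l|l j m].
  apply: (Op_le (n0 l) (proj2 (hz l))); rewrite (bigD1 l) //= -addrA lerDl addr_ge0 //.
  by apply: sumr_ge0 => l' _; case: (hz l').
apply: (Op_le (n0 l) (proj2 (hf (l, j, m)))); rewrite (bigD1 (l, j, m)) //= addrCA lerDl addr_ge0 //.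
by apply: sumr_ge0 => x _; case: (hf x).
Qed.

Lemma W_static (T : R) (w : @mono d -> R) f c K : weight T w -> fseries f c ->
  bsum (fun al => nc (c al) * w (al, 0%N)) K -> Wn T w (fun x _ => f x) K.
Proof.
move=> wt [_ hf] hK; apply: (W_rep wt (C := c) (g := fun al => (al, 0%N))) => // x t tT.
by apply: eq_hsum (hf x) => al; rewrite /chi /= expr0 mulr1.
Qed.

(** [q] is the value of the powers of the time, or of their differences. *)
Lemma W_slice (T : R) (w : @mono d -> R) (c : @mono d -> R[i]) K (q : nat -> R) (z M : R)
    (f : 'rV[R]_d -> R) : 0 <= z -> 0 <= M ->
  bsum (fun g => nc (c g) * w g) K ->
  (forall g : @mono d, `|q g.2| * expR (z * freq_norm g.1) <= M * w g) ->
  (forall x, hsum (fun g => c g * (expi (freq_dot g.1 x) * (q g.2)%:C%C)) (f x)%:C%C) ->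
  exists e : 'rV[int]_d -> R[i], fseries f e /\
    bsum (fun al => nc (e al) * expR (z * freq_norm al)) (M * K).
Proof.
move=> z0 M0 hK hq hf.
have hb : bsum (fun g => nc (c g * (q g.2)%:C%C) * expR (z * freq_norm g.1)) (M * K).
  apply: le_bsum (bsumZ M0 hK) => g; rewrite ncM ncR mulrCA -mulrA.
  by rewrite ler_wpM2l ?nc_ge0.
have hb0 : bsum (fun g => nc (c g * (q g.2)%:C%C)) (M * K).
  apply: le_bsum hb => g; rewrite ler_peMr ?nc_ge0 // -expR0 ler_expR.
  by rewrite mulr_ge0 ?freq_norm_ge0.
have [|e [he1 he2 _]] := fseries_rep (g := fun g : @mono d => g.1) (f := f) hb0.
  by move=> x; apply: eq_hsum (hf x) => g; rewrite mulrA mulrAC.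
by exists e; split=> //; apply: he2 hb => al; apply: expR_ge0.
Qed.

Section Solution.
Variables (A : 'rV[R]_n -> 'M[R]_(d, n) -> 'rV[R]_n) (rho C1 : R).
Hypotheses (rho0 : 0 < rho) (C10 : 0 < C1).
Let T := rho / C1.
Let T0 : 0 < T. Proof. exact: divr_gt0. Qed.
Let w : @mono d -> R := evol_weight rho C1.
Let wt : weight T w := evol_weightP rho0 C10.

Lemma evol_weight_evolution : evolution T C1^-1 w.
Proof.
split; [exact: wt|exact: evol_weight_term|exact: evol_weight_deriv|exact: evol_weight_diff2].
Qed.

Variables (u0 : 'rV[R]_d -> 'rV[R]_n) (u : 'I_n -> 'rV[R]_d -> R -> R) (K : R).
Hypothesis hu : forall l, Wn T w (u l) K.
Hypothesis heq : forall l, primitive T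
  (fun x t => apply_grad A (fun y => \row_l u l y t) x 0 l) (fun x t => u l x t - u0 x 0 l).

(** At the time [t] the weight is at least [e^((rho - C1 t) |al|) t^k], and the
    coefficient of [e^{i al.x}] is the sum over [k]. For the continuity at [t] the
    weight at a slightly later time absorbs the Lipschitz constants of the [s^k]. *)
Lemma solution_of_W : solution A u0 (fun t => rho - C1 * t) (fun t x => \row_l u l x t).
Proof.
have tT t : 0 < rho - C1 * t -> t < T by rewrite subr_gt0 mulrC -ltr_pdivlMr.
have nT t : 0 <= t -> t < T -> `|t| < T by move=> t0; rewrite ger0_norm.
have [c hc] := choice hu.
split.
- apply/funext => x; apply/rowP => l; rewrite mxE.
  by have [h _] := heq l x; apply/eqP; rewrite -subr_eq0 h.
- move=> t t0 rt; rewrite /Xspace /=; apply: le_lt_trans (ltry (\sum_(l < n) (1 * K))).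
  apply: scalar_Gen => l; have [h1 h2] := hc l; have ht := tT t rt.
  refine (@W_slice T w (c l) K (fun k => t ^+ k) (rho - C1 * t) 1 (fun x => (\row_l u l x t) 0 l) (ltW rt) ler01 h1 _ _) => [g|x].
    rewrite mul1r mulrC ger0_norm ?exprn_ge0 //; apply: evol_le_weight => //.
    by rewrite t0 ltW.
  by rewrite mxE; apply: h2; apply: nT.
- move=> t r t0 r0 rt.
  have ht : t < T by apply: tT; apply: le_lt_trans rt.
  (* a time before which the radius stays above r *)
  pose t1 := (rho - r) / C1; pose de := (t1 - t) / 2; pose tau := t + de.
  have tt1 : t < t1 by rewrite ltr_pdivlMr //; move: rt; rewrite mulrC; lra.
  have t1T : t1 <= T by rewrite ler_wpM2r ?invr_ge0 ?(ltW C10) // lerBlDr lerDl.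
  have de0 : 0 < de by rewrite divr_gt0 ?subr_gt0.
  have taude : tau + de = t1 by rewrite /tau /de; field.
  have tau_t1 : tau < t1 by rewrite -taude ltrDl.
  have rt1 : rho - C1 * t1 = r by rewrite /t1; field; rewrite gt_eqF.
  have hG s : 0 <= s <= tau ->
      (Gen ((fun x => \row_l u l x s : 'rV[R]_n) \- (fun x => \row_l u l x t))%R r
       <= (`|s - t| * (n%:R * (de^-1 * K)))%:E)%E.
    move=> /andP[s0 st]; have sT : s < T by apply: le_lt_trans st (lt_le_trans tau_t1 t1T).
    have -> : `|s - t| * (n%:R * (de^-1 * K)) = \sum_(l < n) (de^-1 * `|s - t| * K).
      by rewrite sumr_const card_ord -mulr_natl; ring.
    apply: scalar_Gen => l; have [h1 h2] := hc l.
    refine (@W_slice T w (c l) K (fun k => s ^+ k - t ^+ k) r (de^-1 * `|s - t|)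
      (fun x => (\row_l u l x s - \row_l u l x t) 0 l) r0 _ h1 _ _) => [|g|x].
    - by rewrite mulr_ge0 ?invr_ge0 ?(ltW de0).
    - have hp : `|s ^+ g.2 - t ^+ g.2| <= de^-1 * t1 ^+ g.2 * `|s - t|.
        by rewrite -taude; apply: pow_lip; rewrite // ger0_norm // ?lerDl ltW.
      apply: le_trans (ler_wpM2r (expR_ge0 _) hp) _.
      have hw : evol rho C1 g t1 <= w g.
        by apply: evol_le_weight => //; rewrite t1T (le_trans t0 (ltW tt1)).
      have M0 : 0 <= de^-1 * `|s - t| by rewrite mulr_ge0 ?invr_ge0 ?(ltW de0).
      apply: le_trans (ler_wpM2l M0 hw); rewrite /evol rt1.
      by rewrite le_eqVlt; apply/orP; left; apply/eqP; ring.
    - rewrite !mxE rmorphB; apply: eq_hsum (hsumB (h2 x s (nT s s0 sT)) (h2 x t (nT t t0 ht))) => g.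
      by rewrite /chi rmorphB /=; ring.
  apply: (@squeeze_cvge _ _ _ _ (fun=> 0%E) _ (fun s => (`|s - t| * (n%:R * (de^-1 * K)))%:E)).
  + rewrite near_withinE; near=> s => /= s0; rewrite Gen_ge0 /=; apply: hG; rewrite s0 ltW //.
    by near: s; apply: lt_nbhsl; rewrite ltrDl.
  + exact: cvg_cst.
  + apply: cvg_within_filter; apply: cvg_EFin; first by near=> s.
    have -> : 0 = `|t - t| * (n%:R * (de^-1 * K)) by rewrite subrr normr0 mul0r.
    apply: cvgM; last exact: cvg_cst.
    by apply: cvg_norm; apply: cvgB; [exact: cvg_id|exact: cvg_cst].
- move=> t x t0 rt; have ht := nT t (ltW t0) (tT t rt).
  have hd i l : is_derive t (1 : R) (fun s => (\row_l u l x s : 'rV[R]_n) i l)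
     (apply_grad A (fun y => \row_l u l y t) x i l).
    rewrite ord1; have [_ /(_ t ht) h] := heq l x.
    have := is_deriveD h (is_derive_cst (u0 x 0 l) t 1); rewrite addr0.
    rewrite (_ : _ + _ = (fun s => (\row_l u l x s : 'rV[R]_n) 0 l)) //.
    by apply/funext => s; rewrite mxE /=  subrK.
  have dv : derivable (fun s => \row_l u l x s : 'rV[R]_n) t 1.
    by apply/derivable_mxP => i l; have [] := hd i l.
  apply: DeriveDef => //; rewrite derive_mx //; apply/matrixP => i l; rewrite mxE.
  by have [_ ->] := hd i l.
Unshelve. all: by end_near. Qed.

End Solution.

(** [C1] is chosen so large that the life span [rho / C1] and the cost [1 / C1] of a
    derivative make the integral equation a contraction. *)
Theorem existence (A : 'rV[R]_n -> 'M[R]_(d, n) -> 'rV[R]_n) (C0 : R) (F : R -> R)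
    (rho : R) (u0 : 'rV[R]_d -> 'rV[R]_n) (j0 : 'I_d) :
  (forall y : R, 0 <= y -> analytic_at F y) -> Gen_bound A C0 F -> 0 < rho ->
  Xspace rho u0 -> exists2 C1, 0 < C1 & exists u, solution A u0 (fun t => rho - C1 * t) u.
Proof.
move=> hF hA rho0 hu0; pose K0 := realGen u0 rho.
have fin : (Gen u0 rho <= K0%:E)%E.
  by rewrite /K0 /realGen fineK // ge0_fin_numE ?Gen_ge0.
have K00 : 0 <= K0 by apply: fine_ge0; apply: Gen_ge0.
have r0 : 0 <= 2 * (K0 + 1) by rewrite mulr_ge0 ?addr_ge0.
have [B B0 [zB fB]] := nonlinearity_operates j0 hF hA r0.
set r := 2 * (K0 + 1) in r0 zB fB.
pose C1 := 2 * (rho * B + (d * n)%:R * (B * (r + 1))) + 1.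
have C1p : 0 <= 2 * (rho * B + (d * n)%:R * (B * (r + 1))).
  by rewrite mulr_ge0 ?addr_ge0 ?mulr_ge0 ?addr_ge0 // ltW.
have C10 : 0 < C1 by apply: ltr_wpDl.
have T0 : 0 < rho / C1 by apply: divr_gt0.
have ev := evol_weight_evolution rho0 C10 : @evolution R d _ _ _.
have wt := evolution_weight ev.
have affine a p l : A a p 0 l = zeroth_order A l a + \sum_j \sum_m p j m * gradient_coef A l j m a.
  exact: (A_affine hF hA j0).
have u0W l : Wn (rho / C1) (evol_weight rho C1) (fun x (_ : R) => u0 x 0 l) K0.
  have [c [hc hb]] := Gen_scalar l fin.
  apply: (W_static wt hc); apply: le_bsum hb => al; rewrite ler_wpM2l ?nc_ge0 //.
  apply: evol_weight_le => // t /andP[t0 _]; rewrite /evol /= expr0 mulr1 ler_expR.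
  by rewrite ler_wpM2r ?freq_norm_ge0 // lerBlDr lerDl mulr_ge0 // ltW.
have [||u hu itu] := picard affine T0 ev K00 B0 _ u0W zB fB.
- by rewrite invr_ge0 ltW.
- have -> : 2 * (rho / C1 * B + (d * n)%:R * (C1^-1 * (B * (r + 1))))
    = (2 * (rho * B + (d * n)%:R * (B * (r + 1)))) / C1.
    by field; rewrite gt_eqF.
  by rewrite ler_pdivrMr // mul1r /C1 lerDl.
exists C1 => //; exists (fun t x => \row_l u l x t).
apply: (solution_of_W rho0 C10 hu) => l; apply: primitive_ext (itu l) => x t tT.
exact: (rhs_apply_grad affine ev (K := fun=> r) l x hu tT).
Qed.

End Existence.

(** * Mean value inequality *)

Section MeanValue.
Context {R : realType}.

(** Compare with [K (x - a)^(k + 1) / (k + 1)]. *)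
Lemma mvt_pow (f df : R -> R) (a b K : R) (k : nat) : a <= b ->
  (forall x, a < x -> x < b -> is_derive x (1 : R) f (df x)) ->
  {within `[a, b], continuous f} ->
  (forall x, a < x -> x < b -> `|df x| <= K * (x - a) ^+ k) ->
  f b - f a <= K * ((b - a) ^+ k.+1 / k.+1%:R).
Proof.
rewrite le_eqVlt => /predU1P[->|ab] hd cf hM.
  by rewrite !subrr exprS !mul0r mulr0.
pose h := fun x : R => K * ((x - a) ^+ k.+1 / k.+1%:R).
have hh (x : R) : is_derive x (1 : R) h (K * (x - a) ^+ k).
  have hx : is_derive x (1 : R) (fun x : R => x - a) 1.
    by have := is_deriveB (is_derive_id x (1 : R)) (is_derive_cst a x (1 : R)); rewrite subr0.
  have := is_deriveX k.+1 hx => hX.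
  rewrite (_ : h = (K / k.+1%:R) *: (fun x => x - a) ^+ k.+1); last first.
    apply/funext => y; rewrite /h exprfctE scalrfctE /GRing.scale /=.
    by rewrite [RHS]mulrAC mulrA.
  apply: is_derive_eq (is_deriveZ _ hX) _.
  by rewrite /GRing.scale /= -mulr_natl; field; rewrite ?natr1 gt_eqF.
have hg (x : R) : a < x -> x < b -> is_derive x (1 : R) (f - h) (df x - K * (x - a) ^+ k).
  by move=> ax xb; apply: is_deriveB (hd x ax xb) (hh x).
have [x||c] := @MVT R (f - h) (fun x => df x - K * (x - a) ^+ k) a b ab.
- by rewrite in_itv /= => /andP[]; apply: hg.
- apply: within_continuousB; first exact: cf.
  apply: continuous_subspaceT => y; apply/differentiable_continuous/derivable1_diffP.
  by case: (hh y).
rewrite in_itv /= => /andP[ac cb] e.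
have : (f - h) b - (f - h) a <= 0.
  rewrite e mulr_le0_ge0 ?subr_ge0 ?(ltW ab) // subr_le0.
  by apply: le_trans (ler_norm _) (hM c ac cb).
have -> : (f - h) b - (f - h) a = f b - f a - (h b - h a) by rewrite !fctE; ring.
have -> : h a = 0 by rewrite /h subrr exprS !mul0r mulr0.
by rewrite subr0 subr_le0.
Qed.

Lemma lincomb_derive (I : Type) (q : seq I) (ka : I -> R) (F : I -> R -> R) (G : I -> R) t :
  (forall i, is_derive t (1 : R) (F i) (G i)) ->
  is_derive t (1 : R) (fun t => \sum_(i <- q) ka i * F i t) (\sum_(i <- q) ka i * G i).
Proof.
move=> h; elim: q => [|i q IH].
  rewrite big_nil (_ : (fun t => _) = cst 0); first exact: is_derive_cst.
  by apply/funext => s; rewrite big_nil.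
rewrite big_cons (_ : (fun t => _) = (ka i *: F i) + (fun t => \sum_(i <- q) ka i * F i t)).
  exact: is_deriveD (is_deriveZ _ (h i)) IH.
by apply/funext => s; rewrite big_cons.
Qed.

Lemma lincomb_continuous (I : Type) (q : seq I) (ka : I -> R) (F : I -> R -> R) (D : set R) :
  (forall i, {within D, continuous (F i)}) ->
  {within D, continuous (fun t => \sum_(i <- q) ka i * F i t)}.
Proof.
move=> h; elim: q => [|i q IH].
  rewrite (_ : (fun t => _) = cst 0); first by move=> x; apply: cvg_cst.
  by apply/funext => s; rewrite big_nil.
rewrite (_ : (fun t => _) = (fun t => ka i * F i t) + (fun t => \sum_(i <- q) ka i * F i t)).
  apply: within_continuousD IH => x.
  by apply: cvgM; [apply: cvg_cst|apply: h].
by apply/funext => s; rewrite big_cons.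
Qed.

Variable d : nat.

(** A frequency that is small in comparison with the grid is the shortest of its
    aliases: aliasing does not increase the weighted sums. *)
Lemma cong_shortest N (al be : 'rV[int]_d) : (forall j, (2 * `|al 0%R j| < N)%N) ->
  cong N be al -> freq_norm (R := R) al <= freq_norm be.
Proof.
move=> hN /forallP hc; apply: ler_wsqrtr; apply: ler_sum => j _.
have hj : (`|al 0%R j| <= `|be 0%R j|)%N.
  have := hc j; have := hN j; move: (al 0 j) (be 0 j) => a b aN.
  move=> /dvdzP[q hq]; have -> : b = a + q * N%:Z by rewrite -hq addrC subrK.
  have [->|q0] := eqVneq q 0; first by rewrite mul0r addr0.
  have : (1 <= `|q|)%N by rewrite absz_gt0.
  by move: aN; nia.
rewrite -!rmorphXn /= ler_int -[leLHS]ger0_norm ?sqr_ge0 // -[leRHS]ger0_norm ?sqr_ge0 //.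
rewrite !normrX -!abszE lerXn2r ?nnegrE //.
Qed.

Lemma cong_inj N (al al' be : 'rV[int]_d) : (forall j, (2 * `|al 0%R j| < N)%N) ->
  (forall j, (2 * `|al' 0%R j| < N)%N) -> cong N be al -> cong N be al' -> al = al'.
Proof.
move=> h h' /forallP c /forallP c'; apply/eqP.
have hN j : (`|(al 0 j - al' 0 j)%R| < N)%N by have := h j; have := h' j; lia.
rewrite -(cong_eq hN); apply/forallP => j.
have -> : al 0 j - al' 0 j = (be 0 j - al' 0 j) - (be 0 j - al 0 j) by ring.
exact: rpredB (c' j) (c j).
Qed.

Lemma phase (z : R[i]) : exists ze : R[i], nc ze <= 1 /\ ze * z = (nc z)%:C%C.
Proof.
have [->|z0] := eqVneq z 0; first by exists 0; rewrite nc0 mul0r.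
exists ((nc z)%:C%C / z); split; last by rewrite divfK.
have n0 : nc z != 0 by apply: contra z0 => /eqP /nc_eq0 ->.
have e1 : nc ((nc z)%:C%C / z) * nc z = nc z.
  by rewrite -ncM divfK // ncR ger0_norm // nc_ge0.
by have -> : nc ((nc z)%:C%C / z) = 1 by apply: (mulIf n0); rewrite e1 mul1r.
Qed.

Lemma Re_mulR (z : R[i]) (x : R) : complex.Re (z * x%:C%C) = complex.Re z * x.
Proof. by case: z => a b /=; rewrite mulr0 subr0. Qed.

Lemma Re_sum (I : Type) (q : seq I) (F : I -> R[i]) :
  complex.Re (\sum_(i <- q) F i) = \sum_(i <- q) complex.Re (F i).
Proof. exact: (raddf_sum (@complex.Re R : Rcomplex R -> R)). Qed.

(** Mean value inequality for the weighted sums of Fourier coefficients. A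
    finite combination of coefficients is, up to the aliases on a large grid,
    a finite combination of point values, which can be differentiated under no
    more than pointwise assumptions. *)
Theorem mean_value (f g : R -> 'rV[R]_d -> R) (a b r K : R) (k : nat)
    (c : 'rV[int]_d -> R[i]) : a <= b -> 0 <= r ->
  (forall x, f a x = 0) -> fseries (f b) c ->
  (forall x t, a < t -> t < b -> is_derive t (1 : R) (f ^~ x) (g t x)) ->
  (forall x, {within `[a, b], continuous (f ^~ x)}) ->
  (forall t, a < t -> t < b -> exists e : 'rV[int]_d -> R[i], fseries (g t) e /\
     bsum (fun al => nc (e al) * expR (r * freq_norm al)) (K * (t - a) ^+ k)) ->
  bsum (fun al => nc (c al) * expR (r * freq_norm al)) (K * ((b - a) ^+ k.+1 / k.+1%:R)).
Proof.
move=> ab r0 fa [[Kc hKc] hc] hd hcont hg J.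
apply/ler_addgt0Pl => e e0; rewrite addrC.
pose k_ (al : 'rV[int]_d) : R := expR (r * freq_norm al).
have k0 al : 0 <= k_ al by apply: expR_ge0.
pose S := \sum_(al <- J) k_ al; have S0 : 0 <= S by apply: sumr_ge0 => al _.
have eps0 : 0 < e / (S + 1) by rewrite divr_gt0 // ltr_wpDl.
have [J0 hJ0] := bsum_tail (fun al => nc_ge0 (c al)) hKc eps0.
pose M := \max_(al <- (J `|` J0)%fset) \max_(j < d) `|al 0%R j|%N.
have hM (al : 'rV[int]_d) j : al \in (J `|` J0)%fset -> (`|al 0%R j| <= M)%N.
  move=> alJ; apply: leq_trans (leq_bigmax_seq _ alJ isT).
  exact: (leq_bigmax (F := fun j : 'I_d => `|al 0%R j|%N) j).
pose N := (2 * M).+1; have N0 : (0 < N)%N by [].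
have hN (al : 'rV[int]_d) : al \in J -> forall j, (2 * `|al 0%R j| < N)%N.
  by move=> alJ j; rewrite ltnS leq_mul2l /= hM // inE alJ.
have hNJ0 (al be : 'rV[int]_d) : be \in J -> al \in J0 -> cong N al be = (al == be).
  move=> beJ alJ; apply: cong_eq => j.
  have := hM al j; have := hM be j; rewrite !inE beJ alJ orbT => /(_ isT) h1 /(_ isT) h2.
  by move: h1 h2; rewrite /N; lia.
(* the combination of the coefficients in J whose value at f b is the sum to be bounded *)
have [ze hze] := choice (fun al => phase (c al)).
pose Psi (F : 'rV[R]_d -> R) :=
  \sum_(al <- J) (k_ al)%:C%C * ze al * grid_avg N al (fun x => (F x)%:C%C).
pose ka (s : {ffun 'I_d -> 'I_N}) := \sum_(al <- J)
  complex.Re ((k_ al)%:C%C * ze al * ((N%:R ^+ d)^-1 * expi (- freq_dot al (grid_pt (R := R) s)))).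
have psiE F : complex.Re (Psi F) = \sum_s ka s * F (grid_pt s).
  rewrite /Psi Re_sum /ka; under [RHS]eq_bigr do rewrite mulr_suml.
  rewrite exchange_big /=; apply: eq_bigr => al _.
  rewrite /grid_avg !mulr_sumr Re_sum; apply: eq_bigr => s _.
  by rewrite -Re_mulR !mulrA.
have bound (G : 'rV[R]_d -> R) e' L : fseries G e' ->
    bsum (fun al => nc (e' al) * k_ al) L -> `|complex.Re (Psi G)| <= L.
  move=> [_ hG] hL; apply: le_trans (nc_Re _) _.
  have h := hsum_finsum (enum_fset J) (fun al => hsumZ ((k_ al)%:C%C * ze al) (hsum_grid al N0 hG)).
  apply: (hsum_norm h); apply: le_bsum hL => be /=.
  have [[al alJ albe]|no] := pselect (exists2 al, al \in J & cong N be al).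
    rewrite (big_fsetD1 al) //= big1_fset => [|al']; last first.
      rewrite in_fsetD1 => /andP[ne al'J] _; case: (boolP (cong N be al')) => [c'|_]; last by rewrite !mulr0.
      by case/negP: ne; apply/eqP; apply: (cong_inj (hN _ al'J) (hN _ alJ) c' albe).
    rewrite addr0 albe mulr1 !ncM ncR (ger0_norm (k0 _)) mulrC ler_wpM2l ?nc_ge0 //.
    apply: le_trans (_ : k_ al * 1 <= _).
      by rewrite ler_wpM2l //; case: (hze al).
    by rewrite mulr1 ler_expR ler_wpM2l // (cong_shortest (hN _ alJ)).
  rewrite big1_fset ?nc0 ?mulr_ge0 ?nc_ge0 // => al alJ _.
  by case: (boolP (cong N be al)) => [hc'|_]; [case: no; exists al|rewrite !mulr0].
have h1 : complex.Re (Psi (f b)) <= K * ((b - a) ^+ k.+1 / k.+1%:R).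
  have := @mvt_pow (fun t => complex.Re (Psi (f t))) (fun t => complex.Re (Psi (g t))) a b K k ab.
  have -> : complex.Re (Psi (f a)) = 0.
    by rewrite psiE big1 // => s _; rewrite fa mulr0.
  have -> : (fun t => complex.Re (Psi (f t))) = (fun t => \sum_s ka s * f t (grid_pt s)).
    by apply/funext => t; rewrite psiE.
  rewrite subr0; apply.
  - move=> t at_ tb; rewrite psiE; apply: lincomb_derive => s; exact: hd.
  - by apply: lincomb_continuous => s; apply: hcont.
  - by move=> t at_ tb; have [e' [h2 h3]] := hg t at_ tb; apply: bound h2 h3.
apply: le_trans (lerD h1 (lexx e)); rewrite -lerBlDl.
have -> : \sum_(al <- J) nc (c al) * expR (r * freq_norm al)
   = complex.Re (\sum_(al <- J) (k_ al)%:C%C * ze al * c al).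
  rewrite Re_sum; apply: eq_bigr => al _; have [_ h] := hze al.
  by rewrite -mulrA h -rmorphM /= mulrC.
have -> : complex.Re (\sum_(al <- J) (k_ al)%:C%C * ze al * c al) - complex.Re (Psi (f b))
   = - complex.Re (\sum_(al <- J) (k_ al)%:C%C * ze al * (grid_avg N al (fun x => (f b x)%:C%C) - c al)).
  rewrite /Psi !Re_sum -sumrB -sumrN; apply: eq_bigr => al _.
  by rewrite mulrBr; move: (_ * c al) (_ * grid_avg _ _ _) => [? ?] [? ?] /=; rewrite opprB.
apply: le_trans (ler_norm _) _; rewrite normrN; apply: le_trans (nc_Re _) _.
apply: le_trans (nc_sum _ _ _) _; apply: le_trans (_ : S * (e / (S + 1)) <= _).
  rewrite /S mulr_suml big_seq [leRHS]big_seq; apply: ler_sum => al alJ.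
  rewrite !ncM ncR (ger0_norm (k0 _)) -mulrA ler_wpM2l //.
  rewrite -[leRHS]mul1r ler_pM ?nc_ge0 //; first by case: (hze al).
  by apply: (grid_avg_close N0 hc hJ0) => al'; apply: hNJ0.
by rewrite mulrCA ler_piMr ?(ltW e0) // ler_pdivrMr ?ltr_wpDl // mul1r lerDl.
Qed.

End MeanValue.

(** * Uniqueness *)

Section Radius.
Context {R : realType} {d : nat}.
Implicit Types (f g : 'rV[R]_d -> R).

(** The scalar [Gen f r <= K]. *)
Definition norm_le (r : R) f (K : R) : Prop := exists c : 'rV[int]_d -> R[i],
  fseries f c /\ bsum (fun al => nc (c al) * expR (r * freq_norm al)) K.

Lemma norm_le_mono r r' f K K' : r <= r' -> K <= K' -> norm_le r' f K -> norm_le r f K'.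
Proof.
move=> rr hK [c [h1 h2]]; exists c; split=> //; apply: bsum_le hK; apply: le_bsum h2 => al.
by rewrite ler_wpM2l ?nc_ge0 // ler_expR ler_wpM2r // freq_norm_ge0.
Qed.

(** For functions that do not depend on time the power of 2 is immaterial;
    this weight makes them elements of the weighted algebras. *)
Definition static_weight (r : R) (g : @mono d) : R := expR (r * freq_norm g.1) * 2 ^+ g.2.

Section FixedRadius.
Variables (r : R) (r0 : 0 <= r).

Lemma static_weightP : weight 2 (static_weight r).
Proof.
split=> [g|t t2 g|g h|].
- by rewrite mulr_gt0 ?expR_gt0 ?exprn_gt0.
- rewrite -[leLHS]mul1r ler_pM ?exprn_ge0 //.
    by rewrite -expR0 ler_expR mulr_ge0 ?freq_norm_ge0.
  by apply: lerXn2r; rewrite ?nnegrE // ltW.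
- rewrite /static_weight /= exprD mulrACA -expRD -mulrDr.
  by rewrite ler_wpM2r ?mulr_ge0 ?exprn_ge0 // ler_expR ler_wpM2l ?freq_normD.
- by rewrite /static_weight /= freq_norm0 mulr0 expR0 mulr1.
Qed.

Lemma norm_le_W f K : norm_le r f K <-> Wn 2 (static_weight r) (fun x _ => f x) K.
Proof.
split=> [[c [h1 h2]]|[c [h1 h2]]].
  apply: W_static static_weightP h1 _.
  by apply: le_bsum h2 => al; rewrite /static_weight /= mulr1.
have := @W_slice R d 2 (static_weight r) c K (fun=> 1) r 1 f r0 ler01 h1.
rewrite mul1r; apply=> [g|x].
  rewrite normr1 !mul1r ler_peMr ?expR_ge0 // exprn_ege1 // ler1n //.
have h : `|1 : R| < 2 by rewrite normr1 ltr1n.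
by apply: eq_hsum (h2 x 1 h) => g; rewrite /chi expr1n.
Qed.

Lemma norm_le_bound f K x : norm_le r f K -> `|f x| <= K.
Proof.
move=> /norm_le_W h; have := W_bound static_weightP x h (t := 0); rewrite normr0.
by apply.
Qed.

Lemma norm_le_ge0 f K : norm_le r f K -> 0 <= K.
Proof. by move=> /norm_le_W /W_ge0. Qed.

Lemma norm_le_sub f g K L : norm_le r f K -> norm_le r g L -> norm_le r (fun x => f x - g x) (K + L).
Proof. by move=> /norm_le_W h1 /norm_le_W h2; apply/norm_le_W/(W_sub static_weightP h1 h2). Qed.

Lemma norm_le_add f g K L : norm_le r f K -> norm_le r g L -> norm_le r (fun x => f x + g x) (K + L).
Proof. by move=> /norm_le_W h1 /norm_le_W h2; apply/norm_le_W/(W_add static_weightP h1 h2). Qed.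

End FixedRadius.

(** A derivative multiplies the coefficients by [|al|], and [de |al| <= e^(de |al|)] for
    the loss of radius [de]. *)
Lemma jacobian_norm n (u : 'rV[R]_d -> 'rV[R]_n) r r' M : 0 <= r -> r < r' ->
  (forall l, norm_le r' (fun x => u x 0 l) M) ->
  (forall x, differentiable u x) /\
  forall j l, norm_le r (fun x => jacobian u x j l) (M / (r' - r)).
Proof.
move=> r0 rr hu; have [c hc] := choice hu.
have de0 : 0 < r' - r by rewrite subr_gt0.
have r'0 : 0 < r' by apply: le_lt_trans rr.
pose Q := (1 + 2 / r') ^+ 2; have Q0 : 0 <= Q by apply: sqr_ge0.
have hC l : bsum (fun al => nc (c l al) * (1 + freq_norm al) ^+ 2) (Q * M).
  have [_ h] := hc l; apply: le_bsum (bsumZ Q0 h) => al.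
  rewrite [leRHS]mulrCA ler_wpM2l ?nc_ge0 //.
  by apply: sqr_le_expR => //; apply: freq_norm_ge0.
have hrep := jacobian_rep (g := fun _ al => al) hC (fun x l => proj2 (proj1 (hc l)) x).
split=> [x|j l]; first by have [] := hrep x.
exists (fun al : 'rV[int]_d => 'i%C * ((al 0 j)%:~R)%:C%C * c l al).
have hb : bsum (fun al : 'rV[int]_d => nc ('i%C * ((al 0 j)%:~R)%:C%C * c l al) * expR (r * freq_norm al))
    (M / (r' - r)).
  have [_ h] := hc l; rewrite mulrC; apply: (le_bsum _ (bsumZ _ h)) => [al|]; last first.
    by rewrite invr_ge0 ltW.
  rewrite !ncM ncR (_ : nc ('i%C : R[i]) = 1) ?mul1r; last first.
    by rewrite /= expr0n /= add0r expr1n sqrtr1.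
  have -> : r' * freq_norm al = r * freq_norm al + (r' - r) * freq_norm al by ring.
  rewrite expRD; set a := freq_norm al; set E := expR (r * a).
  have E0 : 0 <= E by apply: expR_ge0.
  have h1 : (r' - r) * a <= expR ((r' - r) * a).
    by apply: le_trans (expR_ge1Dx _); rewrite lerDr.
  have h2 : `|(al 0 j)%:~R : R| <= (r' - r)^-1 * expR ((r' - r) * a).
    by apply: le_trans (freq_norm_coord _ _) _; rewrite mulrC ler_pdivlMr // mulrC.
  rewrite [X in X * _]mulrC -mulrA.
  have -> : (r' - r)^-1 * (nc (c l al) * (E * expR ((r' - r) * a)))
    = nc (c l al) * ((r' - r)^-1 * expR ((r' - r) * a) * E) by ring.
  by rewrite ler_wpM2l ?nc_ge0 // ler_wpM2r.
split=> //; split.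
  exists (M / (r' - r)); apply: le_bsum hb => al; rewrite ler_peMr ?nc_ge0 // -expR0 ler_expR.
  by rewrite mulr_ge0 ?freq_norm_ge0.
by move=> x; have [_ h] := hrep x; apply: eq_hsum (h l j) => al; rewrite mulrA.
Qed.

Lemma jacobian_sub n (u v : 'rV[R]_d -> 'rV[R]_n) x j l : differentiable u x ->
  differentiable v x -> jacobian (u \- v) x j l = jacobian u x j l - jacobian v x j l.
Proof.
move=> hu hv.
have e (f : 'rV[R]_d -> 'rV[R]_n) : jacobian f x j l = ('d f x (delta_mx 0 j)) 0 l.
  by rewrite /jacobian mxE.
apply: etrans (e _) _; apply: etrans (congr2 (fun a b : R => a - b) (esym (e u)) (esym (e v))).
have := congr1 (fun F : 'rV[R]_d -> 'rV[R]_n => F (delta_mx 0 j)) (diffB hu hv).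
by move=> h; apply: etrans (congr1 (fun y : 'rV[R]_n => y 0 l) h) _; rewrite !mxE.
Qed.

End Radius.

Section Uniqueness.
Context {R : realType} {d n : nat}.
Variables (A : 'rV[R]_n -> 'M[R]_(d, n) -> 'rV[R]_n).
Hypothesis affine : forall a p l, A a p 0 l = zeroth_order A l a + \sum_j \sum_m p j m * gradient_coef A l j m a.
Variables (B M r0 : R).
Hypotheses (B0 : 0 <= B) (M0 : 0 <= M) (r00 : 0 < r0).
Hypothesis zeroth_orderB : forall l, @operates R d n M B (zeroth_order A l).
Hypothesis gradient_coefB : forall l j m, @operates R d n M B (gradient_coef A l j m).

Definition lip_const : R := B * r0 + (d * n)%:R * (B * (M + 1)) + 1.
Notation L := lip_const.

Lemma lip_const_gt0 : 0 < L.
Proof. by rewrite ltr_wpDl // addr_ge0 ?mulr_ge0 ?addr_ge0 // ltW. Qed.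

Implicit Types (u v : 'rV[R]_d -> 'rV[R]_n).

Lemma apply_gradE u x l : apply_grad A u x 0 l = zeroth_order A l (u x)
  + \sum_(jm : 'I_d * 'I_n) jacobian u x jm.1 jm.2 * gradient_coef A l jm.1 jm.2 (u x).
Proof. by apply: etrans (affine _ _ _) _; rewrite pair_big. Qed.

(** The right-hand side is Lipschitz continuous, with the loss of radius of
    one derivative. *)
Lemma apply_grad_lip u v r r' de l : 0 <= r -> r < r' -> r' <= r0 ->
  (forall l, norm_le r0 (fun x => u x 0 l) M) ->
  (forall l, norm_le r0 (fun x => v x 0 l) M) ->
  (forall l, norm_le r' (fun x => u x 0 l - v x 0 l) de) ->
  norm_le r (fun x => apply_grad A u x 0 l - apply_grad A v x 0 l) (L * (de / (r' - r))).
Proof.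
move=> r_0 rr r'0 hu hv hd.
have wt := static_weightP (d := d) r_0.
have r'p : 0 <= r' by apply: le_trans (ltW rr).
have eta0 : 0 < r' - r by rewrite subr_gt0.
have de0 : 0 <= de := norm_le_ge0 r'p (hd l).
have toW (f : 'rV[R]_d -> R) K : norm_le r0 f K -> Wn 2 (static_weight r) (fun x _ => f x) K.
  by move=> h; apply/norm_le_W => //; apply: norm_le_mono h => //; apply: le_trans (ltW rr) r'0.
have toW' (f : 'rV[R]_d -> R) K : norm_le r' f K -> Wn 2 (static_weight r) (fun x _ => f x) K.
  by move=> h; apply/norm_le_W => //; apply: norm_le_mono h => //; apply: ltW.
have at_r' (w : 'rV[R]_d -> 'rV[R]_n) : (forall l, norm_le r0 (fun x => w x 0 l) M) ->
    forall l, norm_le r' (fun x => w x 0 l) M.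
  by move=> h l'; apply: norm_le_mono (h l').
have [du ju] := jacobian_norm r_0 rr (at_r' u hu).
have [dv jv] := jacobian_norm r_0 rr (at_r' v hv).
have [|_ jd] := @jacobian_norm R d n (u \- v) r r' de r_0 rr.
  move=> l'; have := hd l'; congr norm_le; apply/funext => x; by rewrite !mxE.
have hz := zeroth_orderB l wt (fun l => toW _ _ (hu l)) (fun l => toW _ _ (hv l)) (fun l => toW' _ _ (hd l)).
have hf jm := gradient_coefB l jm.1 jm.2 wt (fun l => toW _ _ (hu l)) (fun l => toW _ _ (hv l)) (fun l => toW' _ _ (hd l)).
have hd' l' : Wn 2 (static_weight r) (fun x (_ : R) => v x 0 l' - u x 0 l') de.
  have := W_scale (-1) (toW' _ _ (hd l')); rewrite normrN1 mul1r; apply: W_ext => x t _.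
  by rewrite mulN1r opprB.
have hf' jm := gradient_coefB l jm.1 jm.2 wt (fun l => toW _ _ (hv l)) (fun l => toW _ _ (hu l)) hd'.
have ru x : \row_l u x 0 l = u x by apply/rowP => m; rewrite mxE.
have rv x : \row_l v x 0 l = v x by apply/rowP => m; rewrite mxE.
have h1 (jm : 'I_d * 'I_n) := W_mul wt (proj2 (hf jm))
  (proj1 (norm_le_W r_0 _ _) (ju jm.1 jm.2)).
have h2 (jm : 'I_d * 'I_n) := W_mul wt (proj1 (hf' jm))
  (proj1 (norm_le_W r_0 _ _) (jd jm.1 jm.2)).
have h := W_add wt (proj2 hz) (W_finsum wt (fun jm => W_add wt (h1 jm) (h2 jm))).
apply/norm_le_W => //; apply: W_ext (W_le h _) => [x t _|].
  apply: esym; apply: etrans (congr2 (fun a b : R => a - b) (apply_gradE u x l) (apply_gradE v x l)) _.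
  rewrite ru rv opprD addrACA -sumrB; congr (_ + _); apply: eq_bigr => jm _.
  apply: esym; apply: etrans (congr1 (fun a => _ + _ * a) (jacobian_sub _ _ (du x) (dv x))) _.
  have alg (p q a b : R) : (a - b) * p + b * (p - q) = p * a - q * b by ring.
  exact: alg.
rewrite sumr_const card_prod !card_ord -[X in _ + X <= _]mulr_natl /lip_const.
set dn := (d * n)%:R; set et := r' - r in eta0 *.
have -> : B * de + dn * (B * de * (M / et) + B * (de / et))
   = (B * et + dn * (B * (M + 1))) * (de / et) by field; rewrite gt_eqF.
rewrite ler_wpM2r ?divr_ge0 ?(ltW eta0) // -addrA lerD //; last by rewrite lerDl.
by rewrite ler_wpM2l // /et lerBlDr (le_trans r'0) // lerDl.
Qed.

Lemma pow_fact_le p : p.+1%:R ^+ p.+1 / p.+1`!%:R <= expR 1 ^+ p.+1 :> R.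
Proof.
rewrite -expRM_natl mulr1; apply: le_trans (expR_ge1Dxn p (ler0n R p.+1)).
by rewrite lerDr.
Qed.

Section Local.
Variables (u v : R -> 'rV[R]_d -> 'rV[R]_n) (t0 b : R).
Hypothesis hu : forall s, t0 <= s <= b -> forall l, norm_le r0 (fun x => u s x 0 l) M.
Hypothesis hv : forall s, t0 <= s <= b -> forall l, norm_le r0 (fun x => v s x 0 l) M.
Hypothesis uv0 : u t0 = v t0.
Hypothesis cu : forall x l, {within `[t0, b], continuous (fun s => u s x 0 l)}.
Hypothesis cv : forall x l, {within `[t0, b], continuous (fun s => v s x 0 l)}.
Hypothesis du : forall x l t, t0 < t -> t < b ->
  is_derive t (1 : R) (fun s => u s x 0 l) (apply_grad A (u t) x 0 l).
Hypothesis dv : forall x l t, t0 < t -> t < b ->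
  is_derive t (1 : R) (fun s => v s x 0 l) (apply_grad A (v t) x 0 l).

(** After [k] integrations, each at the cost of the part [eta] of the radius. *)
Lemma iterated_bound eta k s l : 0 < eta -> k%:R * eta <= r0 -> t0 <= s <= b ->
  norm_le (r0 - k%:R * eta) (fun x => u s x 0 l - v s x 0 l)
    (2 * M * (L / eta) ^+ k * ((s - t0) ^+ k / k`!%:R)).
Proof.
move=> eta0; elim: k s l => [|k IH] s l hk sb.
  rewrite mul0r subr0 !expr0 divr1 !mulr1 mulr_natl mulr2n.
  by apply: norm_le_sub (hu sb l) (hv sb l); apply: ltW.
have hk' : k%:R * eta <= r0.
  by apply: le_trans hk; rewrite ler_wpM2r ?ler_nat // ltW.
have [t0s sb'] := andP sb.
have rk : 0 <= r0 - k.+1%:R * eta by rewrite subr_ge0.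
have eE : r0 - k%:R * eta - (r0 - k.+1%:R * eta) = eta by rewrite -natr1; ring.
have rlt : r0 - k.+1%:R * eta < r0 - k%:R * eta by rewrite -subr_gt0 eE.
have rle : r0 - k%:R * eta <= r0 by rewrite lerBlDr lerDl mulr_ge0 // ltW.
have [c [hc _]] := IH s l hk' sb; exists c; split=> //.
pose K := 2 * M * (L / eta) ^+ k.+1 / k`!%:R.
have -> : 2 * M * (L / eta) ^+ k.+1 * ((s - t0) ^+ k.+1 / k.+1`!%:R)
    = K * ((s - t0) ^+ k.+1 / k.+1%:R).
  rewrite /K factS natrM invfM; move: (_ ^+ k.+1) (_ ^+ k.+1) => X Y.
  by move: (k.+1%:R^-1) (k`!%:R^-1) => Z Z'; ring.
have sub (f : R -> R) : {within `[t0, b], continuous f} -> {within `[t0, s], continuous f}.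
  apply: continuous_subspaceW => y /=; rewrite !in_itv /= => /andP[-> ys].
  exact: le_trans ys sb'.
apply: (mean_value (f := fun t x => u t x 0 l - v t x 0 l)
  (g := fun t x => apply_grad A (u t) x 0 l - apply_grad A (v t) x 0 l) t0s rk _ hc).
- by move=> x; rewrite uv0 subrr.
- move=> x t tt ts; have tb := lt_le_trans ts sb'.
  exact: is_deriveB (du x l tt tb) (dv x l tt tb).
- by move=> x; exact: (within_continuousB (sub _ (@cu x l)) (sub _ (@cv x l))).
- move=> t tt ts; have tb : t0 <= t <= b by rewrite !ltW //; apply: lt_le_trans sb'.
  have := apply_grad_lip l rk rlt rle (hu tb) (hv tb) (fun l => IH t l hk' tb).
  rewrite eE => h; have -> : K * (t - t0) ^+ k = L * (2 * M * (L / eta) ^+ k * ((t - t0) ^+ k / k`!%:R) / eta).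
    by rewrite /K exprS; move: ((L / eta) ^+ k) ((t - t0) ^+ k) (k`!%:R^-1) => X Y Z; ring.
  exact: h.
Qed.

(** Spending the radius [r0] in [p] equal parts gives the bound
    [(L p / r0)^p (s - t0)^p / p!], and [p^p / p! <= e^p]: for short times it tends to
    [0] as [p] grows. *)
Lemma local_uniqueness s : (b - t0) * (2 * L * expR 1) <= r0 -> t0 <= s <= b -> u s = v s.
Proof.
move=> hb sb; have [t0s sb'] := andP sb.
apply/funext => x; apply/rowP => l; apply/eqP; rewrite -subr_eq0; apply/eqP.
apply: (le_pow2_eq0 (K := 2 * M)) => p; pose q : R := p.+1%:R.
have q0 : 0 < q by rewrite ltr0n.
have eta0 : 0 < r0 / q by rewrite divr_gt0.
have qe : q * (r0 / q) = r0 by field; rewrite gt_eqF.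
have := iterated_bound (k := p.+1) l eta0 _ sb; rewrite qe subrr => /(_ (lexx _)).
move/(norm_le_bound (lexx 0)) => /(_ x) h; apply: le_trans h _.
have -> : 2 * M * (L / (r0 / q)) ^+ p.+1 * ((s - t0) ^+ p.+1 / p.+1`!%:R)
   = 2 * M * ((L * (s - t0) / r0) ^+ p.+1 * (q ^+ p.+1 / p.+1`!%:R)).
  have -> : L / (r0 / q) = L / r0 * q by field; rewrite !gt_eqF.
  have -> : L * (s - t0) / r0 = L / r0 * (s - t0) by rewrite mulrAC.
  rewrite (exprMn _ (L / r0) q) (exprMn _ (L / r0) (s - t0)); move: (p.+1`!%:R^-1) => Z.
  by move: ((s - t0) ^+ _) (q ^+ _) ((L / r0) ^+ _) => X Y W; ring.
have M2 : 0 <= 2 * M by rewrite mulr_ge0.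
rewrite ler_wpM2l //.
have X0 : 0 <= L * (s - t0) / r0.
  by rewrite divr_ge0 ?mulr_ge0 ?subr_ge0 // ltW // lip_const_gt0.
apply: le_trans (ler_wpM2l (exprn_ge0 _ X0) (pow_fact_le p)) _.
rewrite -exprMn; apply: le_trans (_ : 2^-1 ^+ p.+1 <= _).
  apply: lerXn2r; rewrite ?nnegrE ?invr_ge0 ?(mulr_ge0 X0 (expR_ge0 _)) //.
  rewrite mulrAC ler_pdivrMr // ler_pdivlMl //; apply: le_trans hb.
  have -> : 2 * (L * (s - t0) * expR 1) = (s - t0) * (2 * L * expR 1) by ring.
  rewrite ler_wpM2r ?lerD2r // !mulr_ge0 ?expR_ge0 //; exact: ltW lip_const_gt0.
rewrite exprVn lef_pV2 ?posrE ?exprn_gt0 // ler_weXn2l //; exact: ler1n.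
Qed.

End Local.

End Uniqueness.

Section Solutions.
Context {R : realType} {d n : nat}.
Variables (A : 'rV[R]_n -> 'M[R]_(d, n) -> 'rV[R]_n) (u0 : 'rV[R]_d -> 'rV[R]_n) (rhot : R -> R).

Section OneSolution.
Variable u : R -> 'rV[R]_d -> 'rV[R]_n.
Hypothesis hu : solution A u0 rhot u.

Lemma solution_norm t : 0 <= t -> 0 < rhot t -> exists2 K, 0 <= K &
  forall l, norm_le (rhot t) (fun x => u t x 0 l) K.
Proof.
move=> t0 rt; have [_ h _ _] := hu; have := h t t0 rt; rewrite /Xspace /= => fin.
have g0 := Gen_ge0 (u t) (rhot t).
exists (fine (Gen (u t) (rhot t))); first exact: fine_ge0.
by move=> l; apply: Gen_scalar; rewrite fineK // ge0_fin_numE.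
Qed.

Lemma solution_continuous t r e : 0 <= t -> 0 < rhot t -> 0 <= r -> r < rhot t -> 0 < e ->
  exists2 de, 0 < de & forall s, 0 <= s -> `|s - t| < de ->
    forall l, norm_le r (fun x => u s x 0 l - u t x 0 l) e.
Proof.
move=> t0 rt r0 rrt e0; have [_ _ h _] := hu; have := h t r t0 r0 rrt.
move=> /fine_cvgP[hfin /cvgrPdist_lt /(_ e e0) hlt].
have : \forall s \near within [set s | 0 <= s] (nbhs t), (Gen (u s \- u t)%R r <= e%:E)%E.
  near=> s; have hf : Gen (u s \- u t) r \is a fin_num by near: s.
  have : `|0 - fine (Gen (u s \- u t) r)| < e by near: s.
  rewrite sub0r normrN ger0_norm ?fine_ge0 ?Gen_ge0 // => he.
  by rewrite -(fineK hf) lee_fin ltW.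
rewrite near_withinE => /nbhs_normP[de /= de0 hde]; exists de => // s s0 st l.
have hs := hde s; rewrite /= distrC in hs.
have [c [h1 h2]] := Gen_scalar l (hs st s0); exists c; split=> //.
rewrite (_ : (fun x => _) = (fun x => (u s \- u t) x 0 l)) //.
by apply/funext => x; rewrite !mxE.
Unshelve. all: by end_near. Qed.

Lemma solution_cvg t x l e : 0 <= t -> 0 < rhot t -> 0 < e ->
  exists2 de, 0 < de & forall s, 0 <= s -> `|s - t| < de -> `|u s x 0 l - u t x 0 l| <= e.
Proof.
move=> t0 rt e0; have [de de0 h] := solution_continuous t0 rt (lexx 0) rt e0.
by exists de => // s s0 st; apply: norm_le_bound (lexx 0) _ _ _ (h s s0 st l).
Qed.

Lemma solution_within x l a b : 0 <= a -> (forall t, t <= b -> 0 < rhot t) ->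
  {within `[a, b], continuous (fun s => u s x 0 l)}.
Proof.
move=> a0 hb; apply/subspace_continuousP => t; rewrite /= in_itv /= => /andP[at_ tb].
apply/cvgrPdist_le => e e0; rewrite near_withinE.
have t0 : 0 <= t by apply: le_trans at_.
have [de de0 h] := solution_cvg x l t0 (hb t tb) e0.
apply/nbhs_normP; exists de => // s /= st; rewrite in_itv /= => /andP[as_ _].
by rewrite distrC; apply: h; [apply: le_trans as_|rewrite distrC].
Qed.

Lemma solution_derive x l t : 0 < t -> 0 < rhot t ->
  is_derive t (1 : R) (fun s => u s x 0 l) (apply_grad A (u t) x 0 l).
Proof.
move=> t0 rt; have [_ _ _ h] := hu; have [hd he] := h t x t0 rt.
apply: DeriveDef; first by have /derivable_mxP := hd; apply.
by rewrite -he derive_mx // mxE.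
Qed.

End OneSolution.

Variables (C0 : R) (F : R -> R) (j0 : 'I_d).
Hypothesis hF : forall y : R, 0 <= y -> analytic_at F y.
Hypothesis hA : Gen_bound A C0 F.
Hypothesis rho_dec : forall s t, s <= t -> rhot t <= rhot s.

(** The times up to which the solutions agree form an interval that contains its
    supremum, by continuity. At the supremum both solutions belong to a common
    ball for half of the radius, and stay in it for a while, so that they agree a
    little longer. *)
Lemma solution_uniq u v t1 : solution A u0 rhot u -> solution A u0 rhot v ->
  0 <= t1 -> 0 < rhot t1 -> u t1 = v t1.
Proof.
move=> hu hv t10 rt1; have rt t : t <= t1 -> 0 < rhot t.
  by move=> h; apply: lt_le_trans rt1 (rho_dec h).
pose E := [set t | 0 <= t <= t1 /\ forall s, 0 <= s <= t -> u s = v s].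
have E0 : E 0.
  split=> [|s s0]; first by rewrite lexx.
  have -> : s = 0 by apply/eqP; rewrite eq_le andbC.
  by have [-> _ _ _] := hu; have [-> _ _ _] := hv.
have hE : has_sup E by split; [exists 0|exists t1 => t [/andP[]]].
pose ts := sup E.
have ts0 : 0 <= ts by apply: ub_le_sup E0; case: hE.
have tst : ts <= t1 by apply: ge_sup; [exists 0|move=> t [/andP[]]].
have uvts : u ts = v ts.
  apply/funext => x; apply/rowP => l; apply/eqP; rewrite -subr_eq0 -normr_le0.
  apply/ler_addgt0Pl => e e0; rewrite addr0; have e2 : 0 < e / 2 by rewrite divr_gt0.
  have [de de0 h] := solution_cvg hu x l ts0 (rt _ tst) e2.
  have [de' de0' h'] := solution_cvg hv x l ts0 (rt _ tst) e2.
  have m0 : 0 < Num.min de de' by rewrite lt_min de0.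
  have [s [/andP[s0 st1] Es]] := sup_adherent m0 hE; rewrite ltrBlDr -ltrBlDl -/ts => sts.
  have sle : s <= ts by apply: ub_le_sup; [case: hE|split; rewrite ?s0].
  have sd : `|s - ts| < Num.min de de' by rewrite distrC ger0_norm ?subr_ge0.
  move: sd; rewrite lt_min => /andP[/(h s s0) h1 /(h' s s0) h2].
  have uvs : u s x 0 l = v s x 0 l by rewrite Es // s0 lexx.
  have -> : u ts x 0 l - v ts x 0 l = - (u s x 0 l - u ts x 0 l) + (v s x 0 l - v ts x 0 l).
    by rewrite uvs; ring.
  by apply: le_trans (ler_normD _ _) _; rewrite normrN (splitr e) lerD.
have [<-|tsn] := eqVneq ts t1; first by [].
have tlt : ts < t1 by rewrite lt_neqAle tsn.
pose r0 := rhot ts / 2; have rts := rt _ tst.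
have r00 : 0 < r0 by rewrite divr_gt0.
have r0lt : r0 < rhot ts by rewrite ltr_pdivrMr // ltr_pMr // ltr1n.
have [Ku Ku0 hKu] := solution_norm hu ts0 rts.
have [Kv Kv0 hKv] := solution_norm hv ts0 rts.
pose M := Ku + Kv + 1; have M0 : 0 <= M by rewrite !addr_ge0.
have [B B0 [zB fB]] := nonlinearity_operates j0 hF hA M0.
have affine a p l : A a p 0 l = zeroth_order A l a + \sum_j \sum_m p j m * gradient_coef A l j m a.
  exact: (A_affine hF hA j0).
have Lp : 0 < 2 * @lip_const R d n B M r0 * expR 1.
  by rewrite !mulr_gt0 ?expR_gt0 // lip_const_gt0.
have [de de0 hde] := solution_continuous hu ts0 rts (ltW r00) r0lt ltr01.
have [de' de0' hde'] := solution_continuous hv ts0 rts (ltW r00) r0lt ltr01.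
pose h := Num.min (Num.min (de / 2) (de' / 2))
  (Num.min (t1 - ts) (r0 / (2 * @lip_const R d n B M r0 * expR 1))).
have h0 : 0 < h by rewrite !lt_min subr_gt0 tlt !(divr_gt0 _ (ltr0n _ 2)) ?(divr_gt0 r00 Lp).
have [hde1 hde2 ht1 hL] : [/\ h <= de / 2, h <= de' / 2, h <= t1 - ts
    & h <= r0 / (2 * @lip_const R d n B M r0 * expR 1)].
  by have := lexx h; rewrite {2}/h !le_min => /andP[/andP[-> ->] /andP[-> ->]].
have bt : ts + h <= t1 by rewrite -lerBrDl.
have dist s e : 0 < e -> h <= e / 2 -> ts <= s <= ts + h -> `|s - ts| < e.
  move=> e0 he /andP[ss sb]; rewrite ger0_norm ?subr_ge0 //.
  by apply: le_lt_trans (_ : e / 2 < _); [lra|rewrite ltr_pdivrMr // ltr_pMr // ltr1n].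
have bnd (w : R -> 'rV[R]_d -> 'rV[R]_n) (K e : R) : 0 <= K -> K + 1 <= M -> (forall l, norm_le (rhot ts) (fun x => w ts x 0 l) K) ->
  0 < e -> h <= e / 2 ->
  (forall s, 0 <= s -> `|s - ts| < e -> forall l, norm_le r0 (fun x => w s x 0 l - w ts x 0 l) 1) ->
  forall s, ts <= s <= ts + h -> forall l, norm_le r0 (fun x => w s x 0 l) M.
  move=> K0 KM hK e0 he hs s sb l; have [ss _] := andP sb.
  have h1 := hs s (le_trans ts0 ss) (dist s e e0 he sb) l.
  have h2 := norm_le_mono (ltW r0lt) (lexx K) (hK l).
  have := norm_le_add (ltW r00) h1 h2; rewrite addrC.
  rewrite (_ : (fun x => _) = (fun x => w s x 0 l)); first exact: norm_le_mono.
  by apply/funext => x; rewrite subrK.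
have agree s : ts <= s <= ts + h -> u s = v s.
  apply: (local_uniqueness affine B0 M0 r00 zB fB) => //.
  - by apply: (bnd u Ku de) => //; rewrite /M -addrA lerD2l lerDr.
  - by apply: (bnd v Kv de') => //; rewrite /M lerD2r lerDr.
  - by move=> x l; apply: (solution_within hu) => // t tb; apply: rt; apply: le_trans bt.
  - by move=> x l; apply: (solution_within hv) => // t tb; apply: rt; apply: le_trans bt.
  - move=> x l t tt tb; apply: (solution_derive hu); first exact: le_lt_trans tt.
    by apply: rt; apply: le_trans bt; apply: ltW.
  - move=> x l t tt tb; apply: (solution_derive hv); first exact: le_lt_trans tt.
    by apply: rt; apply: le_trans bt; apply: ltW.
  - by rewrite addrAC subrr add0r -ler_pdivlMr.
have : E (ts + h).
  split=> [|s /andP[s0 sh]]; first by rewrite addr_ge0 // ltW.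
  have [ss|ss] := leP ts s; first by apply: agree; rewrite ss.
  have ds : 0 < ts - s by rewrite subr_gt0.
  have [s' [_ Es'] s's] := sup_adherent ds hE; apply: Es'; rewrite s0 ltW //.
  by move: s's; rewrite -/ts; lra.
by move=> /(ub_le_sup (proj2 hE)); rewrite -/ts leNgt ltrDl h0.
Qed.

End Solutions.

Theorem theorem2p1 (R : realType) (d n : nat) (hd : (1 <= d)%N)
    (A : 'rV[R]_n -> 'M[R]_(d, n) -> 'rV[R]_n) (C0 : R) (F : R -> R)
    (hF : forall y : R, 0 <= y -> analytic_at F y)
    (hA : Gen_bound A C0 F)
    (rho : R) (hrho : 0 < rho)
    (u0 : 'rV[R]_d -> 'rV[R]_n) (hu0 : Xspace rho u0) :
  exists C1 : R, 0 < C1 /\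
    let rhot := fun t : R => rho - C1 * t in
    exists u : R -> 'rV[R]_d -> 'rV[R]_n,
      solution A u0 rhot u /\
      forall v : R -> 'rV[R]_d -> 'rV[R]_n, solution A u0 rhot v ->
        forall t : R, 0 <= t -> 0 < rhot t -> v t = u t.
Proof.
pose j0 : 'I_d := Ordinal hd.
have [C1 C10 [u hu]] := existence j0 hF hA hrho hu0.
exists C1; split=> // rhot; exists u; split=> // v hv t t0 rt.
apply: (solution_uniq j0 hF hA _ hv hu t0 rt) => s s' ss'.
by rewrite lerD2l lerN2 ler_wpM2l // ltW.
Qed.
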